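(* Let $n,p\ge 1$ and $k\ge 0$ be integers, and let $\mathbf A,\mathbf B,\mathbf C\in M(p,\mathbb C)$ with $\mathbf A=\mathbf A^\dagger$ and $\mathbf C=\mathbf C^\dagger$. Let $h(x)\in\mathcal{HP}_k(\mathbb R^n)$, $\{u_m\}_{m=0}^\infty\subset\mathbb C^p$, and let $$\psi(x):=\sum_{m=0}^\infty u_m\, l_m^{(k+\frac n2)}\Bigl(\frac{x_1^2+\cdots+x_n^2}{2}\Bigr)h(x).$$ Then $\psi(x)\in L^2(\mathbb R^n)\otimes\mathbb C^p$ and $$\Bigl[\mathbf A\sum_{j=1}^n\Bigl(\mathrm a_j^\dagger \mathrm a_j+\frac12\Bigr)-i\mathbf B\sum_{j=1}^n(\mathrm a_j^\dagger)^2+i\mathbf B^\dagger\sum_{j=1}^n(\mathrm a_j)^2\Bigr]\psi=2\mathbf C\psi$$ hold if and only if $$f(z):=\sum_{m=0}^\infty u_m z^m\in\mathcal H_{k+\frac n2}(\mathbf D)\otimes\mathbb C^p$$ and $$\bigl[-\mathbf A\,\tau_{k+\frac n2}^{\mathbf D}(H)+2\mathbf B\,\tau_{k+\frac n2}^{\mathbf D}(F)-2\mathbf B^\dagger\,\tau_{k+\frac n2}^{\mathbf D}(E)\bigr]f=2\mathbf Cf$$ hold.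
   Context: $\mathbf X^\dagger$ denotes the conjugate transpose of a matrix $\mathbf X$, and $i=\sqrt{-1}$. $\mathbf D=\{z\in\mathbb C: |z|<1\}$. $\mathcal{HP}_k(\mathbb R^n)$ is the space of homogeneous polynomials $h$ of degree $k$ on $\mathbb R^n$ (with complex coefficients) satisfying $\sum_{j=1}^n\partial^2h/\partial x_j^2=0$. The creation and annihilation operators are $\mathrm a_j^\dagger=\frac1{\sqrt2}\bigl(x_j-\frac{\partial}{\partial x_j}\bigr)$ and $\mathrm a_j=\frac1{\sqrt2}\bigl(x_j+\frac{\partial}{\partial x_j}\bigr)$. For $\mu>0$, $(\mu)_0=1$ and $(\mu)_m=\mu(\mu+1)\cdots(\mu+m-1)$ for $m\ge1$; similarly $(-m)_0=1$ and $(-m)_j=(-m)(-m+1)\cdots(-m+j-1)$ for $j\ge1$. For $m\in\mathbb Z_{\ge0}$ and $t>0$, $$l_m^{(\mu)}(t):=i^m\sum_{j=0}^m\frac{(-m)_j}{(\mu)_j\,j!}(2t)^je^{-t}.$$ For $\mu>0$, $\mathcal H_\mu(\mathbf D)$ is the Hilbert space of holomorphic functions $f(z)=\sum_{m\ge0}a_mz^m$ on $\mathbf D$ with $\|f\|_{\mu,\mathbf D}^2:=\sum_{m\ge0}\frac{m!}{(\mu)_m}|a_m|^2<\infty$. The operators $\tau_\mu^{\mathbf D}(\cdot)$, applied componentwise to $\mathbb C^p$-valued functions, are $$\tau_\mu^{\mathbf D}(H)f=-2z\frac{df}{dz}-\mu f,\quad \tau_\mu^{\mathbf D}(E)f=-\frac{df}{dz},\quad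 \tau_\mu^{\mathbf D}(F)f=z^2\frac{df}{dz}+\mu zf.$$
   Formalization: The polynomial h is assumed to be nonzero; for h = 0 the claim fails, since ψ = 0 satisfies the first pair of conditions for every sequence u_m, for example u_m = m! e_1, for which f(z) does not converge on D. *)

(* Defs.v *)
From HB Require Import structures.
From mathcomp Require Import all_boot all_order all_algebra.
From mathcomp Require Import complex.
From mathcomp Require Import -(notations) mpoly.
From mathcomp Require Import all_classical all_reals all_analysis.

Set Implicit Arguments.
Unset Strict Implicit.
Unset Printing Implicit Defensive.

Import Order.TTheory GRing.Theory Num.Theory.
Import numFieldNormedType.Exports.

Local Open Scope classical_set_scope.
Local Open Scope complex_scope.
Local Open Scope sesquilinear_scope.
Local Open Scope ring_scope.

(** The library has the Borel sigma-algebra on [n.-tuple R] and binary products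
    of sigma-finite measures, but no Lebesgue measure on R^n. It is built here by
    recursion on n, as the image of the product of Lebesgue measure on R with
    Lebesgue measure on R^n under [(x, t) |-> x :: t]. *)

Section lebesgue_tuple.
Variable R : realType.

Definition consT n (z : measurableTypeR R * n.-tuple (measurableTypeR R)) :
  n.+1.-tuple (measurableTypeR R) := [tuple of z.1 :: z.2].

Lemma measurable_consT n : measurable_fun setT (@consT n).
Proof. exact: measurable_cons measurable_fst measurable_snd. Qed.

Section step.
Variables (n : nat)
  (m : {sigma_finite_measure set (n.-tuple (measurableTypeR R)) -> \bar R}).

Definition leb_step : set (n.+1.-tuple (measurableTypeR R)) -> \bar R :=
  pushforward (@lebesgue_measure R \x m)%E (@consT n).

Let leb_step0 : leb_step set0 = 0%E.
Proof. by rewrite /leb_step /pushforward preimage_set0 measure0. Qed.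

Let leb_step_ge0 A : (0 <= leb_step A)%E.
Proof. by rewrite /leb_step /pushforward; exact: measure_ge0. Qed.

Let leb_step_sigma_additive : semi_sigma_additive leb_step.
Proof.
move=> F mF tF mUF; rewrite /leb_step /pushforward preimage_bigcup.
have mc A : measurable A -> measurable (@consT n @^-1` A).
  by move=> mA; rewrite -[X in measurable X]setTI; exact: measurable_consT.
apply: measure_semi_sigma_additive.
- by move=> k; exact: mc.
- apply/trivIsetP => /= i j _ _ ij; rewrite -preimage_setI.
  by move/trivIsetP : tF => /(_ _ _ _ _ ij) ->//; rewrite preimage_set0.
- by rewrite -preimage_bigcup; exact: mc.
Qed.

HB.instance Definition _ :=
  isMeasure.Build _ _ _ leb_step leb_step0 leb_step_ge0 leb_step_sigma_additive.

Let leb_step_sigma_finite : sigma_finite setT leb_step.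
Proof.
pose g (t : n.+1.-tuple (measurableTypeR R)) := (thead t, [tuple of behead t]).
have mg : measurable_fun setT g.
  apply/measurable_fun_pairP; split; last exact: measurable_behead.
  exact: measurable_tnth.
have gK (z : measurableTypeR R * n.-tuple (measurableTypeR R)) :
    g (consT z) = z.
  by case: z => x t; rewrite /g; congr pair; apply: val_inj.
have /sigma_finiteP[F [TF ndF Foo]] := sigma_finiteT (@lebesgue_measure R).
have /sigma_finiteP[G [TG ndG Goo]] := sigma_finiteT m.
exists (fun k => g @^-1` (F k `*` G k)) => [|k].
  rewrite -preimage_bigcup (_ : \bigcup_k _ = setT) ?preimage_setT//.
  apply/seteqP; split => // -[x y] _.
  have [i _ Fix] : (\bigcup_k F k) x by rewrite -TF.
  have [j _ Gjy] : (\bigcup_k G k) y by rewrite -TG.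
  exists (maxn i j) => //; split => /=.
  - by move: x Fix; exact/subsetPset/ndF/leq_maxl.
  - by move: y Gjy; exact/subsetPset/ndG/leq_maxr.
have [mF Fk] := Foo k; have [mG Gk] := Goo k; split.
  by rewrite -[X in measurable X]setTI; apply: mg => //; exact: measurableX.
rewrite /leb_step /pushforward -comp_preimage.
rewrite (_ : (g \o @consT n) = id); last exact/funext/gK.
by rewrite preimage_id product_measure1E// lte_mul_pinfty// ge0_fin_numE.
Qed.

HB.instance Definition _ :=
  Measure_isSigmaFinite.Build _ _ _ leb_step leb_step_sigma_finite.

End step.

Fixpoint lebesgue_tuple n :
    {sigma_finite_measure set (n.-tuple (measurableTypeR R)) -> \bar R} :=
  match n with
  | 0 => dirac [tuple]
  | n'.+1 => leb_step (lebesgue_tuple n')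
  end.

End lebesgue_tuple.

(** Points of R^n are row vectors, which carry the normed-space structure used
    for differentiation; measure theory goes through their tuples of coordinates. *)

Section functions_on_Rn.
Variables (R : realType) (n : nat).
Implicit Types (x : 'rV[R]_n) (phi : 'rV[R]_n -> R).

Definition rowT (t : n.-tuple (measurableTypeR R)) : 'rV[R]_n :=
  \row_j (tnth t j : R).

Definition sqnorm x : R := \sum_(j < n) x 0 j ^+ 2.

Definition pderiv (j : 'I_n) phi : 'rV[R]_n -> R :=
  fun x => 'D_(delta_mx 0 j) phi x.

(** All iterated partial derivatives are differentiable, and they decay faster
    than every power of the norm. *)
Definition schwartz phi : Prop :=
  forall s : seq 'I_n,
    (forall x, differentiable (foldr pderiv phi s) x) /\
    (forall m : nat, exists M : R,
       forall x, `|x| ^+ m * `|foldr pderiv phi s x| <= M).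

Variable p : nat.
Implicit Types psi : 'rV[R]_n -> 'cV[R[i]]_p.

Definition measurable_Cp psi : Prop := forall l : 'I_p,
  measurable_fun setT (fun t => complex.Re (psi (rowT t) l 0)) /\
  measurable_fun setT (fun t => complex.Im (psi (rowT t) l 0)).

Definition L2norm2 psi : \bar R :=
  (\int[lebesgue_tuple R n]_t
     (\sum_(l < p) ComplexField.Normc.normc (psi (rowT t) l 0) ^+ 2)%:E)%E.

Definition in_L2 psi : Prop := measurable_Cp psi /\ (L2norm2 psi < +oo)%E.

(** [psi] is the sum of the series [\sum_m F m] in the Hilbert space
    L^2(R^n) (x) C^p. *)
Definition L2_sum (F : nat -> 'rV[R]_n -> 'cV[R[i]]_p) psi : Prop :=
  (fun N : nat => L2norm2 (fun x => psi x - \sum_(m < N) F m x))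
    @ \oo --> 0%E.

(** An element of L^2 need not be differentiable, so differential operators act
    on it in the sense of (tempered, C^p-valued) distributions. These are
    represented by their values on real-valued Schwartz functions, which
    determine their values on the complex-valued ones. *)

Definition vdistribution := ('rV[R]_n -> R) -> 'cV[R[i]]_p.
Implicit Types T : vdistribution.

Definition distr_of psi : vdistribution := fun phi => \col_l
  ((\int[lebesgue_tuple R n]_t (complex.Re (psi (rowT t) l 0) * phi (rowT t)))%R
   +i*
   (\int[lebesgue_tuple R n]_t (complex.Im (psi (rowT t) l 0) * phi (rowT t)))%R).

(** The derivative of a distribution is minus the transpose of [pderiv];
    multiplication by a coordinate is its own transpose. *)
Definition dderiv (j : 'I_n) T : vdistribution := fun phi => - T (pderiv j phi).

Definition dmulx (j : 'I_n) T : vdistribution :=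
  fun phi => T (fun x => x 0 j * phi x).

Definition creation (j : 'I_n) T : vdistribution :=
  fun phi => ((Num.sqrt 2)^-1)%:C *: (dmulx j T phi - dderiv j T phi).

Definition annihilation (j : 'I_n) T : vdistribution :=
  fun phi => ((Num.sqrt 2)^-1)%:C *: (dmulx j T phi + dderiv j T phi).

End functions_on_Rn.

(** [A sum_j (a_j^+ a_j + 1/2) - i B sum_j (a_j^+)^2 + i B^+ sum_j a_j^2], where
    [B^t*] is the conjugate transpose of [B]. *)
Definition oscillator (R : realType) (n p : nat) (A B : 'M[R[i]]_p)
    (T : vdistribution R n p) : vdistribution R n p := fun phi =>
  A *m \sum_(j < n) (creation j (annihilation j T) phi + 2^-1 *: T phi)
  - 'i%C *: (B *m \sum_(j < n) creation j (creation j T) phi)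
  + 'i%C *: (B^t* *m \sum_(j < n) annihilation j (annihilation j T) phi).

Definition harmonic_homog (R : realType) (n k : nat) (h : mpoly.mpoly n R[i]) :
    Prop :=
  h \is mpoly.ishomog1 k mpoly.mdeg /\
  \sum_(j < n) mpoly.mderiv j (mpoly.mderiv j h) = 0.

Definition poly_eval (R : realType) (n : nat) (h : mpoly.mpoly n R[i])
    (x : 'rV[R]_n) : R[i] :=
  mpoly.meval (fun j => (x 0 j)%:C) h.

Definition poch (R : realType) (a : R) (m : nat) : R :=
  \prod_(j < m) (a + j%:R).

Definition lag (R : realType) (mu : R) (m : nat) (t : R) : R[i] :=
  'i%C ^+ m *
  (\sum_(j < m.+1)
     poch (- m%:R) j / (poch mu j * j`!%:R) * (2 * t) ^+ j * expR (- t))%:C.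

Definition psi_term (R : realType) (n p k : nat) (h : mpoly.mpoly n R[i])
    (u : nat -> 'cV[R[i]]_p) (m : nat) : 'rV[R]_n -> 'cV[R[i]]_p := fun x =>
  (lag (k%:R + n%:R / 2) m (sqnorm x / 2) * poly_eval h x) *: u m.

(** Functions on the unit disc are represented by functions on C, of which only
    the values at points of modulus < 1 are used. *)

Section disc.
Variables (R : realType) (mu : R).
Local Notation C := (R[i]^o).
Implicit Types f : C -> C.

Definition in_D (z : C) : Prop := `|z| < 1.

Definition power_sum (a : nat -> C) f : Prop := forall z : C, in_D z ->
  series (fun m => a m * z ^+ m : C) @ \oo --> f z.

(** The squared norm in H_mu(D) of the function with Taylor coefficients [a]. *)
Definition Hmu_norm2 (a : nat -> C) : \bar R :=
  (\sum_(0 <= m <oo)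
     (m`!%:R / poch mu m * ComplexField.Normc.normc (a m) ^+ 2)%:E)%E.

Definition in_Hmu f : Prop :=
  (forall z : C, in_D z -> derivable f z 1) /\
  exists a : nat -> C, power_sum a f /\ (Hmu_norm2 a < +oo)%E.

(** [derive1] is taken over the field [R[i]]: it is the complex derivative. *)
Definition tauH f : C -> C := fun z => - 2 * z * derive1 f z - mu%:C * f z.
Definition tauE f : C -> C := fun z => - derive1 f z.
Definition tauF f : C -> C := fun z => z ^+ 2 * derive1 f z + mu%:C * z * f z.

Variable p : nat.

Definition coordf (F : C -> 'cV[R[i]]_p) (l : 'I_p) : C -> C :=
  fun z => F z l 0.

Definition componentwise (tau : (C -> C) -> C -> C) (F : C -> 'cV[R[i]]_p) :
    C -> 'cV[R[i]]_p :=
  fun z => \col_l tau (coordf F l) z.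

End disc.

(* Main.v *)
(** Write [mu = k + n/2] and [F_m x = l_m (|x|^2/2) h x]. On the [F_m] the three
    operators [\sum_j (a_j^+ a_j + 1/2)], [\sum_j (a_j^+)^2], [\sum_j a_j^2] act
    by [F_m |-> (2m + mu) F_m], [F_m |-> 2i (m + mu) F_(m+1)] and
    [F_m |-> - 2i m F_(m-1)]. As the first is symmetric and the other two are
    adjoint to each other, the [F_m] are orthogonal with
    [|F_m|^2 = m!/(mu)_m |F_0|^2]; hence [psi] is in [L^2] iff [f] is in the
    space [H_mu] of the disc, and each of the two equations amounts to the
    same three-term recurrence for [u].
    On the oscillator side, testing against [F_M] yields the recurrence at [M].
    Conversely, the partial sums of [psi] paired with a Schwartz function
    telescope up to two boundary terms, which tend to 0 because
    [(2m + mu) <F_m, phi> = <F_m, N phi>], with [N] the first operator, is bounded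
    by a multiple of [|F_m|]. *)
Require Import Defs.
From HB Require Import structures.
From mathcomp Require Import all_boot all_order all_algebra.
From mathcomp Require Import complex.
From mathcomp Require Import -(notations) mpoly.
From mathcomp Require Import all_classical all_reals all_analysis.
From mathcomp Require Import measurable_realfun ring lra.
Import Order.TTheory GRing.Theory Num.Theory.
Import numFieldNormedType.Exports.
Set Implicit Arguments.
Unset Strict Implicit.
Unset Printing Implicit Defensive.
Local Open Scope classical_set_scope.
Local Open Scope complex_scope.
Local Open Scope sesquilinear_scope.
Local Open Scope ring_scope.

(** * Square-integrable functions *)

(** Every F_m is a polynomial times the Gaussian exp(-|x|^2/2). Conjugation by the Gaussian turns
    a_j into d_j / sqrt 2 and a_j^+ into (2 x_j - d_j) / sqrt 2, so the action on the F_m becomes an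
    identity between polynomials with complex coefficients. The adjointness relations come from
    integration by parts, which follows the recursive form of the measure: one coordinate at a time,
    by Fubini, under a dominating weight that is a product over the coordinates. Test functions are
    real-valued while the F_m are complex, so the real and imaginary parts of F_m are tested
    separately and recombined into a Hermitian product. As psi and f are asserted to exist, each
    direction has to construct one: psi by completeness of L^2, and f by showing that the weighted
    square-summability of u forces convergence on the whole disc. The hypothesis h != 0 is what
    permits the recurrence to be extracted, |F_M|^2 being a positive multiple of |F_0|^2. If h were
    0, psi = 0 would solve the oscillator side whatever u is. *)

Section square_integrable.
Context d (T : measurableType d) (R : realType).
Variable mu : {measure set T -> \bar R}.
Implicit Types f g : T -> R.

Definition sqintegrable f :=
  measurable_fun setT f /\ (\int[mu]_x (f x ^+ 2)%:E < +oo)%E.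

Lemma sqr_integrable f : sqintegrable f ->
  mu.-integrable setT (fun x => (f x ^+ 2)%:E).
Proof.
move=> [mf lf]; apply/integrableP; split.
  by apply/measurable_EFinP; exact: measurable_funX.
rewrite (eq_integral (fun x => (f x ^+ 2)%:E))// => x _.
by rewrite gee0_abs// lee_fin sqr_ge0.
Qed.

Lemma integrable_sq f : measurable_fun setT f ->
  mu.-integrable setT (fun x => (f x ^+ 2)%:E) -> sqintegrable f.
Proof.
move=> mf /integrableP[_]; split=> //.
rewrite (eq_integral (fun x => `|(f x ^+ 2)%:E|%E))// => x _.
by rewrite gee0_abs// lee_fin sqr_ge0.
Qed.

Lemma mul_integrable f g : sqintegrable f -> sqintegrable g ->
  mu.-integrable setT (fun x => (f x * g x)%:E).
Proof.
move=> Lf Lg; have [mf _] := Lf; have [mg _] := Lg.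
apply: (@le_integrable _ _ _ _ _ _ _
  (fun x => (f x ^+ 2)%:E + (g x ^+ 2)%:E)%E) => //.
- by apply/measurable_EFinP; exact: measurable_funM.
- move=> x _; rewrite -EFinD !abse_EFin lee_fin.
  rewrite [leRHS]ger0_norm ?addr_ge0 ?sqr_ge0// normrM.
  rewrite -(real_normK (num_real (f x))) -(real_normK (num_real (g x))).
  have := sqr_ge0 (`|f x| - `|g x|).
  have := sqr_ge0 (`|f x|); have := sqr_ge0 (`|g x|).
  by rewrite !expr2; nra.
- by apply: integrableD => //; exact: sqr_integrable.
Qed.

Lemma sqintegrableD f g : sqintegrable f -> sqintegrable g ->
  sqintegrable (fun x => f x + g x).
Proof.
move=> Lf Lg; have [mf _] := Lf; have [mg _] := Lg.
apply: integrable_sq; first exact: measurable_funD.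
apply: (eq_integrable _ (fun x => (f x ^+ 2)%:E + ((f x * g x)%:E +
  ((f x * g x)%:E + (g x ^+ 2)%:E)))%E) => //.
  by move=> x _; rewrite -!EFinD; congr EFin; ring.
do 3 (apply: integrableD => //; try exact: sqr_integrable;
  try exact: mul_integrable).
Qed.

Lemma sqintegrableZ c f : sqintegrable f -> sqintegrable (fun x => c * f x).
Proof.
move=> Lf; have [mf _] := Lf; apply: integrable_sq.
  by apply: measurable_funM.
apply: (eq_integrable _ (fun x => (c ^+ 2)%:E * (f x ^+ 2)%:E)%E) => //.
  by move=> x _; rewrite -EFinM exprMn.
by apply: integrableZl => //; exact: sqr_integrable.
Qed.

Definition sqnorm2 f : R := \int[mu]_x (f x ^+ 2).

Lemma sqnorm2_ge0 f : 0 <= sqnorm2 f.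
Proof. by apply: Rintegral_ge0 => x _; exact: sqr_ge0. Qed.

Lemma sqnorm2E f : sqintegrable f ->
  (\int[mu]_x (f x ^+ 2)%:E)%E = (sqnorm2 f)%:E.
Proof.
move=> Lf; rewrite /sqnorm2 /Rintegral fineK//.
by apply: integrable_fin_num => //; exact: sqr_integrable.
Qed.

(** The form s^2 |f|^2 + 2 s t <f, g> + t^2 |g|^2 is the integral of (s f + t g)^2, hence
    nonnegative for all real s and t. One choice of (s, t) suffices in each of the cases |f| = 0 and
    |f| > 0. *)
Lemma cauchy_schwarz_Rintegral f g : sqintegrable f -> sqintegrable g ->
  (\int[mu]_x (f x * g x)) ^+ 2 <= sqnorm2 f * sqnorm2 g.
Proof.
move=> Lf Lg; set c := \int[mu]_x _.
set a := sqnorm2 f; set b := sqnorm2 g.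
have key s t : 0 <= s ^+ 2 * a + 2 * s * t * c + t ^+ 2 * b.
  have I1 := sqr_integrable Lf; have I2 := sqr_integrable Lg.
  have I3 := mul_integrable Lf Lg.
  have -> : s ^+ 2 * a + 2 * s * t * c + t ^+ 2 * b =
      sqnorm2 (fun x => s * f x + t * g x).
    rewrite /sqnorm2 /a /b /c.
    rewrite -RintegralZl// -RintegralZl// -RintegralZl//.
    have J1 : mu.-integrable setT (EFin \o (fun x => s ^+ 2 * f x ^+ 2)).
      exact: (integrableZl _ (s ^+ 2) I1).
    have J2 : mu.-integrable setT (EFin \o (fun x => t ^+ 2 * g x ^+ 2)).
      exact: (integrableZl _ (t ^+ 2) I2).
    have J3 : mu.-integrable setT (EFin \o (fun x => 2 * s * t * (f x * g x))).
      exact: (integrableZl _ (2 * s * t) I3).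
    rewrite -RintegralD// -RintegralD//; last first.
      exact: (integrableD _ J1 J3).
    by apply: eq_Rintegral => x _; ring.
  exact: sqnorm2_ge0.
have a0 : 0 <= a := sqnorm2_ge0 f.
have b0 : 0 <= b := sqnorm2_ge0 g.
have [az|an] := eqVneq a 0.
  suff -> : c = 0 by rewrite expr0n/= mulr_ge0.
  apply/eqP; rewrite -sqrf_eq0; rewrite eq_le sqr_ge0 andbT.
  rewrite leNgt; apply/negP => c0.
  (* With a = 0 these values make the form equal to - b - 2 < 0, which excludes c != 0. *)
  have := key (- (b + 1) / c) 1.
  have cn0 : c != 0 by apply: contraTneq c0 => ->; rewrite expr0n ltxx.
  by rewrite az mulr0 add0r mulr1 -mulrA divfK// expr1n mul1r; lra.
have ap : 0 < a by rewrite lt_def an.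
(* Here the form equals a (a b - c^2) with a positive. *)
have := key (- c) a.
have -> : (- c) ^+ 2 * a + 2 * - c * a * c + a ^+ 2 * b = a * (a * b - c ^+ 2).
  by ring.
by rewrite pmulr_rge0// subr_ge0.
Qed.

End square_integrable.

(** * Completeness of L^2 (Riesz-Fischer) *)

Section L2_completeness.
Context d (T : measurableType d) (R : realType).
Variable mu : {measure set T -> \bar R}.

Lemma geometric_bound_cvg (x : nat -> R) (K : R) :
  (forall j, `|x j.+1 - x j| <= K * 2^-1 ^+ j) -> cvgn x.
Proof.
move=> h; pose y := [sequence x n.+1 - x n]_n.
have : cvgn (series y).
  apply: normed_cvg; apply: (series_le_cvg (v_ := geometric K 2^-1)) => //.
  - by move=> n; exact: normr_ge0.
  - by move=> n /=; exact: le_trans (normr_ge0 _) (h n).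
  - by apply: is_cvg_geometric_series; rewrite ger0_norm// invf_lt1// ltr1n.
move=> /cvg_ex[l hl]; apply/cvg_ex; exists (l + x 0%N).
have xE : (fun n => series y n + x 0%N) = x.
  by apply/funext => n; rewrite seriesEnat /y /= telescope_sumr// subrK.
rewrite -[X in X @ _]xE; apply: cvgD; [exact: hl|exact: cvg_cst].
Qed.

(** The series of 4^j (x_(j+1) - x_j)^2 has integral at most the sum of 4^j 8^-j = 2^-j, so it is
    finite almost everywhere. Where its value is C, each increment is at most (1 + C) 2^-j; the
    bound 1 + C replaces the square root of C. *)
Lemma ae_cvg_of_sqr_bound (x : nat -> T -> R) :
  (forall j, measurable_fun setT (x j)) ->
  (forall j, (\int[mu]_t ((x j.+1 t - x j t) ^+ 2)%:E <= (8^-1 ^+ j)%:E)%E) ->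
  {ae mu, forall t, cvgn (x ^~ t)}.
Proof.
move=> mx hx.
pose f j t := (4 ^+ j * (x j.+1 t - x j t) ^+ 2)%:E : \bar R.
have mf j : measurable_fun setT (f j).
  apply/measurable_EFinP; apply: measurable_funM => //.
  by apply: measurable_funX; exact: measurable_funB.
have f0 j t : setT t -> (0 <= f j t)%E.
  by move=> _; rewrite lee_fin mulr_ge0 ?sqr_ge0 ?exprn_ge0.
have fint : (\int[mu]_t \sum_(j <oo) f j t < +oo)%E.
  rewrite integral_nneseries//.
  apply: (@le_lt_trans _ _ (\sum_(0 <= j <oo) (2^-1 ^+ j)%:E)%E).
    apply: lee_nneseries => [j _ _|j _].
      by apply: integral_ge0 => t _; exact: f0.
    rewrite /f; under eq_integral do rewrite EFinM.
    rewrite ge0_integralZl//; first last.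
    - by move=> t _; rewrite lee_fin sqr_ge0.
    - apply/measurable_EFinP; apply: measurable_funX; exact: measurable_funB.
    have -> : (2^-1 ^+ j)%:E = ((4 ^+ j)%:E * (8^-1 ^+ j)%:E :> \bar R)%E.
      rewrite -EFinM -exprMn; congr (_ ^+ _)%:E; lra.
    by apply: lee_pmul => //; rewrite ?lee_fin ?exprn_ge0// integral_ge0// => t _;
       rewrite lee_fin sqr_ge0.
  have cg : series (geometric (1 : R) 2^-1) @ \oo --> (1 * (1 - 2^-1)^-1 : R).
    by apply: cvg_geometric_series; rewrite ger0_norm// invf_lt1// ltr1n.
  rewrite (_ : (\sum_(0 <= j <oo) _)%E = (1 * (1 - 2^-1)^-1)%:E) ?ltry//.
  apply/cvg_lim => //.
  have -> : (fun n => \sum_(0 <= j < n) (2^-1 ^+ j : R)%:E)%E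
      = EFin \o series (geometric (1 : R) 2^-1).
    apply/funext => n /=; rewrite sumEFin /series /=; congr EFin.
    by apply: eq_bigr => i _; rewrite mul1r.
  by apply: cvg_EFin; [exact: nearW|exact: cg].
have : mu.-integrable setT (fun t => \sum_(j <oo) f j t)%E.
  apply/integrableP; split.
    by apply: ge0_emeasurable_sum => [k t Dt _|k _]; [exact: f0|exact: mf].
  rewrite (eq_integral (fun t => \sum_(j <oo) f j t)%E)// => t _.
  by rewrite gee0_abs//; apply: nneseries_ge0 => j _ _; exact: f0.
move=> /(integrable_ae measurableT); apply: filterS => t /(_ I) tfin.
pose C := fine (\sum_(j <oo) f j t)%E.
have C0 : 0 <= C.
  by rewrite fine_ge0//; apply: nneseries_ge0 => j _ _; exact: f0.
apply: (@geometric_bound_cvg _ (1 + C)) => j.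
have : (f j t <= C%:E)%E.
  rewrite fineK// (nneseriesD1 (n := j))//= => [|i _]; last exact: f0.
  by rewrite leeDl//; apply: nneseries_ge0 => i _ _; exact: f0.
rewrite lee_fin => hC.
have : (2 ^+ j * `|x j.+1 t - x j t|) ^+ 2 <= C.
  rewrite exprMn real_normK ?num_real// -exprM mulnC exprM.
  by rewrite (_ : 2 ^+ 2 = 4 :> R)//; lra.
set y := 2 ^+ j * _ => hy.
have y1 : y <= 1 + C.
  have [//|yC] := leP y (1 + C).
  suff : y <= C by lra.
  apply: le_trans hy; rewrite expr2 ler_peMl//; lra.
have -> : `|x j.+1 t - x j t| = y * 2^-1 ^+ j.
  by rewrite /y mulrAC exprVn mulfV ?mul1r// expf_neq0// pnatr_eq0.
by rewrite ler_wpM2r// exprn_ge0.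
Qed.

(** A fast Cauchy subsequence converges almost everywhere by [ae_cvg_of_sqr_bound], and Fatou's
    lemma along it bounds the distance of every late x_i from its limit. *)
Lemma L2_complete (x : nat -> T -> R) :
  (forall j, measurable_fun setT (x j)) ->
  (forall e : R, 0 < e -> exists N, forall i j, (N <= i)%N -> (N <= j)%N ->
    (\int[mu]_t ((x i t - x j t) ^+ 2)%:E <= e%:E)%E) ->
  exists g : T -> R, measurable_fun setT g /\
    (forall e : R, 0 < e -> exists N, forall i, (N <= i)%N ->
      (\int[mu]_t ((x i t - g t) ^+ 2)%:E <= e%:E)%E).
Proof.
move=> mx hx.
have e8 j : 0 < 8^-1 ^+ j :> R by rewrite exprn_gt0// invr_gt0.
have [F HF] : {F : nat -> nat & forall j i k, (F j <= i)%N -> (F j <= k)%N ->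
    (\int[mu]_t ((x i t - x k t) ^+ 2)%:E <= (8^-1 ^+ j)%:E)%E}.
  by apply: (choice (fun j => hx _ (e8 j))).
(* Summing the successors of the thresholds makes N nondecreasing, with N j >= F j and N j >= j; the
   last inequality lets the subsequence pass any given index. *)
pose N j := (\sum_(i < j.+1) (F i).+1)%N.
have FN j : (F j <= N j)%N by rewrite /N big_ord_recr/= -ltnS ltnS ltnW// leq_addl.
have NS j : (N j <= N j.+1)%N by rewrite [N j.+1]/N big_ord_recr/= leq_addr.
have jN j : (j <= N j)%N.
  elim: j => // j IH; rewrite [N j.+1]/N big_ord_recr/=.
  by rewrite -/(N j) addnS ltnS (leq_trans IH)// leq_addr.
pose y j := x (N j).
have hae : {ae mu, forall t, cvgn (y ^~ t)}.
  apply: ae_cvg_of_sqr_bound => [j|j]; first exact: mx.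
  by apply: HF; [exact: leq_trans (FN j) (NS j)|exact: FN].
(* The upper limit is defined and measurable everywhere, and agrees with the limit wherever the
   subsequence converges. *)
pose g t := fine (limn_esup (fun j => (y j t)%:E)).
have mg : measurable_fun setT g.
  apply: measurableT_comp; first exact: fine_measurable.
  by apply: measurable_fun_limn_esup => j; apply/measurable_EFinP; exact: mx.
have gE t : cvgn (y ^~ t) -> y ^~ t @ \oo --> g t.
  move=> /cvg_ex[l hl]; suff -> : g t = l by [].
  have : (fun j => (y j t)%:E) @ \oo --> l%:E by apply: cvg_EFin; [exact: nearW|exact: hl].
  by rewrite /g => /cvg_limn_einf_sup[_ ->].
exists g; split=> // e e0.
have [N0 hN0] := hx _ e0; exists N0 => i Ni.
pose h j t := ((x i t - y j t) ^+ 2)%:E : \bar R.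
have mh j : measurable_fun setT (h j).
  apply/measurable_EFinP; apply: measurable_funX; apply: measurable_funB => //; exact: mx.
have h0 j t : setT t -> (0 <= h j t)%E by rewrite lee_fin sqr_ge0.
have := fatou mu measurableT mh h0.
rewrite (ae_eq_integral (fun t => ((x i t - g t) ^+ 2)%:E))//; first last.
- apply: filterS hae => t ct _.
  have : (fun j => h j t) @ \oo --> ((x i t - g t) ^+ 2)%:E.
    apply: cvg_EFin; first exact: nearW.
    rewrite /comp /h /=.
    have hB : (fun j => x i t - y j t) @ \oo --> x i t - g t.
      by apply: cvgB; [exact: cvg_cst|exact: gE].
    rewrite expr2 (_ : (fun j => _) =
      (fun j => (x i t - y j t) * (x i t - y j t))); last exact/funext.
    by apply: cvgM.
  by move=> /cvg_limn_einf_sup[-> _].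
- apply/measurable_EFinP; apply: measurable_funX; apply: measurable_funB => //; exact: mx.
- apply: (emeasurable_fun_cvg (fun n t => einfs (h ^~ t) n)).
    by move=> n; exact: measurable_fun_einfs.
  by move=> t _; rewrite limn_einf_lim; exact: is_cvg_einfs.
move=> /le_trans; apply.
rewrite limn_einf_lim; apply: lime_le; first exact: is_cvg_einfs.
near=> j.
apply: (@le_trans _ _ (\int[mu]_t h (maxn j N0) t)%E).
  by apply: ereal_inf_lbound; exists (maxn j N0) => //=; exact: leq_maxl.
apply: hN0 => //; apply: leq_trans (jN _); exact: leq_maxr.
Unshelve. all: by end_near. Qed.

End L2_completeness.

(** * Integration over R^n *)

Section whole_line.
Context (R : realType).
Local Notation leb := (@lebesgue_measure R).

Lemma integrable_oneDsqrV :
  leb.-integrable setT (fun x : R => (oneDsqr x)^-1%:E).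
Proof.
apply/integrableP; split.
  apply/measurable_EFinP; apply: continuous_measurable_fun.
  exact: continuous_oneDsqrV.
rewrite (eq_integral (fun x : measurableTypeR R => ((oneDsqr x)^-1)%:E)); last first.
  by move=> x _; rewrite gee0_abs// lee_fin invr_ge0 (le_trans ler01)// oneDsqr_ge1.
rewrite (@ge0_symfun_integralT R (fun x => (oneDsqr x)^-1)).
- rewrite (_ : [set x | 0 <= x] = `[0%R, +oo[%classic); last first.
    by apply/seteqP; split => x /=; rewrite in_itv/= ?andbT.
  by rewrite integral0y_oneDsqr -EFinM ltry.
- by move=> x; rewrite invr_ge0 (le_trans ler01)// oneDsqr_ge1.
- exact: continuous_oneDsqrV.
- by move=> x; rewrite /= /oneDsqr sqrrN.
Qed.

Lemma oneDsqrV_gt0 (x : R) : 0 < (oneDsqr x)^-1.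
Proof. by rewrite invr_gt0 (lt_le_trans ltr01)// oneDsqr_ge1. Qed.

(** The bound by a multiple of (1 + s^2)^-1 serves twice: it dominates the truncations of f to
    [-(n+1), n+1], and it makes the boundary values of F in the fundamental theorem of calculus tend
    to 0. *)
Lemma integral_derive_eq0 (F f : R -> R) (M : R) :
  (forall s : R, is_derive s 1 F (f s)) -> continuous f ->
  (forall s, `|F s| <= M * (oneDsqr s)^-1) ->
  (forall s, `|f s| <= M * (oneDsqr s)^-1) ->
  (\int[leb]_s (f s)%:E = 0)%E.
Proof.
move=> dF cf bF bf.
have M0 : 0 <= M.
  have := le_trans (normr_ge0 _) (bF 0); rewrite pmulr_lge0//.
have mf : measurable_fun setT f by exact: continuous_measurable_fun.
pose fn (n : nat) (s : R) := ((f \_ `[(- n.+1%:R), n.+1%:R]) s)%:E.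
have dom : leb.-integrable setT (fun s : R => (M * (oneDsqr s)^-1)%:E).
  exact: integrableZl integrable_oneDsqrV.
have [] := @dominated_convergence _ _ _ leb setT measurableT fn (EFin \o f)
   (fun s : R => (M * (oneDsqr s)^-1)%:E) _ _ _ dom.
- move=> n; apply/measurable_EFinP.
  by apply/(measurable_restrict _ _ _) => //; exact: measurable_funTS.
- exact/measurable_EFinP.
- apply: aeW => s _; apply: cvg_near_cst; rewrite /fn.
  near=> n; rewrite /= patchE ifT// inE/= in_itv/= -ler_norml.
  rewrite (@le_trans _ _ n%:R)//; last by rewrite ler_nat.
  near: n; exact: nbhs_infty_ger.
- apply: aeW => s n _; rewrite /fn patchE; case: ifPn => _.
    by rewrite lee_fin.
  rewrite abse_EFin normr0 lee_fin mulr_ge0//.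
move=> _ _ cv.
have FE n : (\int[leb]_x fn n x = (F n.+1%:R)%:E - (F (- n.+1%:R))%:E)%E.
  rewrite (_ : fn n = (EFin \o f) \_ `[(- n.+1%:R), n.+1%:R]); last first.
    by rewrite restrict_EFin.
  rewrite -integral_mkcond; apply: continuous_FTC2.
  - by rewrite (@lt_trans _ _ 0)// ?oppr_lt0.
  - exact: continuous_subspaceT.
  - have cF : continuous F.
      move=> s; apply/differentiable_continuous; rewrite -derivable1_diffP.
      by have [] := dF s.
    split; first by move=> s _; have [] := dF s.
    + by apply: cvg_at_right_filter; exact: cF.
    + by apply: cvg_at_left_filter; exact: cF.
  - by move=> s _; rewrite derive1E; have [_ ->] := dF s.
have : (fun n => \int[leb]_x fn n x)%E @ \oo --> 0%E.
  under eq_fun do rewrite FE.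
  apply: cvg_EFin; first exact: nearW.
  have FN0 (e : nat -> R) : (forall n, `|e n| = n.+1%:R) -> F \o e @ \oo --> (0 : R).
    move=> he; apply/norm_cvg0P.
    apply: (@squeeze_cvgr _ _ _ _ (cst 0) (fun n => M * n.+1%:R^-1)).
    - near=> n; rewrite normr_ge0/=.
      apply: le_trans (bF _) _; rewrite ler_wpM2l// lef_pV2 ?posrE//.
      rewrite /oneDsqr -real_normK ?num_real// he.
      rewrite expr2 (@le_trans _ _ (n.+1%:R * n.+1%:R))//.
        by rewrite ler_peMl// ler1n.
      by rewrite lerDr.
    - exact: cvg_cst.
    - rewrite -[X in _ --> X](mulr0 M); apply: cvgM; first exact: cvg_cst.
      exact: cvg_harmonic.
  rewrite -[X in _ --> X](subr0 0).
  apply: cvgB; first by apply: (FN0 (fun n => n.+1%:R)) => n; rewrite ger0_norm.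
  by apply: (FN0 (fun n => - n.+1%:R)) => n; rewrite normrN ger0_norm.
move=> c0; exact: (cvg_unique _ cv c0).
Unshelve. all: by end_near. Qed.

End whole_line.

(** * Iterated integrals over tuples and vanishing of integrals of partial derivatives *)

Section lebesgue_tuple_integral.
Context (R : realType).
Local Notation leb := (@lebesgue_measure R).
Local Notation tup n := (n.-tuple (measurableTypeR R)).
Local Notation lebn n := (lebesgue_tuple R n).

Lemma lebesgue_tupleS n (A : set (tup n.+1)) :
  lebn n.+1 A = (leb \x lebn n)%E (@consT R n @^-1` A).
Proof. by []. Qed.

Lemma ge0_integral_tupleS n (f : tup n.+1 -> \bar R) :
  measurable_fun setT f -> (forall t, 0 <= f t)%E ->
  (\int[lebn n.+1]_t f t = \int[leb]_x \int[lebn n]_t f (consT (x, t)))%E.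
Proof.
move=> mf f0.
transitivity (\int[(leb \x lebn n)%E]_z f (consT z))%E.
  rewrite -[in RHS](preimage_setT (@consT R n)).
  rewrite -(ge0_integral_pushforward (@measurable_consT R n))//.
rewrite (@fubini_tonelli1 _ _ _ _ _ leb (lebn n) (f \o @consT R n))//.
  by apply: measurableT_comp => //; exact: measurable_consT.
by move=> z; exact: f0.
Qed.

Lemma integrable_tupleS n (f : tup n.+1 -> R) :
  (lebn n.+1).-integrable setT (EFin \o f) ->
  (leb \x lebn n)%E.-integrable setT (EFin \o (f \o @consT R n)).
Proof.
move=> /integrableP[mf lf]; apply/integrableP; split.
  rewrite compA; apply: measurableT_comp => //; exact: measurable_consT.
apply: le_lt_trans lf; rewrite le_eqVlt; apply/orP; left; apply/eqP.
rewrite -[in LHS](preimage_setT (@consT R n)).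
rewrite -(ge0_integral_pushforward (@measurable_consT R n) _ (f := fun t => `|(f t)%:E|%E))//.
exact: measurableT_comp.
Qed.

Lemma integral_tupleS n (f : tup n.+1 -> R) :
  (lebn n.+1).-integrable setT (EFin \o f) ->
  (\int[lebn n.+1]_t (f t)%:E =
   \int[(leb \x lebn n)%E]_z (f (consT z))%:E)%E.
Proof.
move=> If; have [mf _] := integrableP _ _ _ If.
have If' := integrable_tupleS If.
rewrite -[in RHS](preimage_setT (@consT R n)).
by rewrite -(integral_pushforward (@measurable_consT R n) mf) ?preimage_setT.
Qed.

(** An integrable dominating function in product form: fixing one coordinate leaves the weight of
    the others times a constant, as an induction on n by Fubini requires. *)
Definition cauchy_weight n (t : tup n) : R := \prod_(y <- t) (oneDsqr y)^-1.

Lemma cauchy_weight_gt0 n (t : tup n) : 0 < cauchy_weight t.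
Proof. by apply: prodr_gt0 => y _; exact: oneDsqrV_gt0. Qed.

Lemma cauchy_weightS n (x : R) (t : tup n) :
  cauchy_weight (consT (x, t)) = (oneDsqr x)^-1 * cauchy_weight t.
Proof. by rewrite /cauchy_weight big_cons. Qed.

Lemma measurable_cauchy_weight n : measurable_fun setT (@cauchy_weight n).
Proof.
rewrite (_ : @cauchy_weight n = fun t => \prod_(i < n) (oneDsqr (tnth t i))^-1).
  apply: measurable_prod => i _.
  apply: (measurableT_comp (f := fun y : R => (oneDsqr y)^-1)).
    by apply: continuous_measurable_fun; exact: continuous_oneDsqrV.
  exact: measurable_tnth.
by apply/funext => t; rewrite /cauchy_weight big_tuple.
Qed.

Lemma integrable_cauchy_weight n :
  (lebn n).-integrable setT (EFin \o @cauchy_weight n).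
Proof.
apply/integrableP; split.
  apply/measurable_EFinP; exact: measurable_cauchy_weight.
rewrite (eq_integral (EFin \o @cauchy_weight n)); last first.
  by move=> t _; rewrite gee0_abs// lee_fin ltW// cauchy_weight_gt0.
elim: n => [|n IH].
  rewrite [X in (X < _)%E](_ : _ = \int[dirac [tuple]]_t (EFin \o @cauchy_weight 0) t)%E//.
  rewrite integral_dirac//; first by rewrite diracT mul1e ltry.
  by apply/measurable_EFinP; exact: measurable_cauchy_weight.
rewrite ge0_integral_tupleS//; first last.
- by move=> t; rewrite lee_fin ltW// cauchy_weight_gt0.
- by apply/measurable_EFinP; exact: measurable_cauchy_weight.
under eq_integral => x _.
  under eq_integral do rewrite /= cauchy_weightS EFinM.
  rewrite ge0_integralZl//; first last.
  - by move=> t _; rewrite lee_fin ltW// cauchy_weight_gt0.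
  - by apply/measurable_EFinP; exact: measurable_cauchy_weight.
  over.
rewrite /= ge0_integralZr//; first last.
- by apply: integral_ge0 => t _; rewrite lee_fin ltW// cauchy_weight_gt0.
- by have [] := integrableP _ _ _ (integrable_oneDsqrV R).
apply: lte_mul_pinfty.
- by apply: integral_ge0 => x _; rewrite lee_fin ltW// oneDsqrV_gt0.
- by apply: integrable_fin_num => //; exact: integrable_oneDsqrV.
- exact: IH.
Qed.

Lemma integrable_weight_bound n (g : tup n -> R) (M : R) :
  measurable_fun setT g -> (forall t, `|g t| <= M * cauchy_weight t) ->
  (lebn n).-integrable setT (EFin \o g).
Proof.
move=> mg bg; apply: (@le_integrable _ _ _ _ _ _ _
   (fun t => (M * cauchy_weight t)%:E)) => //.
- exact/measurable_EFinP.
- by move=> t _; rewrite /= lee_fin (le_trans (bg t))// ler_norm.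
- exact: integrableZl (integrable_cauchy_weight n).
Qed.

Definition tupd n (t : tup n) (j : 'I_n) (s : R) : tup n :=
  [tuple if i == j then s else tnth t i | i < n].

Lemma tupd0 n (x : R) (t : tup n) (s : R) :
  tupd (consT (x, t)) ord0 s = consT (s, t).
Proof.
apply: eq_from_tnth => i; rewrite tnth_mktuple.
have [i' ->|->] := fintype.unliftP ord0 i; last by rewrite tnth0.
by rewrite eq_sym (negPf (neq_lift _ _)) !tnthS.
Qed.

Lemma tupdS n (x : R) (t : tup n) (j : 'I_n) (s : R) :
  tupd (consT (x, t)) (lift ord0 j) s = consT (x, tupd t j s).
Proof.
apply: eq_from_tnth => i; rewrite tnth_mktuple.
have [i' ->|->] := fintype.unliftP ord0 i; last by rewrite !tnth0.
by rewrite !tnthS tnth_mktuple (inj_eq lift_inj).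
Qed.

(** Induction on n. If j is the first coordinate, the inner integral is taken over it and vanishes
    by [integral_derive_eq0]. Otherwise the inner integral is over the tail and vanishes by
    induction, the weight factor of the fixed first coordinate being absorbed into M.
    Differentiability is expressed along s |-> g (tupd t j s), so that tuples need no differential
    structure. *)
Lemma integral_partial_eq0 n (g dg : tup n -> R) (j : 'I_n) (M : R) :
  measurable_fun setT dg ->
  (forall t (s : R), is_derive s 1 (fun s : R => g (tupd t j s)) (dg (tupd t j s))) ->
  (forall t, continuous (fun s : R => dg (tupd t j s))) ->
  (forall t, `|g t| <= M * cauchy_weight t) ->
  (forall t, `|dg t| <= M * cauchy_weight t) ->
  (\int[lebn n]_t (dg t)%:E = 0)%E.
Proof.
elim: n g dg j M => [? ? []//|n IH] g dg j M mdg ddg cdg bg bdg.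
have I1 := integrable_weight_bound mdg bdg.
rewrite integral_tupleS//; have I2 := integrable_tupleS I1.
have [j' jE|j0] := fintype.unliftP ord0 j.
- rewrite -(integral12_prod_meas1 I2) integral0_eq// => x _.
  apply: (IH (fun t => g (consT (x, t))) _ j' (M * (oneDsqr x)^-1)).
  + apply: (measurableT_comp (f := dg)); first exact: mdg.
    apply: (measurableT_comp (f := @consT R n)); first exact: measurable_consT.
    exact: pair1_measurable.
  + move=> t s; have := ddg (consT (x, t)) s.
    by rewrite jE; under eq_fun do rewrite tupdS; rewrite tupdS.
  + move=> t; have := cdg (consT (x, t)); rewrite jE.
    by under eq_fun do rewrite tupdS.
  + by move=> s; rewrite (le_trans (bg _))// cauchy_weightS mulrA.
  + by move=> s; rewrite (le_trans (bdg _))// cauchy_weightS mulrA.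
- rewrite -(integral21_prod_meas1 I2) integral0_eq// => t _.
  apply: (@integral_derive_eq0 _ (fun x => g (consT (x, t))) _ (M * cauchy_weight t)).
  + move=> s; have := ddg (consT (0, t)) s.
    by rewrite j0; under eq_fun do rewrite tupd0; rewrite tupd0.
  + have := cdg (consT (0, t)); rewrite j0.
    by under eq_fun do rewrite tupd0.
  + by move=> s; rewrite (le_trans (bg _))// cauchy_weightS [_^-1 * _]mulrC mulrA.
  + by move=> s; rewrite (le_trans (bdg _))// cauchy_weightS [_^-1 * _]mulrC mulrA.
Qed.

End lebesgue_tuple_integral.

(** * Measurability and positivity: from row vectors to tuples *)

Section borel_tuple0.
Context (R : realType) (n : nat).
Local Notation tup := (n.-tuple (measurableTypeR R)).

Lemma tnth_rowT (t : tup) (i : 'I_n) : rowT t 0 i = tnth t i.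
Proof. by rewrite mxE. Qed.

Definition tuple_of_row (x : 'rV[R]_n) : tup := [tuple x 0 i | i < n].

Lemma rowTK : cancel (@rowT R n) tuple_of_row.
Proof. by move=> t; apply: eq_from_tnth => i; rewrite tnth_mktuple mxE. Qed.

Lemma rowT_box_measurable (c : 'rV[R]_n) (e : R) :
  measurable [set t : tup | forall i, `|c 0 i - tnth t i| < e].
Proof.
have -> : [set t : tup | forall i, `|c 0 i - tnth t i| < e] =
    \big[setI/setT]_(i < n) ((fun t : tup => `|c 0 i - tnth t i|) @^-1` `]-oo, e[).
  apply/seteqP; split => t /=.
    by move=> h; elim/big_ind: _ => // i _; rewrite /= in_itv/=.
  move=> h i; move: h; rewrite (bigD1 i)//= => -[] /=.
  by rewrite in_itv/=.
apply: bigsetI_measurable => i _; rewrite -[X in measurable X]setTI.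
have : measurable_fun setT (fun t : tup => `|c 0 i - tnth t i|).
  apply: measurableT_comp => //; apply: measurable_funB => //.
  exact: measurable_tnth.
by apply => //; exact: measurable_itv.
Qed.

End borel_tuple0.

Lemma lebesgue_tuple_box_gt0 (R : realType) n (c : 'I_n -> R) (e : R) : 0 < e ->
  (0 < lebesgue_tuple R n [set t | forall i, (`|c i - tnth t i| < e)%R])%E.
Proof.
move=> e0; elim: n c => [|n IH] c.
  by rewrite [X in (_ < X)%E]diracE mem_set ?lte01// => -[].
rewrite lebesgue_tupleS (_ : _ @^-1` _ =
    `](c ord0 - e), (c ord0 + e)[%classic `*`
    [set t | forall i, `|c (lift ord0 i) - tnth t i| < e]); last first.
  apply/seteqP; split => -[x t] /=.
    move=> h; split.
      by have := h ord0; rewrite tnth0 in_itv/= -ltr_distl distrC.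
    by move=> i; have := h (lift ord0 i); rewrite tnthS.
  move=> [hx ht] i; have [i' ->|->] := fintype.unliftP ord0 i.
    by rewrite tnthS.
  by rewrite tnth0 distrC ltr_distl; move: hx; rewrite in_itv.
rewrite product_measure1E//; last first.
  have := @rowT_box_measurable R n (\row_i c (lift ord0 i)) e.
  by under eq_set do under eq_forall do rewrite mxE.
apply: mule_gt0; last exact: IH.
rewrite [X in (_ < X)%E](_ : _ = (e + e)%:E); first by rewrite lte_fin addr_gt0.
apply: etrans (lebesgue_measure_itv _) _ => /=.
rewrite lte_fin ifT; last by lra.
by rewrite -EFinB; congr EFin; ring.
Qed.

Section borel_tuple.
Context (R : realType) (n : nat).
Local Notation tup := (n.-tuple (measurableTypeR R)).

(** An open set is the union of the boxes with rational centre and radius 1/(k+1) that it contains,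
    and there are countably many such boxes. This links the topology of row vectors to the
    sigma-algebra of tuples. *)
Lemma open_rowT_measurable (O : set 'rV[R]_n) :
  open O -> measurable (@rowT R n @^-1` O).
Proof.
move=> oO.
pose box (a : n.-tuple rat * nat) : set tup :=
  [set t : tup | forall i, `|(\row_i ratr (tnth a.1 i) : 'rV[R]_n) 0 i - tnth t i|
     < a.2.+1%:R^-1].
pose F (a : n.-tuple rat * nat) : set tup :=
  if `[< box a `<=` @rowT R n @^-1` O >] then box a else set0.
have -> : @rowT R n @^-1` O = \bigcup_a F a.
  apply/seteqP; split => t; last first.
    by move=> [a _]; rewrite /F; case: ifPn => // /asboolP; exact.
  move=> /= Ot; have := open_nbhs_nbhs (conj oO Ot).
  rewrite -nbhs_ballE => -[e /= e0 he].
  (* The box is centred at a rational point near t rather than at t, so two deviations have to fit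
     into e. *)
  have [k hk] : exists k : nat, k.+1%:R^-1 < e / 2.
    have [k kn] := ltr_add_invr (divr_gt0 e0 (@ltr0n R 2)).
    by exists k; move: kn; rewrite add0r.
  have k0 : 0 < k.+1%:R^-1 :> R by rewrite invr_gt0.
  have /choice[q hq] : forall i : 'I_n, exists q : rat,
      `|ratr q - tnth t i| < k.+1%:R^-1.
    move=> i; have /rat_in_itvoo[q] : tnth t i < tnth t i + k.+1%:R^-1.
      by rewrite ltrDl.
    rewrite in_itv/= => /andP[q1 q2]; exists q.
    by rewrite ger0_norm ?subr_ge0 ?ltW// ltrBlDl.
  exists ([tuple q i | i < n], k) => //; rewrite /F ifT.
    by move=> i /=; rewrite mxE tnth_mktuple; exact: hq.
  apply/asboolP => t' /= ht'; apply: he; split => // i j.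
  rewrite !mxE /ball /=; move: (ht' j) (hq j); rewrite mxE tnth_mktuple => h1 h2.
  rewrite (_ : _ - _ = (ratr (q j) - tnth t' j) - (ratr (q j) - tnth t j)); last ring.
  apply: le_lt_trans (ler_normB _ _) _.
  apply: lt_trans (ltrD h1 h2) _.
  by rewrite [ltRHS]splitr ltrD.
apply: countable_bigcupT_measurable => // a; rewrite /F.
by case: ifPn => // _; exact: rowT_box_measurable.
Qed.

Lemma continuous_rowT_measurable (g : 'rV[R]_n -> R) :
  continuous g -> measurable_fun setT (fun t : tup => g (rowT t)).
Proof.
move=> /continuousP cg; apply: (measurability _ (RGenOpens.measurableE R)).
move=> _ [_ [a [b ->]] <-]; rewrite setTI.
apply: (@open_rowT_measurable (g @^-1` `]a, b[)).
by apply: cg; exact: interval_open.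
Qed.

(** Continuity keeps g above g x0 / 2 on a box around x0, and boxes have positive measure. *)
Lemma integral_gt0_of_pos (g : 'rV[R]_n -> R) (x0 : 'rV[R]_n) :
  continuous g -> (forall x, 0 <= g x) -> 0 < g x0 ->
  (0 < \int[lebesgue_tuple R n]_t (g (rowT t))%:E)%E.
Proof.
move=> cg g0 gx0.
have [e e0 he] : exists2 e : R, 0 < e &
    forall x : 'rV[R]_n, (forall i, `|x0 0 i - x 0 i| < e) -> g x0 / 2 < g x.
  have /nbhs_ballP[e /= e0 he] : nbhs x0 [set x | g x0 / 2 < g x].
    by apply: (cvgr_gt (g x0) (cg x0)); lra.
  exists e => // x hx; apply: he; split=> // i j; rewrite ord1; exact: hx.
have mB := rowT_box_measurable x0 e; set B := [set t | _] in mB.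
have mg : measurable_fun setT (fun t : tup => (g (rowT t))%:E).
  by apply/measurable_EFinP; exact: continuous_rowT_measurable.
apply: (@lt_le_trans _ _ (\int[lebesgue_tuple R n]_(t in B) (g x0 / 2)%:E)%E).
  rewrite integral_cst// mule_gt0//; first by rewrite lte_fin; lra.
  exact: lebesgue_tuple_box_gt0.
apply: (@le_trans _ _ (\int[lebesgue_tuple R n]_(t in B) (g (rowT t))%:E)%E).
  apply: ge0_le_integral => //.
  - by move=> t _; rewrite lee_fin; lra.
  - exact: measurable_funTS.
  - move=> t Bt; rewrite lee_fin ltW//; apply: he => i.
    by rewrite mxE; exact: Bt.
by apply: ge0_subset_integral => // t _; rewrite lee_fin.
Qed.

End borel_tuple.

(** * The ladder relations for Laguerre times harmonic polynomials *)

Section harmonic_ladder.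
Context (K : numFieldType) (n k : nat).
Local Notation MP := (mpoly.mpoly n K).
Implicit Types (p q : MP) (m : nat).

Definition mvar (j : 'I_n) : MP := mpoly.mpolyX K (mpoly.mnm1 j).
Local Notation dj := (@mpoly.mderiv n K).
Local Notation mC := (@mpoly.mpolyC n K).

Definition msqnorm : MP := \sum_j mvar j ^+ 2.
Definition laplacian p : MP := \sum_j dj j (dj j p).
Definition euler p : MP := \sum_j mvar j * dj j p.

Lemma mderiv_var i j : dj i (mvar j) = (i == j)%:R.
Proof.
rewrite /mvar mpoly.mderivX mpoly.mnm1E eq_sym.
have [->|] := eqVneq i j; last by rewrite scale0r.
rewrite scale1r -mpoly.mpolyX0; congr (mpoly.mpolyX _ _).
by apply/mpoly.mnmP => i'; rewrite mpoly.mnmBE mpoly.mnm0E subnn.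
Qed.

Lemma natZ (a : nat) p : a%:R * p = a%:R *: p.
Proof. by rewrite -(rmorph_nat mC a) mpoly.mul_mpolyC. Qed.

Lemma euler_homog p : p \is mpoly.ishomog1 k mpoly.mdeg -> euler p = k%:R *: p.
Proof.
move=> /mpoly.dhomogP hp; rewrite /euler.
have E : forall m : mpoly.multinom n, \sum_j mvar j * dj j (mpoly.mpolyX K m) =
    (mpoly.mdeg m)%:R *: mpoly.mpolyX K m.
  move=> m; rewrite mpoly.mdegE natr_sum scaler_suml; apply: eq_bigr => j _.
  rewrite mpoly.mderivX -scalerAr -mpoly.mpolyXD.
  have [m0|m0] := eqVneq (m j) 0%N; first by rewrite m0 !scale0r.
  congr (_ *: mpoly.mpolyX _ _); rewrite mpoly.addmC mpoly.submK//.
  apply/mpoly.mnm_lepP => i; rewrite mpoly.mnm1E.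
  by case: eqVneq => // <-; rewrite lt0n.
rewrite [in LHS](mpoly.mpolyE p) [in RHS](mpoly.mpolyE p) scaler_sumr.
under eq_bigr => j _ do rewrite raddf_sum mulr_sumr.
rewrite exchange_big /= big_seq [RHS]big_seq; apply: eq_bigr => m mp.
under eq_bigr => j _ do rewrite mpoly.mderivZ -scalerAr.
by rewrite -scaler_sumr E (hp m mp) scalerA mulrC -scalerA.
Qed.

Lemma eulerD p q : euler (p + q) = euler p + euler q.
Proof. by rewrite -big_split; apply: eq_bigr => j _; rewrite mpoly.mderivD mulrDr. Qed.

Lemma eulerZ c p : euler (c *: p) = c *: euler p.
Proof. by rewrite scaler_sumr; apply: eq_bigr => j _; rewrite mpoly.mderivZ scalerAr. Qed.

Lemma laplacianD p q : laplacian (p + q) = laplacian p + laplacian q.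
Proof. by rewrite -big_split; apply: eq_bigr => j _; rewrite !mpoly.mderivD. Qed.

Lemma laplacianZ c p : laplacian (c *: p) = c *: laplacian p.
Proof. by rewrite scaler_sumr; apply: eq_bigr => j _; rewrite !mpoly.mderivZ. Qed.

Lemma laplacian_sum (I : Type) (r : seq I) (F : I -> MP) :
  laplacian (\sum_(i <- r) F i) = \sum_(i <- r) laplacian (F i).
Proof.
elim: r => [|i r IH]; last by rewrite !big_cons laplacianD IH.
by rewrite !big_nil /laplacian big1// => j _; rewrite !raddf0.
Qed.

Lemma euler_sum (I : Type) (r : seq I) (F : I -> MP) :
  euler (\sum_(i <- r) F i) = \sum_(i <- r) euler (F i).
Proof.
elim: r => [|i r IH]; last by rewrite !big_cons eulerD IH.
by rewrite !big_nil /euler big1// => j _; rewrite raddf0 mulr0.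
Qed.

Lemma mderiv_msqnorm i : dj i msqnorm = 2%:R * mvar i.
Proof.
rewrite /msqnorm raddf_sum (bigD1 i)//= big1 => [|j ji].
  by rewrite addr0 expr2 mpoly.mderivM mderiv_var eqxx /=; ring.
by rewrite expr2 mpoly.mderivM mderiv_var eq_sym (negPf ji) mul0r mulr0 addr0.
Qed.

Lemma eulerM p q : euler (p * q) = euler p * q + p * euler q.
Proof.
rewrite /euler mulr_suml mulr_sumr -big_split; apply: eq_bigr => j _ /=.
by rewrite mpoly.mderivM; ring.
Qed.

Lemma euler_msqnorm : euler msqnorm = 2%:R * msqnorm.
Proof.
rewrite /euler {2}/msqnorm mulr_sumr; apply: eq_bigr => j _.
by rewrite mderiv_msqnorm; ring.
Qed.

(** The commutation relation of the Laplacian with multiplication by |x|^2. With the eigenvalues of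
    [euler] it determines the Laplacian on all |x|^(2j) h by induction on j, and it is the source of
    the n/2 in mu. *)
Lemma laplacian_msqnormM p : laplacian (msqnorm * p) =
  msqnorm * laplacian p + 4%:R * euler p + (2 * n)%:R * p.
Proof.
rewrite /laplacian /euler !mulr_sumr.
have -> : (2 * n)%:R * p = \sum_(j < n) 2%:R * p.
  by rewrite sumr_const card_ord mulnC natrM -mulrA mulr_natl.
rewrite -!big_split; apply: eq_bigr => j _ /=.
rewrite !mpoly.mderivM mderiv_msqnorm mpoly.mderivD !mpoly.mderivM mderiv_msqnorm.
have -> : dj j 2%:R = 0.
  by rewrite -[2%:R](rmorph_nat mC) mpoly.mderivC.
by rewrite mderiv_var eqxx /=; ring.
Qed.

Variable h : MP.
Hypotheses (hhom : h \is mpoly.ishomog1 k mpoly.mdeg) (hharm : laplacian h = 0).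

Definition mu_of : K := k%:R + n%:R / 2.
Local Notation mu := mu_of.

Definition radial j : MP := msqnorm ^+ j * h.

Lemma euler_radial j : euler (radial j) = (2 * j + k)%:R *: radial j.
Proof.
rewrite /radial; elim: j => [|j IH].
  by rewrite expr0 mul1r muln0 euler_homog.
rewrite exprS -mulrA eulerM IH euler_msqnorm.
rewrite natZ -scalerAl -scalerAr mulrA -exprS -scalerDl; congr (_ *: _).
by rewrite (natrD _ (2 * j) k) (natrD _ (2 * j.+1) k) !(natrM _ 2) -(natr1 j); ring.
Qed.

Lemma laplacian_radial0 : laplacian (radial 0) = 0.
Proof. by rewrite /radial expr0 mul1r. Qed.

Lemma laplacian_radialS j :
  laplacian (radial j.+1) = (4 * j.+1%:R * (j%:R + mu)) *: radial j.
Proof.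
elim: j => [|j IH].
  rewrite /radial expr1 expr0 mul1r laplacian_msqnormM hharm mulr0 add0r.
  rewrite euler_homog// !natZ scalerA -scalerDl; congr (_ *: _).
  by rewrite (natrM _ 2 n) /mu_of; field.
rewrite {1}/radial exprS -mulrA -/(radial j.+1) laplacian_msqnormM IH euler_radial.
have -> : msqnorm * ((4 * j.+1%:R * (j%:R + mu)) *: radial j) =
    (4 * j.+1%:R * (j%:R + mu)) *: radial j.+1.
  by rewrite -scalerAr /radial exprS mulrA.
rewrite !natZ scalerA -!scalerDl; congr (_ *: _).
rewrite (natrD _ (2 * j.+1) k) (natrM _ 2 j.+1) (natrM _ 2 n) /mu_of.
by rewrite -(natr1 j.+1) -(natr1 j); field.
Qed.

Definition pochK (a : K) (m : nat) : K := \prod_(j < m) (a + j%:R).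

(** The coefficients of Kummer's polynomial 1F1(-m; mu; .). In F_m its argument 2t is |x|^2, so
    these are also the coordinates of F_m on the |x|^(2j) h, up to the phase i^m and the
    Gaussian. *)
Definition lag_coef (m j : nat) : K := pochK (- m%:R) j / (pochK mu j * j`!%:R).

Lemma pochKS a m : pochK a m.+1 = pochK a m * (a + m%:R).
Proof. by rewrite /pochK big_ord_recr. Qed.

Lemma pochKSl a m : pochK a m.+1 = a * pochK (a + 1) m.
Proof.
rewrite /pochK big_ord_recl addr0; congr (_ * _); apply: eq_bigr => i _.
by rewrite /= /bump /= add1n -natr1; ring.
Qed.

Hypothesis mu0 : 0 < mu.

Lemma pochK_gt0 m : 0 < pochK mu m.
Proof. by apply: prodr_gt0 => j _; rewrite ltr_pwDl. Qed.

Lemma lag_coef_gt m j : (m < j)%N -> lag_coef m j = 0.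
Proof.
move=> mj; rewrite /lag_coef /pochK (bigD1 (Ordinal mj))//= addNr !mul0r //.
Qed.

Lemma muDn_neq0 j : j%:R + mu != 0 :> K.
Proof. by rewrite gt_eqF// ltr_wpDl. Qed.

Lemma lag_coefS m j :
  j.+1%:R * (j%:R + mu) * lag_coef m j.+1 = (j%:R - m%:R) * lag_coef m j.
Proof.
rewrite /lag_coef !pochKS factS natrM.
have := muDn_neq0 j; rewrite addrC => h1; have h2 := lt0r_neq0 (pochK_gt0 j).
have h3 : j`!%:R != 0 :> K by rewrite pnatr_eq0 -lt0n fact_gt0.
have h4 : 1 + j%:R != 0 :> K by rewrite nat1r pnatr_eq0.
by rewrite -nat1r; field; rewrite h1 h2 h3 h4.
Qed.

Lemma lag_coefSS m j :
  j.+1%:R * (j%:R + mu) * lag_coef m.+1 j.+1 = - m.+1%:R * lag_coef m j.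
Proof.
rewrite /lag_coef (pochKSl (- m.+1%:R)) pochKS factS natrM.
have -> : - m.+1%:R + 1 = - m%:R :> K by rewrite -natr1; ring.
have := muDn_neq0 j; rewrite addrC => h1; have h2 := lt0r_neq0 (pochK_gt0 j).
have h3 : j`!%:R != 0 :> K by rewrite pnatr_eq0 -lt0n fact_gt0.
have h4 : 1 + j%:R != 0 :> K by rewrite nat1r pnatr_eq0.
by rewrite -(nat1r j); field; rewrite h1 h2 h3 h4.
Qed.

Lemma lag_coef_raise0 m : (m%:R + mu) * lag_coef m 0 = (m%:R + mu) * lag_coef m.+1 0.
Proof. by rewrite /lag_coef /pochK !big_ord0. Qed.

(** Multiplied by (j+1)(j+mu), all three terms become multiples of [lag_coef m j], and there remains
    (m + mu + j + 1)(j - m) - (j + 1)(j + mu) = - (m + 1)(m + mu). *)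
Lemma lag_coef_raiseS m j :
  (m%:R + mu + j.+1%:R) * lag_coef m j.+1 - lag_coef m j =
  (m%:R + mu) * lag_coef m.+1 j.+1.
Proof.
have h5 : j.+1%:R * (j%:R + mu) != 0 :> K.
  by rewrite mulf_neq0 ?muDn_neq0 ?pnatr_eq0.
apply: (mulfI h5); rewrite mulrBr mulrCA lag_coefS.
rewrite [RHS]mulrCA lag_coefSS -!natr1; ring.
Qed.

Definition lag_poly m : MP := \sum_(j < m.+1) lag_coef m j *: radial j.

(** Coefficients beyond m vanish, so sums for different m, or with shifted indices, can be given a
    common length. *)
Lemma lag_polyE N m : (m < N)%N -> lag_poly m = \sum_(j < N) lag_coef m j *: radial j.
Proof.
move=> mN; rewrite /lag_poly -(big_mkord xpredT (fun j => lag_coef m j *: radial j)).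
rewrite -(big_mkord xpredT (fun j => lag_coef m j *: radial j)).
rewrite (@big_cat_nat _ _ _ m.+1 0 N)//= [X in _ = _ + X]big_nat_cond.
rewrite [X in _ = _ + X]big1 ?addr0// => j /andP[/andP[mj _] _].
by rewrite lag_coef_gt// scale0r.
Qed.

Lemma laplacian_lag_sum m N : (m < N)%N ->
  laplacian (lag_poly m) = \sum_(j < N) (4 * (j%:R - m%:R) * lag_coef m j) *: radial j.
Proof.
move=> mN; rewrite (@lag_polyE N.+1) ?leqW// laplacian_sum big_ord_recl.
rewrite laplacianZ laplacian_radial0 scaler0 add0r; apply: eq_bigr => j _.
rewrite laplacianZ /= /bump /= add1n laplacian_radialS scalerA; congr (_ *: _).
by rewrite -[RHS]mulrA -lag_coefS; ring.
Qed.

Lemma laplacian_lag_polyS m : laplacian (lag_poly m.+1) = (- (4 * m.+1%:R)) *: lag_poly m.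
Proof.
rewrite (@lag_polyE m.+2)// laplacian_sum big_ord_recl.
rewrite laplacianZ laplacian_radial0 scaler0 add0r scaler_sumr; apply: eq_bigr => j _.
rewrite laplacianZ /= /bump /= add1n laplacian_radialS !scalerA; congr (_ *: _).
have := lag_coefSS m j => /(congr1 (fun x => 4 * x)) H.
by transitivity (4 * (j.+1%:R * (j%:R + mu) * lag_coef m.+1 j.+1)); [ring|rewrite H; ring].
Qed.

Lemma euler_lag_poly m N : (m < N)%N ->
  euler (lag_poly m) = \sum_(j < N) ((2 * j + k)%:R * lag_coef m j) *: radial j.
Proof.
move=> mN; rewrite (lag_polyE mN) euler_sum; apply: eq_bigr => j _.
by rewrite eulerZ euler_radial scalerA mulrC.
Qed.

(** The left side is the operator N conjugated by the Gaussian. On the coefficient of |x|^(2j) h the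
    three terms act by 2j + k, - 2 (j - m) and n/2, and the sum 2m + mu does not depend on j. *)
Lemma number_lag_poly m : euler (lag_poly m) - 2^-1 *: laplacian (lag_poly m)
    + (n%:R / 2) *: lag_poly m = (2 * m%:R + mu) *: lag_poly m.
Proof.
rewrite (euler_lag_poly (ltnSn m)) (laplacian_lag_sum (ltnSn m)) (lag_polyE (ltnSn m)).
rewrite !scaler_sumr -sumrB -big_split; apply: eq_bigr => j _ /=.
rewrite !scalerA -scalerBl -scalerDl; congr (_ *: _).
by rewrite /mu natrD natrM; field.
Qed.

(** The left side is twice the sum of the (a_j^+)^2, conjugated by the Gaussian. Its coefficient of
    |x|^(2j) h is - 4 times the left side of [lag_coef_raise0] or [lag_coef_raiseS]. *)
Lemma raise_lag_poly m : 4%:R * msqnorm * lag_poly m - 4%:R * euler (lag_poly m)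
    - (2 * n)%:R * lag_poly m + laplacian (lag_poly m) =
  (- (4 * (m%:R + mu))) *: lag_poly m.+1.
Proof.
rewrite -mulrA !natZ.
have mN : (m < m.+2)%N by [].
rewrite (euler_lag_poly mN) (laplacian_lag_sum mN).
(* Multiplication by |x|^2 shifts the coefficients by one and leaves 0 at j = 0; hence the common
   length m + 2. *)
have -> : msqnorm * lag_poly m = \sum_(j < m.+2)
    ((if (j : nat) is j'.+1 then lag_coef m j' else 0) *: radial j).
  rewrite [RHS]big_ord_recl scale0r add0r /lag_poly mulr_sumr.
  by apply: eq_bigr => j _; rewrite -scalerAr /= /radial exprS mulrA.
rewrite (lag_polyE mN) (lag_polyE (ltnSn m.+1)).
rewrite !scaler_sumr -!sumrB -big_split; apply: eq_bigr => -[j jm] _ /=.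
rewrite !scalerA -!scalerBl -scalerDl; congr (_ *: _).
have -> : - (4 * (m%:R + mu)) * lag_coef m.+1 j =
    - 4 * ((m%:R + mu) * lag_coef m.+1 j) by ring.
case: j {jm} => [|j].
  rewrite -lag_coef_raise0 (natrD _ (2 * 0) k) (natrM _ 2 0) (natrM _ 2 n) /mu_of.
  by field.
rewrite -lag_coef_raiseS (natrD _ (2 * j.+1) k) (natrM _ 2 j.+1) (natrM _ 2 n) /mu_of.
by field.
Qed.

End harmonic_ladder.
Import ComplexField.Normc.

(** * Limits in R[i] *)

Section complex_limits.
Context (R : realType).
Local Notation C := (R[i]).
Implicit Types z w : C.

Lemma normCE z : `|z| = (normc z)%:C.
Proof. by case: z. Qed.

Lemma normc_ge0 z : 0 <= normc z.
Proof. by case: z => x y; exact: sqrtr_ge0. Qed.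

Lemma normcX z m : normc (z ^+ m) = normc z ^+ m.
Proof. by elim: m => [|m IH]; rewrite ?expr0 ?normc1// !exprS normcM IH. Qed.

Lemma normc_real (x : R) : normc x%:C = `|x|.
Proof. by rewrite /= expr0n/= addr0 sqrtr_sqr. Qed.

Lemma normc_nat (m : nat) : normc (m%:R : C) = m%:R.
Proof. by rewrite -[m%:R in LHS](rmorph_nat (real_complex R)) normc_real ger0_norm. Qed.

Lemma normc_Re z : `|complex.Re z| <= normc z.
Proof.
case: z => x y /=; rewrite -sqrtr_sqr ler_wsqrtr// lerDl; exact: sqr_ge0.
Qed.

Lemma normc_Im z : `|complex.Im z| <= normc z.
Proof.
case: z => x y /=; rewrite -sqrtr_sqr ler_wsqrtr// lerDr; exact: sqr_ge0.
Qed.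

Lemma sqr_normcE z : normc z ^+ 2 = complex.Re z ^+ 2 + complex.Im z ^+ 2.
Proof. by case: z => x y /=; rewrite sqr_sqrtr// addr_ge0 ?sqr_ge0. Qed.

Lemma normc_le_ReIm z : normc z <= `|complex.Re z| + `|complex.Im z|.
Proof.
rewrite -(@ler_pXn2r _ 2)// ?nnegrE ?normc_ge0 ?addr_ge0//.
rewrite sqr_normcE -(real_normK (num_real (complex.Re z))).
rewrite -(real_normK (num_real (complex.Im z))) sqrrD -addrA lerD2l.
by rewrite lerDr mulrn_wge0// mulr_ge0.
Qed.

Lemma normcB z w : normc (z - w) = normc (w - z).
Proof. by rewrite -normcN opprB. Qed.

Lemma cvgC_normc (T : Type) (F : set_system T) (FF : Filter F)
    (f : T -> C) (l : C) :
  (f : T -> R[i]^o) @ F --> (l : R[i]^o) <->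
  (forall e : R, 0 < e -> \forall t \near F, normc (l - f t) < e).
Proof.
split.
  move=> /cvgrPdist_lt h e e0.
  have /h : 0 < e%:C by rewrite ltcR.
  by apply: filterS => t; rewrite normCE ltcR.
(* A positive element of R[i] has imaginary part 0, so real radii suffice. *)
move=> h; apply/cvgrPdist_lt => e; rewrite ltcE /= => /andP[/eqP e1 e0].
have := h _ e0; apply: filterS => t ht.
by rewrite normCE ltcE/= e1 eqxx.
Qed.

Lemma cvgC_ReIm (T : Type) (F : set_system T) (FF : Filter F)
    (f : T -> C) (a b : R) :
  (fun t => complex.Re (f t)) @ F --> a -> (fun t => complex.Im (f t)) @ F --> b ->
  (f : T -> R[i]^o) @ F --> (a +i* b : R[i]^o).
Proof.
move=> /cvgrPdist_lt ha /cvgrPdist_lt hb; apply/cvgC_normc => e e0.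
have e2 : 0 < e / 2 by rewrite divr_gt0.
near=> t; apply: le_lt_trans (normc_le_ReIm _) _.
rewrite [ltRHS](splitr e) ltrD//.
  have : `|a - complex.Re (f t)| < e / 2 by near: t; exact: ha.
  by case: (f t).
have : `|b - complex.Im (f t)| < e / 2 by near: t; exact: hb.
by case: (f t).
Unshelve. all: by end_near. Qed.

Lemma cvgC_bounded (f : nat -> C) (l : C) :
  (f : nat -> R[i]^o) @ \oo --> (l : R[i]^o) -> exists K, forall m, normc (f m) <= K.
Proof.
move=> /cvgC_normc /(_ 1 ltr01) [N _ hN].
exists (normc l + 1 + \sum_(i < N) normc (f i)) => m.
have S0 (N' : nat) : 0 <= \sum_(i < N') normc (f i) by apply: sumr_ge0 => i _; exact: normc_ge0.
have [Nm|mN] := leqP N m.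
  have := hN m Nm; rewrite /= => h.
  have -> : f m = l - (l - f m) by ring.
  have := le_normcD l (- (l - f m)); rewrite normcN => h2.
  have := S0 N; lra.
rewrite (bigD1 (Ordinal mN))//=.
have : 0 <= \sum_(i < N | i != Ordinal mN) normc (f i).
  by apply: sumr_ge0 => i _; exact: normc_ge0.
have := normc_ge0 l; lra.
Qed.

Lemma normc_sum (I : Type) (r : seq I) (P : pred I) (F : I -> C) :
  normc (\sum_(i <- r | P i) F i) <= \sum_(i <- r | P i) normc (F i).
Proof.
elim/big_ind2 : _ => // [|x1 x2 y1 y2 h1 h2]; first by rewrite normc0.
exact: le_trans (le_normcD _ _) (lerD h1 h2).
Qed.

Lemma geometric_sum_le (t : R) N : 0 <= t < 1 ->
  \sum_(0 <= m < N) t ^+ m <= (1 - t)^-1.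
Proof.
move=> /andP[t0 t1]; have t1' : 0 < 1 - t by rewrite subr_gt0.
rewrite -[leRHS]mul1r ler_pdivlMr// big_mkord mulrC -opprB mulNr -subrX1 opprB.
by rewrite lerBlDr lerDl exprn_ge0.
Qed.

Lemma cvgC_series_geometric (c : nat -> C) (K t : R) : 0 <= t < 1 ->
  (forall m, normc (c m) <= K * t ^+ m) ->
  exists l : C, (series (c : nat -> R[i]^o)) @ \oo --> (l : R[i]^o).
Proof.
move=> /andP[t0 t1] hc.
have cv (x : nat -> R) : (forall m, `|x m| <= K * t ^+ m) -> cvgn (series x).
  move=> hx; apply: normed_cvg; apply: (series_le_cvg (v_ := geometric K t)) => //.
  - by move=> m; exact: normr_ge0.
  - by move=> m /=; exact: le_trans (normr_ge0 _) (hx m).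
  - by apply: is_cvg_geometric_series; rewrite ger0_norm.
have /cvg_ex[a ha] : cvgn (series (fun m => complex.Re (c m))).
  by apply: cv => m; exact: le_trans (normc_Re _) (hc m).
have /cvg_ex[b hb] : cvgn (series (fun m => complex.Im (c m))).
  by apply: cv => m; exact: le_trans (normc_Im _) (hc m).
exists (a +i* b); apply: cvgC_ReIm.
  rewrite (_ : (fun _ => _) = series (fun m => complex.Re (c m)))//.
  by apply/funext => m; rewrite /series/= raddf_sum.
rewrite (_ : (fun _ => _) = series (fun m => complex.Im (c m)))//.
by apply/funext => m; rewrite /series/= raddf_sum.
Qed.

Lemma cvgC_normc_le (f : nat -> C) (l : C) (K : R) :
  (f : nat -> R[i]^o) @ \oo --> (l : R[i]^o) -> (forall m, normc (f m) <= K) ->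
  normc l <= K.
Proof.
move=> /cvgC_normc h hK; rewrite leNgt; apply/negP => Kl.
have [N _ hN] := h _ (eq_ind_r is_true Kl (subr_gt0 K (normc l))).
have := hN N (leqnn _); rewrite /= => h1.
have := le_normcD (l - f N) (f N); rewrite subrK => h2.
have := hK N; lra.
Qed.

(* Complex limits are stated on [R[i]^o], which carries the topology, while the
   ring operations are those of [R[i]]. *)
Lemma cvgCB (T : Type) (F : set_system T) (FF : Filter F) (f g : T -> C) (a b : C) :
  (f : T -> R[i]^o) @ F --> (a : R[i]^o) -> (g : T -> R[i]^o) @ F --> (b : R[i]^o) ->
  ((fun t => f t - g t) : T -> R[i]^o) @ F --> (a - b : R[i]^o).
Proof. exact: (@cvgB _ (R[i]^o)). Qed.

Lemma cvgCD (T : Type) (F : set_system T) (FF : Filter F) (f g : T -> C) (a b : C) :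
  (f : T -> R[i]^o) @ F --> (a : R[i]^o) -> (g : T -> R[i]^o) @ F --> (b : R[i]^o) ->
  ((fun t => f t + g t) : T -> R[i]^o) @ F --> (a + b : R[i]^o).
Proof. exact: (@cvgD _ (R[i]^o)). Qed.

Lemma cvgCZ (T : Type) (F : set_system T) (FF : Filter F) (c : C) (f : T -> C) (a : C) :
  (f : T -> R[i]^o) @ F --> (a : R[i]^o) ->
  ((fun t => c * f t) : T -> R[i]^o) @ F --> (c * a : R[i]^o).
Proof. by move=> h; apply: (@cvgZl_tmp _ (R[i]^o)). Qed.

Lemma cvgC_congr (T : Type) (F : set_system T) (f g : T -> C) (a b : C) :
  f = g -> a = b ->
  (g : T -> R[i]^o) @ F --> (b : R[i]^o) -> (f : T -> R[i]^o) @ F --> (a : R[i]^o).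
Proof. by move=> -> ->. Qed.

Lemma cvgC_sum (T : Type) (F : set_system T) (FF : Filter F) (I : Type) (r : seq I)
    (f : I -> T -> C) (a : I -> C) :
  (forall i, (f i : T -> R[i]^o) @ F --> (a i : R[i]^o)) ->
  ((fun t => \sum_(i <- r) f i t) : T -> R[i]^o) @ F --> (\sum_(i <- r) a i : R[i]^o).
Proof.
move=> h; elim: r => [|i r IH].
  apply: (@cvgC_congr _ F _ (fun=> 0) _ 0); last exact: cvg_cst.
    by apply/funext => t; rewrite big_nil.
  by rewrite big_nil.
apply: cvgC_congr (cvgCD FF (h i) IH); last by rewrite big_cons.
by apply/funext => t; rewrite big_cons.
Qed.

End complex_limits.

(** * Power series on the unit disc *)

Section complex_power_series.
Context (R : realType).
Local Notation C := (R[i]).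
Implicit Types (a : nat -> C) (f : R[i]^o -> R[i]^o).

Lemma in_DE (z : C) : in_D (z : R[i]^o) <-> normc z < 1.
Proof. by rewrite /in_D normCE -[1]/((1 : R)%:C) ltcR. Qed.

(** Radius of convergence at least 1, stated through bounded terms. Convergence on the disc gives
    it, so does weighted square-summability, and it passes to the differentiated series. *)
Definition subexponential a := forall r : R, 0 <= r < 1 ->
  exists K, forall m, normc (a m) * r ^+ m <= K.

Lemma power_sum_subexponential a f : power_sum a f -> subexponential a.
Proof.
move=> af r /andP[r0 r1].
have zD : in_D (r%:C : R[i]^o) by apply/in_DE; rewrite normc_real ger0_norm.
have /cvgC_bounded[K hK] := af _ zD.
exists (K + K) => m.
have -> : normc (a m) * r ^+ m = normc (a m * r%:C ^+ m).
  by rewrite normcM normcX normc_real ger0_norm.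
have -> : a m * r%:C ^+ m = series (fun m => a m * r%:C ^+ m : R[i]^o) m.+1 -
    series (fun m => a m * r%:C ^+ m : R[i]^o) m.
  by rewrite seriesSB.
apply: le_trans (le_normcD _ _) _; rewrite normcN; exact: lerD.
Qed.

(** Each of the m + 1 summands of 1 + t + ... + t^m is at least t^m. *)
Lemma natmul_geometric_le (t : R) (m : nat) : 0 <= t < 1 ->
  m.+1%:R * t ^+ m <= (1 - t)^-1.
Proof.
move=> t01; apply: le_trans (geometric_sum_le m.+1 t01).
move/andP: t01 => [t0 t1].
rewrite big_mkord mulr_natl -[X in _ *+ X]card_ord -sumr_const.
by apply: ler_sum => i _; rewrite ler_wiXn2l// ?ltW// -ltnS.
Qed.

(** With rho = t^4, the factors of t^(4m) are spent as follows: one makes |a_m| t^m bounded, two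
    make (m+1)^2 t^(2m) bounded, and one is kept for geometric decay. The factor (m+1)^2 pays for
    the derivative and for second-order Taylor remainders. *)
Lemma subexponential_geometric a (r : R) : subexponential a -> 0 <= r < 1 ->
  exists rho t K : R, [/\ r < rho, rho < 1, 0 < t < 1 &
    forall m, normc (a m) * m.+1%:R ^+ 2 * rho ^+ m <= K * t ^+ m].
Proof.
(* Bernoulli's inequality, used twice, gives t^4 >= 1 - (1 - r) / 2 > r. *)
move=> sa /andP[r0 r1]; pose t := 1 - (1 - r) / 8.
have t0 : 0 < t by rewrite /t; lra.
have t1 : t < 1 by rewrite /t; lra.
have [|K hK] := sa t; first by rewrite t1 ltW.
have K0 : 0 <= K.
  by apply: le_trans (hK 0%N); rewrite expr0 mulr1 normc_ge0.
exists (t ^+ 4), t, (K * (1 - t)^-1 ^+ 2); split.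
- have h (x : R) : 1 - 2 * x <= (1 - x) ^+ 2.
    by have := sqr_ge0 x; rewrite !expr2; lra.
  have h1 := h ((1 - r) / 8); have h2 := h ((1 - r) / 4).
  rewrite -/t in h1; apply: (@lt_le_trans _ _ ((1 - (1 - r) / 4) ^+ 2)); first lra.
  by rewrite (exprM t 2 2) lerXn2r ?nnegrE ?sqr_ge0//; lra.
- by rewrite exprn_ilt1 ?ltW.
- by rewrite t0.
move=> m; have -> : normc (a m) * m.+1%:R ^+ 2 * (t ^+ 4) ^+ m =
    (normc (a m) * t ^+ m) * (m.+1%:R * t ^+ m) ^+ 2 * t ^+ m.
  by rewrite -exprM mulnC exprM; ring.
apply: ler_wpM2r; first by rewrite exprn_ge0// ltW.
apply: ler_pM => //; rewrite ?sqr_ge0//.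
  by rewrite mulr_ge0 ?normc_ge0 ?exprn_ge0 ?ltW.
apply: lerXn2r; rewrite ?nnegrE.
- by rewrite mulr_ge0// exprn_ge0// ltW.
- by rewrite invr_ge0 subr_ge0 ltW.
- by apply: natmul_geometric_le; rewrite t1 ltW.
Qed.

Lemma subexponential_cvg a (z : C) : subexponential a -> normc z < 1 ->
  exists l : C, series (fun m => a m * z ^+ m : R[i]^o) @ \oo --> (l : R[i]^o).
Proof.
move=> sa z1.
have [|rho [t [K [r1 r2 /andP[t0 t1] h]]]] := subexponential_geometric sa (r := normc z).
  by rewrite normc_ge0.
apply: (@cvgC_series_geometric _ _ K t) => [|m]; first by rewrite t1 ltW.
apply: le_trans (h m); rewrite normcM normcX.
have rho0 : 0 <= rho by apply/ltW/le_lt_trans/r1/normc_ge0.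
apply: (@le_trans _ _ (normc (a m) * rho ^+ m)).
  by rewrite ler_wpM2l ?normc_ge0// lerXn2r ?nnegrE ?normc_ge0// ltW.
rewrite mulrAC ler_peMr ?mulr_ge0 ?normc_ge0 ?exprn_ge0//.
by rewrite exprn_ege1// ler1n.
Qed.

Lemma subexponential_power_sum a : subexponential a -> exists f, power_sum a f.
Proof.
move=> sa; have /choice[f hf] : forall z : R[i]^o, exists l : R[i]^o,
    in_D z -> series (fun m => a m * z ^+ m : R[i]^o) @ \oo --> l.
  move=> z; have [zD|zD] := pselect (in_D z); last by exists 0.
  by have /in_DE/(subexponential_cvg sa)[l hl] := zD; exists l.
by exists f => z zD; exact: hf.
Qed.

Definition diff_coef a : nat -> C := fun m => m.+1%:R * a m.+1.

Lemma subexponential_diff a : subexponential a -> subexponential (diff_coef a).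
Proof.
move=> sa r r01.
have [rho [t [K [r1 r2 /andP[t0 t1] h]]]] := subexponential_geometric sa r01.
have /andP[r0 _] := r01; have rho0 : 0 < rho by exact: le_lt_trans r1.
have K0 : 0 <= K.
  have := h 0%N; rewrite !expr0 !mulr1 expr1n mulr1; exact: le_trans (normc_ge0 _).
exists (rho^-1 * K) => m; rewrite /diff_coef normcM normc_nat.
rewrite ler_pdivlMl//.
apply: (@le_trans _ _ (normc (a m.+1) * m.+2%:R ^+ 2 * rho ^+ m.+1)); last first.
  by apply: le_trans (h m.+1) _; apply: ler_piMr => //; apply: exprn_ile1; exact: ltW.
have -> : rho * (m.+1%:R * normc (a m.+1) * r ^+ m) =
    normc (a m.+1) * m.+1%:R * (rho * r ^+ m) by ring.
rewrite -[leRHS]mulrA -[leLHS]mulrA ler_wpM2l ?normc_ge0// ler_pM//.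
- by rewrite mulr_ge0 ?exprn_ge0// ltW.
- by rewrite expr2 -natrM ler_nat; rewrite (leq_trans (leqnSn _))// leq_pmulr.
- by rewrite exprS ler_wpM2l ?lerXn2r ?nnegrE// ltW.
Qed.

(* The remainder satisfies E (m + 1) = (z + w) * E m + m * w ^ 2 * z ^ (m - 1). *)
Lemma taylor2_pow (z w : C) (rho : R) (m : nat) : 0 < rho ->
  normc z <= rho -> normc (z + w) <= rho ->
  rho ^+ 2 * normc ((z + w) ^+ m - z ^+ m - m%:R * w * z ^+ m.-1)
    <= m%:R ^+ 2 * normc w ^+ 2 * rho ^+ m.
Proof.
move=> rho0 hz hzw; elim: m => [|m IH].
  by rewrite !expr0 subrr mul0r mul0r subrr normc0 mulr0 expr2 !mul0r.
pose E := (z + w) ^+ m - z ^+ m - m%:R * w * z ^+ m.-1.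
have -> : (z + w) ^+ m.+1 - z ^+ m.+1 - m.+1%:R * w * z ^+ m.+1.-1 =
    (z + w) * E + m%:R * w ^+ 2 * z ^+ m.-1.
  rewrite /E /=; case: m {IH E} => [|m] /=; first by rewrite !expr1 !expr0; ring.
  by rewrite !exprS -(natr1 m.+1) -(natr1 m); ring.
have h1 : normc ((z + w) * E + m%:R * w ^+ 2 * z ^+ m.-1) <=
    rho * normc E + m%:R * normc w ^+ 2 * normc z ^+ m.-1.
  apply: le_trans (le_normcD _ _) _; rewrite !normcM !normcX normc_nat lerD2r.
  by rewrite ler_wpM2r// normc_ge0.
have h2 : rho ^+ 2 * (m%:R * normc w ^+ 2 * normc z ^+ m.-1) <=
    m%:R * normc w ^+ 2 * rho ^+ m.+1.
  case: m {IH E h1} => [|m]; first by rewrite !mul0r mulr0.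
  rewrite mulrCA; apply: ler_wpM2l; first by rewrite mulr_ge0// sqr_ge0.
  rewrite (_ : m.+2 = 2 + m)%N// exprD; apply: ler_wpM2l; first exact: sqr_ge0.
  by apply: lerXn2r => //; rewrite nnegrE ?normc_ge0// ltW.
apply: (@le_trans _ _ (rho ^+ 2 *
    (rho * normc E + m%:R * normc w ^+ 2 * normc z ^+ m.-1))).
  by rewrite ler_wpM2l ?sqr_ge0.
have h3 : rho * (rho ^+ 2 * normc E) <= rho * (m%:R ^+ 2 * normc w ^+ 2 * rho ^+ m).
  by rewrite ler_wpM2l// ltW.
rewrite mulrDr; apply: le_trans (lerD (_ : _ <= rho * (m%:R ^+ 2 * normc w ^+ 2 * rho ^+ m)) h2) _.
  by rewrite mulrCA.
rewrite -natr1 [rho ^+ m.+1]exprS.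
have : 0 <= (m%:R + 1) * (normc w ^+ 2 * rho ^+ m * rho).
  apply: mulr_ge0; first by rewrite addr_ge0.
  exact: mulr_ge0 (mulr_ge0 (sqr_ge0 _) (exprn_ge0 m (ltW rho0))) (ltW rho0).
set X := normc w ^+ 2; set Y := rho ^+ m; set c : R := m%:R => h4.
have -> : (c + 1) ^+ 2 * X * (rho * Y) = rho * (c ^+ 2 * X * Y) + c * X * (rho * Y) +
    (c + 1) * (X * Y * rho) by ring.
by rewrite lerDl.
Qed.

(** Termwise application of [taylor2_pow] to the partial sums, with a bound independent of their
    length. The factor rho^2 on the left avoids negative powers of rho. *)
Lemma power_sum_quotient_bound a f z rho t K w fz' :
  power_sum a f -> 0 < rho < 1 -> 0 < t < 1 ->
  (forall m, normc (a m) * m.+1%:R ^+ 2 * rho ^+ m <= K * t ^+ m) ->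
  normc z <= rho -> normc (z + w) <= rho ->
  series (fun m => diff_coef a m * z ^+ m : R[i]^o) @ \oo --> (fz' : R[i]^o) ->
  rho ^+ 2 * normc (f (z + w) - f z - w * fz') <= K * (1 - t)^-1 * normc w ^+ 2.
Proof.
move=> af /andP[rho0 rho1] /andP[t0 t1] ha hz hzw hd.
pose S (x : C) N := series (fun m => a m * x ^+ m : R[i]^o) N.
have zD : in_D (z : R[i]^o) by apply/in_DE; exact: le_lt_trans rho1.
have zwD : in_D (z + w : R[i]^o) by apply/in_DE; exact: le_lt_trans rho1.
rewrite -[X in X * normc _ <= _]ger0_norm ?sqr_ge0// -normc_real -normcM.
pose D N := series (fun m => diff_coef a m * z ^+ m : R[i]^o) N.
(* The series of f is cut at N + 1 and that of its derivative at N, since the constant term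
   disappears under differentiation. *)
apply: (@cvgC_normc_le _ (fun N => (rho ^+ 2)%:C * (S (z + w) N.+1 - S z N.+1 - w * D N))).
  apply: cvgCZ.
  have H (x : C) : in_D (x : R[i]^o) -> (fun N => S x N.+1 : R[i]^o) @ \oo --> f x.
    by move=> xD; have := af x xD; rewrite -cvg_shiftS.
  apply: cvgCB; last exact: cvgCZ.
  by apply: cvgCB; exact: H.
move=> N; rewrite normcM normc_real ger0_norm ?sqr_ge0//.
have -> : S (z + w) N.+1 - S z N.+1 - w * D N =
    \sum_(0 <= m < N.+1) a m * ((z + w) ^+ m - z ^+ m - m%:R * w * z ^+ m.-1).
  rewrite /S /D /series /= big_nat_recl// [X in _ - X - _]big_nat_recl//.
  rewrite [in RHS]big_nat_recl// mulr_sumr !expr0 mul0r mul0r subr0 subrr mulr0 add0r.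
  rewrite mulr1 opprD addrACA subrr add0r -!sumrB.
  by apply: eq_bigr => m _; rewrite /diff_coef /=; ring.
apply: (@le_trans _ _ (\sum_(0 <= m < N.+1) K * t ^+ m * normc w ^+ 2)).
  apply: (@le_trans _ _ (rho ^+ 2 * \sum_(0 <= m < N.+1)
     normc (a m * ((z + w) ^+ m - z ^+ m - m%:R * w * z ^+ m.-1)))).
    by rewrite ler_wpM2l ?sqr_ge0// normc_sum.
  rewrite mulr_sumr; apply: ler_sum => m _; rewrite normcM mulrCA.
  apply: (@le_trans _ _ (normc (a m) * (m%:R ^+ 2 * normc w ^+ 2 * rho ^+ m))).
    by rewrite ler_wpM2l ?normc_ge0// taylor2_pow.
  apply: (@le_trans _ _ (normc (a m) * m.+1%:R ^+ 2 * rho ^+ m * normc w ^+ 2)).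
    have -> : normc (a m) * (m%:R ^+ 2 * normc w ^+ 2 * rho ^+ m) =
      (normc (a m) * (rho ^+ m * normc w ^+ 2)) * m%:R ^+ 2 by ring.
    have -> : normc (a m) * m.+1%:R ^+ 2 * rho ^+ m * normc w ^+ 2 =
      (normc (a m) * (rho ^+ m * normc w ^+ 2)) * m.+1%:R ^+ 2 by ring.
    rewrite ler_wpM2l//.
      exact: mulr_ge0 (normc_ge0 _) (mulr_ge0 (exprn_ge0 m (ltW rho0)) (sqr_ge0 _)).
    by rewrite lerXn2r ?nnegrE// ler_nat.
  by rewrite ler_wpM2r ?sqr_ge0.
rewrite -mulr_suml ler_wpM2r ?sqr_ge0// -mulr_sumr ler_wpM2l//.
  have := ha 0%N; rewrite !expr0 !mulr1 expr1n mulr1; exact: le_trans (normc_ge0 _).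
by apply: geometric_sum_le; rewrite t1 ltW.
Qed.

(** Termwise differentiation: by [power_sum_quotient_bound] the difference quotient differs from the
    differentiated series by a multiple of |w|, for w small enough that z + w stays within rho. *)
Lemma power_sum_derive a f : power_sum a f ->
  (forall z, in_D z -> derivable f z 1) /\ power_sum (diff_coef a) (derive1 f).
Proof.
move=> af; have sa := power_sum_subexponential af.
have key (z : C) : in_D (z : R[i]^o) -> exists l : C,
    series (fun m => diff_coef a m * z ^+ m : R[i]^o) @ \oo --> (l : R[i]^o) /\
    (fun h : R[i]^o => h^-1 *: (f (h + z) - f z)) @ 0^' --> (l : R[i]^o).
  move=> /in_DE z1.
  have [l hl] := subexponential_cvg (subexponential_diff sa) z1.
  exists l; split=> //.
  have [|rho [t [K [r1 r2 t01 h]]]] := subexponential_geometric sa (r := normc z).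
    by rewrite normc_ge0.
  have rho0 : 0 < rho by exact: le_lt_trans (normc_ge0 _) r1.
  have rho01 : 0 < rho < 1 by rewrite rho0.
  have K1 : 0 <= K * (1 - t)^-1.
    rewrite mulr_ge0// ?invr_ge0 ?subr_ge0; last by move/andP: t01 => [_ /ltW].
    have := h 0%N; rewrite !expr0 !mulr1 expr1n mulr1; exact: le_trans (normc_ge0 _).
  set K' := K * (1 - t)^-1 in K1.
  apply/cvgC_normc => e e0.
  (* The first entry keeps z + w within radius rho, the second makes K' |w| / rho^2 smaller than e.
     The added 1 covers K' = 0. *)
  pose dl := Num.min (rho - normc z) (e * rho ^+ 2 / (K' + 1)).
  have dl0 : 0 < dl.
    rewrite lt_min subr_gt0 r1/= divr_gt0 ?mulr_gt0 ?exprn_gt0//.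
    by rewrite ltr_pwDr.
  have dlC : 0 < dl%:C by rewrite ltcR.
  exists dl%:C => //= w; rewrite /ball /= sub0r normrN normCE ltcR lt_min.
  move=> /andP[w1 w2] w0.
  have hw : normc (z + w) <= rho.
    by apply: le_trans (le_normcD _ _) _; lra.
  have := power_sum_quotient_bound af rho01 t01 h (ltW r1) hw hl.
  have wn0 : 0 < normc w.
    by rewrite lt_def normc_ge0 andbT; apply: contraNneq w0 => /eq0_normc ->.
  have -> : f (z + w) - f z - w * l = w * (w^-1 *: (f (w + z) - f z) - l).
    rewrite (_ : w^-1 *: (f (w + z) - f z) = w^-1 * (f (w + z) - f z))//.
    by rewrite mulrBr mulrA mulfV// mul1r (addrC w z).
  rewrite normcM (normcB l) => hh.
  rewrite -(ltr_pM2l wn0) -(ltr_pM2l (exprn_gt0 2 rho0)).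
  apply: le_lt_trans hh _; rewrite -/K'.
  rewrite expr2 mulrA [K' * _]mulrC -mulrA -[ltRHS]mulrCA ltr_pM2l//.
  apply: (@le_lt_trans _ _ ((K' + 1) * normc w)).
    by rewrite ler_wpM2r// ?normc_ge0// lerDl.
  by rewrite -ltr_pdivlMl ?ltr_pwDr// mulrC [_ * e]mulrC.
split=> z zD; have [l [h1 h2]] := key z zD.
  apply/cvg_ex; exists l => /=.
  by under eq_fun do rewrite [_ *: 1]mulr1.
by rewrite /derive1 (cvg_lim _ h2).
Qed.

Lemma power_sum_cst a z f : power_sum a f -> z = 0 -> a 0%N = f z.
Proof.
move=> af ->; have zD : in_D (0 : R[i]^o) by rewrite /in_D normr0 ltr01.
have h := af 0 zD; apply/esym; apply: (cvg_unique _ h); first exact: norm_hausdorff.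
apply: cvg_near_cst; exists 1%N => // m /= m1.
rewrite /series/= big_ltn// expr0 mulr1 big_nat_cond big1 ?addr0// => i.
by case/andP => /andP[i1 _] _; rewrite expr0n eqn0Ngt i1 mulr0.
Qed.

(** The coefficient at 0 is the value at 0, and the coefficient at m + 1 is, up to the factor m + 1,
    the coefficient at m of the derivative, which is again the zero function. *)
Lemma power_sum0_eq0 a m : power_sum a (fun _ => 0) -> a m = 0.
Proof.
elim: m a => [|m IH] a a0; first exact: (power_sum_cst a0 erefl).
have [_] := power_sum_derive a0.
have -> : derive1 (fun _ : R[i]^o => 0 : R[i]^o) = fun _ => 0.
  by apply/funext => z; rewrite derive1_cst.
by move=> /IH /eqP; rewrite /diff_coef mulf_eq0 pnatr_eq0/= => /eqP.
Qed.

Lemma power_sumB a b f g : power_sum a f -> power_sum b g ->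
  power_sum (fun m => a m - b m) (fun z => f z - g z).
Proof.
move=> af bg z zD.
rewrite (_ : series _ = fun N => series (fun m => a m * z ^+ m : R[i]^o) N -
    series (fun m => b m * z ^+ m : R[i]^o) N).
  exact: cvgCB (af z zD) (bg z zD).
by apply/funext => N; rewrite /series/= -sumrB; apply: eq_bigr => m _; rewrite mulrBl.
Qed.

Lemma power_sum_inj a b f : power_sum a f -> power_sum b f -> a =1 b.
Proof.
move=> af bf m; apply/eqP; rewrite -subr_eq0; apply/eqP.
apply: (@power_sum0_eq0 (fun m => a m - b m)) => z zD.
by have := power_sumB af bf zD; rewrite subrr.
Qed.

End complex_power_series.

Lemma cvgC_unique (R : realType) (f : nat -> R[i]) (a b : R[i]) :
  (f : nat -> R[i]^o) @ \oo --> (a : R[i]^o) ->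
  (f : nat -> R[i]^o) @ \oo --> (b : R[i]^o) -> a = b.
Proof. by move=> fa fb; apply: (cvg_unique _ fa fb); exact: norm_hausdorff. Qed.

(** * Algebra of power series and the coefficients of the operators tau *)

Section power_sum_operations.
Context (R : realType).
Local Notation C := (R[i]).
Implicit Types (a : nat -> C) (f : R[i]^o -> R[i]^o).

Lemma eq_power_sum a b f g : a =1 b -> f =1 g -> power_sum a f -> power_sum b g.
Proof. by move=> /funext -> /funext ->. Qed.

Lemma power_sum_of0 a f : power_sum a f -> a =1 (fun=> 0) ->
  forall z, in_D z -> f z = 0.
Proof.
move=> af /funext a0 z /af; rewrite a0 => fz; apply: (cvgC_unique fz).
rewrite (_ : series _ = fun=> 0); first exact: cvg_cst.
by apply/funext => N; rewrite /series/= big1// => m _; rewrite mul0r.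
Qed.

Lemma power_sumZ (c : C) a f : power_sum a f ->
  power_sum (fun m => c * a m) (fun z => c * f z).
Proof.
move=> af z zD.
rewrite (_ : series _ = fun N => c * series (fun m => a m * z ^+ m : R[i]^o) N).
  by apply: cvgCZ; exact: af.
by apply/funext => N; rewrite /series/= mulr_sumr; apply: eq_bigr => m _; rewrite mulrA.
Qed.

Arguments power_sumZ c {a f}.

Lemma power_sumD a b f g : power_sum a f -> power_sum b g ->
  power_sum (fun m => a m + b m) (fun z => f z + g z).
Proof.
move=> af bg z zD.
rewrite (_ : series _ = fun N => series (fun m => a m * z ^+ m : R[i]^o) N +
    series (fun m => b m * z ^+ m : R[i]^o) N).
  exact: cvgCD (af z zD) (bg z zD).
by apply/funext => N; rewrite /series/= -big_split; apply: eq_bigr => m _; rewrite mulrDl.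
Qed.

Lemma power_sum_sum (I : Type) (r : seq I) (a : I -> nat -> C) (f : I -> R[i]^o -> R[i]^o) :
  (forall i, power_sum (a i) (f i)) ->
  power_sum (fun m => \sum_(i <- r) a i m) (fun z => \sum_(i <- r) f i z).
Proof.
move=> af; elim: r => [|i r IH].
  apply: (@eq_power_sum (fun=> 0) _ (fun=> 0)) => [m|z|z zD]; rewrite ?big_nil//.
  rewrite (_ : series _ = fun=> 0); first exact: cvg_cst.
  by apply/funext => N; rewrite /series/= big1// => m _; rewrite mul0r.
apply: (eq_power_sum _ _ (power_sumD (af i) IH)) => [m|z]; by rewrite big_cons.
Qed.

Lemma power_sum_mulz a f : power_sum a f ->
  power_sum (fun m => if m is m'.+1 then a m' else 0) (fun z => z * f z).
Proof.
move=> af z zD; rewrite -cvg_shiftS.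
rewrite (_ : (fun N => _) = fun N => z * series (fun m => a m * z ^+ m : R[i]^o) N).
  by apply: cvgCZ; exact: af.
apply/funext => N; rewrite /series/= big_nat_recl// mul0r add0r mulr_sumr.
by apply: eq_bigr => m _; rewrite exprS mulrCA.
Qed.

Variable mu : R.

Lemma power_sum_tauE a f : power_sum a f ->
  power_sum (fun m => - (m.+1%:R * a m.+1)) (tauE f).
Proof.
move=> /power_sum_derive[_ d].
by apply: (eq_power_sum _ _ (power_sumZ (-1) d)) => [m|z]; rewrite mulN1r.
Qed.

Lemma power_sum_tauH a f : power_sum a f ->
  power_sum (fun m => - ((2 * m%:R + mu%:C) * a m)) (tauH mu f).
Proof.
move=> af; have [_ d] := power_sum_derive af.
apply: (eq_power_sum _ _ (power_sumD (power_sumZ (- 2) (power_sum_mulz d)) (power_sumZ (- mu%:C) af))).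
  by case=> [|m]; rewrite /diff_coef; ring.
by move=> z; rewrite /tauH mulrA (mulNr mu%:C).
Qed.

Lemma power_sum_tauF a f : power_sum a f ->
  power_sum (fun m => if m is m'.+1 then (m'%:R + mu%:C) * a m' else 0) (tauF mu f).
Proof.
move=> af; have [_ d] := power_sum_derive af.
apply: (eq_power_sum _ _ (power_sumD (power_sum_mulz (power_sum_mulz d))
  (power_sumZ mu%:C (power_sum_mulz af)))).
  by case=> [|[|m]]; rewrite /diff_coef; ring.
by move=> z; rewrite /tauF expr2 !mulrA.
Qed.

Lemma power_sum_mulmx (p : nat) (D : 'M[C]_p) (v : nat -> 'cV[C]_p)
    (W : R[i]^o -> 'cV[C]_p) l :
  (forall l', power_sum (fun m => v m l' 0) (fun z => W z l' 0)) ->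
  power_sum (fun m => (D *m v m) l 0) (fun z => (D *m W z) l 0).
Proof.
move=> h.
have H := @power_sum_sum _ (index_enum 'I_p) (fun l' m => D l l' * v m l' 0)
  (fun l' z => D l l' * W z l' 0) (fun l' => power_sumZ (D l l') (h l')).
by apply: (eq_power_sum _ _ H) => [m|z]; rewrite mxE.
Qed.

End power_sum_operations.

Arguments power_sumZ {R} c {a f}.
Arguments power_sum_tauH {R} mu {a f}.
Arguments power_sum_tauF {R} mu {a f}.

(** * Membership in H_mu in terms of coefficients *)

Section weighted_coefficients.
Context (R : realType) (mu : R) (mu0 : 0 < mu).
Local Notation C := (R[i]).
Implicit Types (a : nat -> C).

Lemma poch_gt0 m : 0 < poch mu m.
Proof. by apply: prodr_gt0 => i _; rewrite ltr_pwDl. Qed.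

Lemma Hmu_norm2_bounded a : (Hmu_norm2 mu a < +oo)%E <->
  exists K, forall N, \sum_(0 <= m < N) m`!%:R / poch mu m * normc (a m) ^+ 2 <= K.
Proof.
have w0 m : 0 <= m`!%:R / poch mu m * normc (a m) ^+ 2.
  by rewrite mulr_ge0 ?sqr_ge0// divr_ge0// ltW// poch_gt0.
split=> [fin|[K hK]].
  have hl : Hmu_norm2 mu a = (fine (Hmu_norm2 mu a))%:E.
    rewrite fineK// ge0_fin_numE//.
    by apply: nneseries_ge0 => m _ _; rewrite lee_fin.
  exists (fine (Hmu_norm2 mu a)) => N; rewrite -lee_fin -hl -sumEFin.
  by apply: nneseries_lim_ge => m _ _; rewrite lee_fin.
apply: (@le_lt_trans _ _ K%:E); last by rewrite ltry.
apply: lime_le; first by apply: is_cvg_nneseries => m _ _; rewrite lee_fin.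
by apply: nearW => N; rewrite sumEFin lee_fin.
Qed.

(** A bounded weighted sum gives |a_m|^2 <= K (mu)_m / m!, and x_m = (mu)_m / m! r^m is bounded
    because its ratio r (mu + m) / (m + 1) is eventually at most 1. The inequality |a| <= 1 + |a|^2
    then removes the square. *)
Lemma weighted_subexponential a :
  (exists K, forall N, \sum_(0 <= m < N) m`!%:R / poch mu m * normc (a m) ^+ 2 <= K) ->
  subexponential a.
Proof.
move=> [K hK] r /andP[r0 r1].
have w0 m : 0 <= m`!%:R / poch mu m * normc (a m) ^+ 2.
  by rewrite mulr_ge0 ?sqr_ge0// divr_ge0// ltW// poch_gt0.
have hm m : normc (a m) ^+ 2 <= K * (poch mu m / m`!%:R).
  have := hK m.+1; rewrite big_nat_recr//= => h.
  have {}h : m`!%:R / poch mu m * normc (a m) ^+ 2 <= K.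
    by apply: le_trans h; rewrite lerDr sumr_ge0.
  rewrite -(ler_pM2l (_ : 0 < m`!%:R / poch mu m)); last first.
    by rewrite divr_gt0 ?poch_gt0// ltr0n fact_gt0.
  apply: le_trans h _; rewrite mulrCA mulf_div [_ * m`!%:R]mulrC divff ?mulr1//.
  by rewrite mulf_neq0 ?lt0r_neq0 ?poch_gt0// ltr0n fact_gt0.
have K0 : 0 <= K by apply: le_trans (hK 0%N); rewrite big_geq.
pose x m := poch mu m / m`!%:R * r ^+ m.
have x0 m : 0 <= x m by rewrite mulr_ge0 ?exprn_ge0// divr_ge0// ltW// poch_gt0.
have xS m : x m.+1 = x m * (r * (mu + m%:R) / m.+1%:R).
  rewrite /x /poch big_ord_recr/= factS natrM exprSr invfM; ring.
have [N hN] : exists N : nat, forall m, (N <= m)%N -> r * (mu + m%:R) <= m.+1%:R.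
  have r1' : 0 < 1 - r by rewrite subr_gt0.
  have c0 : 0 <= r * mu / (1 - r) by rewrite divr_ge0// ?mulr_ge0// ltW.
  (* Beyond this index r mu < (1 - r) m, so r (mu + m) < m. *)
  exists (Num.bound (r * mu / (1 - r))) => m Nm.
  have := lt_le_trans (archi_boundP c0) (_ : _ <= m%:R); rewrite ler_nat => /(_ Nm).
  rewrite ltr_pdivrMr// -(natr1 m); nra.
have xN m : x (N + m)%N <= x N.
  elim: m => [|m IH]; rewrite ?addn0// addnS xS; apply: le_trans IH.
  by rewrite ler_piMr// ler_pdivrMr// mul1r hN// leq_addr.
have [L hL] : exists L, forall m, x m <= L.
  exists (\sum_(i < N.+1) x i) => m; have [mN|Nm] := leqP m N.
    by rewrite (bigD1 (Ordinal (mN : (m < N.+1)%N)))//= lerDl sumr_ge0.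
  rewrite -(subnKC (ltnW Nm)); apply: le_trans (xN _) _.
  by rewrite (bigD1 ord_max)//= lerDl sumr_ge0.
exists (1 + K * L) => m.
have h1 : normc (a m) ^+ 2 * r ^+ m <= K * L.
  apply: (@le_trans _ _ (K * x m)); last by rewrite ler_wpM2l.
  by rewrite /x mulrA ler_wpM2r ?exprn_ge0.
have t1 : r ^+ m <= 1 by rewrite exprn_ile1// ltW.
have h2 : normc (a m) * r ^+ m <= (1 + normc (a m) ^+ 2) * r ^+ m.
  rewrite ler_wpM2r ?exprn_ge0//; move: (normc (a m)) => y; have := sqr_ge0 (y - 1).
  by have := sqr_ge0 y; rewrite !expr2; lra.
by apply: le_trans h2 _; rewrite mulrDl mul1r lerD.
Qed.

End weighted_coefficients.

(** * Gaussian functions are Schwartz *)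

Section gradient_calculus.
Context (R : realType) (n : nat).
Local Notation V := 'rV[R]_n.
Implicit Types (f g : V -> R) (x : V) (j : 'I_n).

(** Differentiability together with explicit partial derivatives: both pass through sums, products
    and exponentials at once, and [pderiv j f] can then be rewritten as a function, which iterated
    derivatives require. *)
Definition has_gradient f (df : 'I_n -> V -> R) : Prop :=
  forall x, differentiable f x /\ forall j, pderiv j f x = df j x.

Lemma pderivE f df j : has_gradient f df -> pderiv j f = df j.
Proof. by move=> h; apply/funext => x; have [_] := h x. Qed.

Lemma has_gradient_pderiv f : (forall x, differentiable f x) ->
  has_gradient f (fun j => pderiv j f).
Proof. by move=> h x. Qed.

Lemma has_gradient_cst (c : R) : has_gradient (fun=> c) (fun _ _ => 0).
Proof.
move=> x; split=> [|j]; first exact: differentiable_cst.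
by rewrite /pderiv; exact: derive_val.
Qed.

Lemma has_gradient_coord i : has_gradient (fun x => x 0 i) (fun j _ => (i == j)%:R).
Proof.
move=> x; split=> [|j]; first exact: differentiable_coord.
rewrite /pderiv /derive; apply: cvg_lim => //; apply: cvg_near_cst.
exists 1 => //= t _ t0; rewrite !mxE eqxx eq_sym addrK /GRing.scale/=.
by rewrite mulrA mulVf// mul1r.
Qed.

Lemma has_gradientD f g df dg : has_gradient f df -> has_gradient g dg ->
  has_gradient (fun x => f x + g x) (fun j x => df j x + dg j x).
Proof.
move=> hf hg x; have [df1 df2] := hf x; have [dg1 dg2] := hg x.
split=> [|j]; first exact: (@differentiableD _ _ _ f g).
rewrite -df2 -dg2 /pderiv; apply: (@deriveD _ _ _ f g); exact: diff_derivable.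
Qed.

Lemma has_gradientM f g df dg : has_gradient f df -> has_gradient g dg ->
  has_gradient (fun x => f x * g x) (fun j x => df j x * g x + f x * dg j x).
Proof.
move=> hf hg x; have [df1 df2] := hf x; have [dg1 dg2] := hg x.
split=> [|j]; first exact: (@differentiableM _ _ f g).
rewrite -df2 -dg2 /pderiv.
rewrite (@deriveM _ _ f g); [|exact: diff_derivable|exact: diff_derivable].
by rewrite addrC /GRing.scale /=; congr (_ + _); rewrite mulrC.
Qed.

Lemma has_gradient_expR f df : has_gradient f df ->
  has_gradient (fun x => expR (f x)) (fun j x => df j x * expR (f x)).
Proof.
move=> hf x; have [df1 df2] := hf x.
have de : differentiable (@expR R) (f x).
  by apply/derivable1_diffP; exact: derivable_expR.
have dc : differentiable (fun x => expR (f x)) x.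
  exact: (@differentiable_comp _ _ _ _ f (@expR R)).
split=> // j; rewrite -df2 /pderiv !deriveE//.
rewrite (_ : (fun x => expR (f x)) = @expR R \o f)//.
rewrite diff_comp// /= diff1E//.
by rewrite derive1E; have -> : 'D_1 (@expR R) (f x) = expR (f x) by exact: derive_val.
Qed.

Lemma has_gradient_sum (I : Type) (r : seq I) (f : I -> V -> R) df :
  (forall i, has_gradient (f i) (df i)) ->
  has_gradient (fun x => \sum_(i <- r) f i x) (fun j x => \sum_(i <- r) df i j x).
Proof.
move=> h; elim: r => [|i r IH].
  rewrite (_ : (fun x => _) = fun=> 0); last by apply/funext => x; rewrite big_nil.
  rewrite (_ : (fun j x => _) = fun _ _ => 0); first exact: has_gradient_cst.
  by apply/funext => j; apply/funext => x; rewrite big_nil.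
rewrite (_ : (fun x => _) = fun x => f i x + \sum_(i <- r) f i x); last first.
  by apply/funext => x; rewrite big_cons.
rewrite (_ : (fun j x => _) = fun j x => df i j x + \sum_(i <- r) df i j x).
  exact: has_gradientD.
by apply/funext => j; apply/funext => x; rewrite big_cons.
Qed.

Lemma differentiable_continuousT f : (forall x, differentiable f x) -> continuous f.
Proof. by move=> h x; exact: differentiable_continuous. Qed.

End gradient_calculus.

(** * Schwartz functions *)

Section schwartz_class.
Context (R : realType) (n : nat).
Local Notation V := 'rV[R]_n.
Implicit Types (f g : V -> R) (x : V) (j : 'I_n).

(** Decay measured by 1 + |x|^2 with the Euclidean norm instead of the supremum norm: this quantity
    is at least 1, so its powers are monotone in the exponent, and it dominates each coordinate and
    each factor of the product weight. *)
Definition rapid f : Prop :=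
  forall N : nat, exists M : R, forall x, (1 + sqnorm x) ^+ N * `|f x| <= M.

Lemma sqnorm_ge0 x : 0 <= sqnorm x.
Proof. by apply: sumr_ge0 => j _; exact: sqr_ge0. Qed.

Lemma onesq_ge1 x : 1 <= 1 + sqnorm x.
Proof. by rewrite lerDl sqnorm_ge0. Qed.

Lemma onesq_gt0 x : 0 < 1 + sqnorm x.
Proof. by rewrite (lt_le_trans ltr01)// onesq_ge1. Qed.

Lemma coord_sqr_le x j : (x 0 j) ^+ 2 <= sqnorm x.
Proof.
by rewrite /sqnorm (bigD1 j)//= lerDl sumr_ge0// => i _; exact: sqr_ge0.
Qed.

Lemma ler_onesq (t : R) x : 0 <= t -> t ^+ 2 <= sqnorm x -> t <= 1 + sqnorm x.
Proof.
move=> t0 h; apply: (@le_trans _ _ (1 + t ^+ 2)); last by rewrite lerD2l.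
by have := sqr_ge0 (t - 1); rewrite !expr2; nra.
Qed.

Lemma coord_le x j : `|x 0 j| <= 1 + sqnorm x.
Proof.
by apply: ler_onesq => //; rewrite real_normK ?num_real// coord_sqr_le.
Qed.

Lemma norm_le_onesq x : `|x| <= 1 + sqnorm x.
Proof.
have -> : `|x| = mx_norm x by [].
have [->|/mx_norm_neq0[[i j] ->]] := eqVneq (mx_norm x) 0; first exact/ltW/onesq_gt0.
by rewrite (ord1 i); exact: coord_le.
Qed.

Lemma coord_le_norm x j : `|x 0 j| <= `|x|.
Proof.
have -> : `|x| = mx_norm x by [].
rewrite mx_normrE.
exact: (le_bigmax _ (fun ij : 'I_1 * 'I_n => `|x ij.1 ij.2|) (ord0, j)).
Qed.

Lemma onesq_le_norm x : 1 + sqnorm x <= n.+1%:R * Num.max 1 (`|x| ^+ 2).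
Proof.
rewrite -nat1r mulrDl mul1r lerD//; first by rewrite le_max lexx.
rewrite mulr_natl -[X in _ *+ X]card_ord -sumr_const; apply: ler_sum => j _.
rewrite le_max; apply/orP; right.
by rewrite -real_normK ?num_real// lerXn2r ?nnegrE// coord_le_norm.
Qed.

(** Iterated partial derivatives never leave P, so it suffices to exhibit a class of functions
    stable under one derivative; no Leibniz formula for iterated derivatives has to be written. *)
Lemma schwartz_coind (P : (V -> R) -> Prop) :
  (forall f, P f -> [/\ forall x, differentiable f x, rapid f &
     forall j, P (pderiv j f)]) ->
  forall f, P f -> schwartz f.
Proof.
move=> hP f Pf s; have : P (foldr (@pderiv R n) f s).
  by elim: s => //= j s /hP[_ _]; exact.
move: (foldr _ _ _) => g /hP[dg rg _]; split=> // m.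
have [M hM] := rg m; exists M => x; apply: le_trans (hM x).
by rewrite ler_wpM2r// lerXn2r ?nnegrE ?norm_le_onesq// ltW// onesq_gt0.
Qed.

Lemma schwartz_differentiable f : schwartz f -> forall x, differentiable f x.
Proof. by move=> /(_ [::])[]. Qed.

Lemma schwartz_continuous f : schwartz f -> continuous f.
Proof. by move=> /schwartz_differentiable; exact: differentiable_continuousT. Qed.

Lemma schwartz_pderiv f j : schwartz f -> schwartz (pderiv j f).
Proof. by move=> sf s; have := sf (rcons s j); rewrite foldr_rcons. Qed.

Lemma schwartz_rapid f : schwartz f -> rapid f.
Proof.
move=> /(_ [::])[_ /= h] N.
have [M0 h0] := h 0%N; have [M1 h1] := h (2 * N)%N.
(* From 1 + |x|^2 <= (n + 1) max(1, |x|_sup^2): the N-th power of the maximum is covered by the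
   decay of order 0 or of order 2N. *)
exists (n.+1%:R ^+ N * (M0 + M1)) => x.
apply: (@le_trans _ _ ((n.+1%:R * Num.max 1 (`|x| ^+ 2)) ^+ N * `|f x|)).
  by rewrite ler_wpM2r// lerXn2r ?nnegrE ?onesq_le_norm// ?mulr_ge0 ?le_max ?ler01//
    ltW// onesq_gt0.
rewrite exprMn -mulrA ler_wpM2l ?exprn_ge0//.
have := h0 x; have := h1 x; rewrite expr0 mul1r exprM => h1x h0x.
have h1x0 : 0 <= (`|x| ^+ 2) ^+ N * `|f x| by rewrite mulr_ge0// exprn_ge0// sqr_ge0.
by rewrite maxEle; case: ifPn => _; rewrite ?expr1n ?mul1r; have := normr_ge0 (f x); lra.
Qed.

Lemma rapid_mul_coord f j : rapid f -> rapid (fun x => x 0 j * f x).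
Proof.
move=> rf N; have [M hM] := rf N.+1; exists M => x; apply: le_trans (hM x).
rewrite normrM mulrA ler_wpM2r// exprSr ler_wpM2l ?coord_le//.
by rewrite exprn_ge0// ltW// onesq_gt0.
Qed.

Lemma rapidD f g : rapid f -> rapid g -> rapid (fun x => f x + g x).
Proof.
move=> rf rg N; have [M hM] := rf N; have [M' hM'] := rg N.
exists (M + M') => x; apply: le_trans (lerD (hM x) (hM' x)).
by rewrite -mulrDr ler_wpM2l ?ler_normD// exprn_ge0// ltW// onesq_gt0.
Qed.

Lemma rapidM f g : rapid f -> rapid g -> rapid (fun x => f x * g x).
Proof.
move=> rf rg N; have [M hM] := rf N; have [M' hM'] := rg 0%N.
exists (M * M') => x; rewrite normrM mulrA.
have := hM' x; rewrite expr0 mul1r => hg; apply: ler_pM => //.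
by rewrite mulr_ge0// exprn_ge0// ltW// onesq_gt0.
Qed.

Lemma schwartzD f g : schwartz f -> schwartz g -> schwartz (fun x => f x + g x).
Proof.
move=> sf sg; apply: (@schwartz_coind (fun F => exists f g,
    [/\ schwartz f, schwartz g & F = fun x => f x + g x])); last by exists f, g.
move=> _ [{sf}f [{sg}g [sf sg ->]]].
have H : has_gradient (fun x => f x + g x) (fun j x => pderiv j f x + pderiv j g x).
  by apply: has_gradientD; apply: has_gradient_pderiv; exact: schwartz_differentiable.
split.
- by move=> x; have [] := H x.
- by apply: rapidD; exact: schwartz_rapid.
- by move=> j; rewrite (pderivE _ H); exists (pderiv j f), (pderiv j g);
    split=> //; exact: schwartz_pderiv.
Qed.

Lemma schwartz0 : schwartz (fun _ : V => 0 : R).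
Proof.
apply: (@schwartz_coind (fun F => F = fun=> 0)) => // _ ->; split.
- by move=> x; exact: differentiable_cst.
- by move=> N; exists 0 => x; rewrite normr0 mulr0.
- by move=> j; rewrite (pderivE _ (@has_gradient_cst R n 0)).
Qed.

(** The products x_i f alone are not stable under d_i, which produces an extra f; the stable class
    consists of the functions x_i f + g. *)
Lemma schwartz_mul_coord f i : schwartz f -> schwartz (fun x => x 0 i * f x).
Proof.
move=> sf; apply: (@schwartz_coind (fun F => exists f g,
    [/\ schwartz f, schwartz g & F = fun x => x 0 i * f x + g x])); last first.
  exists f, (fun=> 0); split=> //; first exact: schwartz0.
  by apply/funext => x; rewrite addr0.
move=> _ [{sf}f [g [sf sg ->]]].
have H : has_gradient (fun x => x 0 i * f x + g x)
    (fun j x => (i == j)%:R * f x + x 0 i * pderiv j f x + pderiv j g x).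
  apply: has_gradientD; last by apply: has_gradient_pderiv; exact: schwartz_differentiable.
  apply: (has_gradientM (@has_gradient_coord R n i)).
  by apply: has_gradient_pderiv; exact: schwartz_differentiable.
split.
- by move=> x; have [] := H x.
- by apply: rapidD; [apply: rapid_mul_coord|]; exact: schwartz_rapid.
- move=> j; rewrite (pderivE _ H); exists (pderiv j f), (fun x => (i == j)%:R * f x + pderiv j g x).
  split; [exact: schwartz_pderiv| |by apply/funext => x; rewrite addrCA addrA].
  apply: schwartzD; last exact: schwartz_pderiv.
  by case: eqVneq => _; under eq_fun do rewrite ?mul1r ?mul0r; rewrite //; exact: schwartz0.
Qed.

End schwartz_class.

(** * Polynomials times the Gaussian *)

Lemma mpoly_alg_ind (K : comNzRingType) (n : nat) (P : mpoly.mpoly n K -> Prop) :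
  (forall c, P (mpoly.mpolyC n c)) ->
  (forall i, P (mpoly.mpolyX K (mpoly.mnm1 i))) ->
  (forall p q, P p -> P q -> P (p + q)) ->
  (forall p q, P p -> P q -> P (p * q)) -> forall p, P p.
Proof.
move=> hC hX hD hM p; rewrite (mpoly.mpolyE p).
have h0 : P 0 by rewrite -mpoly.mpolyC0; exact: hC.
have h1 : P 1 by rewrite -mpoly.mpolyC1; exact: hC.
apply: big_ind => // m _; rewrite -mpoly.mul_mpolyC; apply: (hM) => //.
rewrite mpoly.mpolyXE_id; apply: big_ind => // i _.
by elim: (mpoly.fun_of_multinom m i) => [|d IH]; rewrite ?expr0// exprS; exact: hM.
Qed.

Section gaussian_functions.
Context (R : realType) (n : nat).
Local Notation V := 'rV[R]_n.
Local Notation MP := (mpoly.mpoly n R[i]).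
Local Notation X := (@mvar _ n).
Implicit Types (q r : MP) (x : V) (j : 'I_n).

Lemma poly_evalD q r x : poly_eval (q + r) x = poly_eval q x + poly_eval r x.
Proof. exact: mpoly.mevalD. Qed.

Lemma poly_evalB q r x : poly_eval (q - r) x = poly_eval q x - poly_eval r x.
Proof. exact: mpoly.mevalB. Qed.

Lemma poly_evalM q r x : poly_eval (q * r) x = poly_eval q x * poly_eval r x.
Proof. exact: mpoly.mevalM. Qed.

Lemma poly_evalZ c q x : poly_eval (c *: q) x = c * poly_eval q x.
Proof. exact: mpoly.mevalZ. Qed.

Lemma poly_eval_mvar j x : poly_eval (X j) x = (x 0 j)%:C.
Proof. exact: mpoly.mevalXU. Qed.

Lemma poly_eval_sum (I : Type) (s : seq I) (F : I -> MP) x :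
  poly_eval (\sum_(i <- s) F i) x = \sum_(i <- s) poly_eval (F i) x.
Proof. by rewrite /poly_eval raddf_sum. Qed.

Lemma poly_eval_msqnorm x : poly_eval (@msqnorm _ n) x = (sqnorm x)%:C.
Proof.
rewrite /msqnorm poly_eval_sum rmorph_sum; apply: eq_bigr => j _.
by rewrite expr2 poly_evalM poly_eval_mvar -rmorphM -expr2.
Qed.

Lemma ReM (a b : R[i]) : complex.Re (a * b) =
  complex.Re a * complex.Re b - complex.Im a * complex.Im b.
Proof. by case: a b => [? ?] [? ?]. Qed.

Lemma ImM (a b : R[i]) : complex.Im (a * b) =
  complex.Re a * complex.Im b + complex.Im a * complex.Re b.
Proof. by case: a b => [? ?] [? ?]. Qed.

Lemma ReD (a b : R[i]) : complex.Re (a + b) = complex.Re a + complex.Re b.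
Proof. by case: a b => [? ?] [? ?]. Qed.

Lemma ReB (a b : R[i]) : complex.Re (a - b) = complex.Re a - complex.Re b.
Proof. by case: a b => [? ?] [? ?]. Qed.

Lemma ImD (a b : R[i]) : complex.Im (a + b) = complex.Im a + complex.Im b.
Proof. by case: a b => [? ?] [? ?]. Qed.

(** The real and imaginary parts are treated together because each part of a product involves both
    parts of the factors. *)
Lemma has_gradient_poly_eval q :
  has_gradient (fun x : V => complex.Re (poly_eval q x))
    (fun j x => complex.Re (poly_eval (mpoly.mderiv j q) x)) /\
  has_gradient (fun x : V => complex.Im (poly_eval q x))
    (fun j x => complex.Im (poly_eval (mpoly.mderiv j q) x)).
Proof.
have ext f g df dg : @has_gradient R n f df -> f =1 g -> (forall j, df j =1 dg j) ->
    has_gradient g dg.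
  by move=> h /funext <- e; rewrite (_ : dg = df)//; apply/funext => j; apply/funext => x; rewrite e.
elim/mpoly_alg_ind: q => [c|i|p q [p1 p2] [q1 q2]|p q [p1 p2] [q1 q2]].
- split.
    apply: ext (has_gradient_cst (complex.Re c)) _ _ => [x|j x].
      by rewrite /poly_eval mpoly.mevalC.
    by rewrite mpoly.mderivC /poly_eval mpoly.meval0.
  apply: ext (has_gradient_cst (complex.Im c)) _ _ => [x|j x].
    by rewrite /poly_eval mpoly.mevalC.
  by rewrite mpoly.mderivC /poly_eval mpoly.meval0.
- have E j x : poly_eval (mpoly.mderiv j (mpoly.mpolyX R[i] (mpoly.mnm1 i))) x =
      (i == j)%:R.
    by rewrite (mderiv_var R[i] j i) eq_sym /poly_eval rmorph_nat.
  split.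
    apply: ext (@has_gradient_coord R n i) _ _ => [x|j x].
      by rewrite poly_eval_mvar.
    by rewrite E; case: eqP.
  apply: ext (has_gradient_cst 0) _ _ => [x|j x].
    by rewrite poly_eval_mvar.
  by rewrite E; case: eqP.
- split.
    apply: ext (has_gradientD p1 q1) _ _ => [x|j x].
      by rewrite poly_evalD raddfD.
    by rewrite mpoly.mderivD poly_evalD raddfD.
  apply: ext (has_gradientD p2 q2) _ _ => [x|j x].
    by rewrite poly_evalD raddfD.
  by rewrite mpoly.mderivD poly_evalD raddfD.
- have N (f : V -> R) df : has_gradient f df -> has_gradient (fun x => - f x) (fun j x => - df j x).
    move=> h; apply: ext (has_gradientM (has_gradient_cst (-1)) h) _ _ => [x|j x].
      by rewrite mulN1r.
    by rewrite mul0r add0r mulN1r.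
  split.
    apply: ext (has_gradientD (has_gradientM p1 q1) (N _ _ (has_gradientM p2 q2))) _ _ => [x|j x].
      by rewrite poly_evalM ReM.
    by rewrite mpoly.mderivM poly_evalD !poly_evalM ReD !ReM /=; ring.
  apply: ext (has_gradientD (has_gradientM p1 q2) (has_gradientM p2 q1)) _ _ => [x|j x].
    by rewrite poly_evalM ImM.
  by rewrite mpoly.mderivM poly_evalD !poly_evalM ImD !ImM /=; ring.
Qed.

Definition gauss x : R := expR (- (sqnorm x / 2)).

Lemma has_gradient_gauss : has_gradient gauss (fun j x => - x 0 j * gauss x).
Proof.
have H0 : has_gradient (@sqnorm R n) (fun j x => 2 * x 0 j).
  have := has_gradient_sum (index_enum 'I_n) (fun i =>
    has_gradientM (@has_gradient_coord R n i) (@has_gradient_coord R n i)).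
  rewrite (_ : (fun x => _) = @sqnorm R n); last first.
    by apply/funext => x; apply: eq_bigr => i _; rewrite expr2.
  rewrite (_ : (fun j x => _) = fun j x => 2 * x 0 j)//.
  apply/funext => j; apply/funext => x; rewrite (bigD1 j)//= eqxx big1 => [|i /negPf ->].
    by rewrite mul1r mulr1 addr0; ring.
  by rewrite mul0r mulr0 addr0.
have H1 : has_gradient (fun x : V => - (sqnorm x / 2)) (fun j x => - x 0 j).
  have := has_gradientM H0 (@has_gradient_cst R n (- 2^-1)).
  rewrite (_ : (fun x => _) = fun x : V => - (sqnorm x / 2)); last first.
    by apply/funext => x; rewrite mulrN.
  rewrite (_ : (fun j x => _) = fun j x => - x 0 j)//.
  by apply/funext => j; apply/funext => x; field.
exact: has_gradient_expR H1.
Qed.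

Definition gfun q x : R[i] := poly_eval q x * (gauss x)%:C.
(** Test functions are real-valued, hence the real part; the imaginary part of [gfun q] is obtained
    as [regfun (- 'i%C *: q)]. *)
Definition regfun q x : R := complex.Re (gfun q x).
(* [d_j - x_j] is [d_j] conjugated by the Gaussian. *)
Definition gderiv j q : MP := mpoly.mderiv j q - X j * q.

Lemma regfunE q x : regfun q x = complex.Re (poly_eval q x) * gauss x.
Proof. by rewrite /regfun /gfun ReM /= mulr0 subr0. Qed.

Lemma has_gradient_regfun q : has_gradient (regfun q) (fun j => regfun (gderiv j q)).
Proof.
have [h _] := has_gradient_poly_eval q.
have := has_gradientM h has_gradient_gauss.
rewrite (_ : (fun x => _) = regfun q); last by apply/funext => x; rewrite regfunE.
rewrite (_ : (fun j x => _) = fun j => regfun (gderiv j q))//.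
apply/funext => j; apply/funext => x; rewrite regfunE /gderiv.
by rewrite poly_evalB poly_evalM poly_eval_mvar ReB ReM /=; ring.
Qed.

Lemma gfunD q r x : gfun (q + r) x = gfun q x + gfun r x.
Proof. by rewrite /gfun poly_evalD mulrDl. Qed.

Lemma gfunZ c q x : gfun (c *: q) x = c * gfun q x.
Proof. by rewrite /gfun poly_evalZ mulrA. Qed.

Lemma gfun_mvarM j q x : gfun (X j * q) x = (x 0 j)%:C * gfun q x.
Proof. by rewrite /gfun poly_evalM poly_eval_mvar mulrA. Qed.

Lemma poly_eval_bound q : exists K d, forall x,
  normc (poly_eval q x) <= K * (1 + sqnorm x) ^+ d.
Proof.
elim/mpoly_alg_ind: q => [c|i|p q [K1 [d1 h1]] [K2 [d2 h2]]|p q [K1 [d1 h1]] [K2 [d2 h2]]].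
- by exists (normc c), 0%N => x; rewrite /poly_eval mpoly.mevalC expr0 mulr1.
- exists 1, 1%N => x; rewrite poly_eval_mvar normc_real mul1r expr1; exact: coord_le.
- have K0 (K : R) d (p' : MP) : (forall x, normc (poly_eval p' x) <= K * (1 + sqnorm x) ^+ d) ->
      0 <= K.
    move=> h; have := le_trans (normc_ge0 _) (h 0).
    by rewrite pmulr_lge0// exprn_gt0// onesq_gt0.
  exists (K1 + K2), (d1 + d2)%N => x; rewrite poly_evalD mulrDl.
  apply: le_trans (le_normcD _ _) _; apply: lerD.
    apply: le_trans (h1 x) _; rewrite ler_wpM2l ?(K0 _ _ _ h1)//.
    by rewrite ler_weXn2l ?onesq_ge1// leq_addr.
  apply: le_trans (h2 x) _; rewrite ler_wpM2l ?(K0 _ _ _ h2)//.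
  by rewrite ler_weXn2l ?onesq_ge1// leq_addl.
- exists (K1 * K2), (d1 + d2)%N => x; rewrite poly_evalM normcM exprD mulrACA.
  by apply: ler_pM => //; exact: normc_ge0.
Qed.

Lemma gauss_rapid (N : nat) : exists M : R, forall x : V, (1 + sqnorm x) ^+ N * gauss x <= M.
Proof.
(* With y = 1 + |x|^2 the Gaussian is exp(1/2) / exp(y/2), and exp(y/2) is at least (y/2)^(N+1) /
   (N+1)!, a term of its series; finally y^N <= y^(N+1). *)
exists (2 ^+ N.+1 * N.+1`!%:R * expR 2^-1) => x; set y := 1 + sqnorm x.
have y1 : 1 <= y by exact: onesq_ge1.
have y0 : 0 < y by exact: onesq_gt0.
have -> : gauss x = expR 2^-1 * (expR (y / 2))^-1.
  by rewrite -expRN -expRD /gauss /y; congr expR; field.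
have h1 : y ^+ N.+1 / (2 ^+ N.+1 * N.+1`!%:R) <= expR (y / 2).
  have := expR_ge1Dxn N (ltW (divr_gt0 y0 (@ltr0n R 2))).
  rewrite expr_div_n -mulrA -invfM; apply: le_trans; by rewrite lerDr.
rewrite mulrA ler_pdivrMr ?expR_gt0// [_ * expR 2^-1 * _]mulrAC ler_pM2r ?expR_gt0//.
have c0 : 0 < 2 ^+ N.+1 * N.+1`!%:R :> R.
  by rewrite mulr_gt0 ?exprn_gt0// ltr0n fact_gt0.
rewrite -ler_pdivrMl// mulrC; apply: le_trans h1.
by rewrite ler_pM2r ?invr_gt0// ler_weXn2l.
Qed.

Lemma regfun_rapid q : rapid (regfun q).
Proof.
move=> N; have [K [d hK]] := poly_eval_bound q; have [M hM] := gauss_rapid (N + d).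
exists (K * M) => x; rewrite regfunE normrM.
have K0 : 0 <= K.
  have := le_trans (normc_ge0 _) (hK 0).
  by rewrite pmulr_lge0// exprn_gt0// onesq_gt0.
apply: (@le_trans _ _ (K * ((1 + sqnorm x) ^+ (N + d) * gauss x))).
  rewrite exprD !mulrA [`|gauss x|]ger0_norm ?expR_ge0// ler_wpM2r ?expR_ge0//.
  rewrite [leRHS]mulrAC [leRHS]mulrC ler_wpM2l//.
    by rewrite exprn_ge0// ltW// onesq_gt0.
  exact: le_trans (normc_Re _) (hK x).
by rewrite ler_wpM2l.
Qed.

Lemma schwartz_regfun q : schwartz (regfun q).
Proof.
apply: (@schwartz_coind _ _ (fun F => exists q, F = regfun q)); last by exists q.
move=> _ [{}q ->]; have H := has_gradient_regfun q; split.
- by move=> x; have [] := H x.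
- exact: regfun_rapid.
- by move=> j; rewrite (pderivE _ H); exists (gderiv j q).
Qed.

(** All iterated derivatives of q vanish as functions, and the derivative belonging to a monomial,
    evaluated at 0, is the coefficient of that monomial times a product of factorials. *)
Lemma poly_eval_eq0 q : (forall x, poly_eval q x = 0) -> q = 0.
Proof.
move=> q0; have dq s x : poly_eval (foldr (@mpoly.mderiv n R[i]) q s) x = 0.
  elim: s x => [|j s IH] x //=; have [h1 h2] := has_gradient_poly_eval (foldr (@mpoly.mderiv n R[i]) q s).
  have := pderivE j h1; have := pderivE j h2.
  rewrite (_ : (fun x => _) = fun=> 0); last by apply/funext => y; rewrite IH.
  rewrite (_ : (fun x => complex.Re _) = fun=> 0); last by apply/funext => y; rewrite IH.
  rewrite (pderivE j (@has_gradient_cst R n 0)) => /(congr1 (fun f => f x)) /= h3.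
  move=> /(congr1 (fun f => f x)) /= h4.
  by move: h3 h4; case: (poly_eval _ _) => a b /= <- <-.
apply/mpoly.mpolyP => m; rewrite mpoly.mcoeff0.
have := dq (flatten [seq nseq (mpoly.fun_of_multinom m j) j | j <- enum 'I_n]) 0.
rewrite -mpoly.mderivm_foldr.
have E (r : MP) : poly_eval r 0 = mpoly.mcoeff (mpoly.mnm0 (n:=n)) r.
  elim/mpoly_alg_ind: r => [c|i|p r h1 h2|p r h1 h2].
  - by rewrite /poly_eval mpoly.mevalC mpoly.mcoeffC eqxx mulr1.
  - by rewrite poly_eval_mvar mxE mpoly.mcoeffX mpoly.mnm1_eq0.
  - by rewrite poly_evalD mpoly.mcoeffD h1 h2.
  - by rewrite poly_evalM h1 h2 rmorphM.
rewrite E mpoly.mcoeff_mderivm mpoly.addm0 => /eqP.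
rewrite mulrn_eq0 => /orP[|/eqP//].
move=> /eqP h0; have : (0 < \prod_(i < n) (mpoly.fun_of_multinom m i) ^_ (mpoly.fun_of_multinom m i))%N.
  by apply: prodn_gt0 => i; rewrite ffactnn fact_gt0.
by rewrite h0.
Qed.

End gaussian_functions.

(** * Integrals of Schwartz functions and integration by parts *)

Section schwartz_integrals.
Context (R : realType) (n : nat).
Local Notation V := 'rV[R]_n.
Local Notation lebn := (lebesgue_tuple R n).
Implicit Types (f g phi : V -> R) (j : 'I_n).

Definition intg f : R := \int[lebn]_t f (rowT t).

(** Each 1 + t_i^2 is at most 1 + |t|^2, so decay of order n beats the product weight. *)
Lemma rapid_weight_bound f : rapid f ->
  exists M, forall t, `|f (rowT t)| <= M * cauchy_weight t.
Proof.
move=> rf; have [M hM] := rf n; exists M => t.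
rewrite -ler_pdivrMr ?cauchy_weight_gt0//; apply: le_trans (hM (rowT t)).
rewrite mulrC ler_wpM2r// /cauchy_weight big_tuple -prodfV.
rewrite -[X in _ ^+ X]card_ord -prodr_const; apply: ler_prod => i _.
rewrite invrK (le_trans ler01 (oneDsqr_ge1 _))/= /oneDsqr lerD2l.
by rewrite -[tnth t i]/((tnth t i : R)) -(tnth_rowT t i) coord_sqr_le.
Qed.

Lemma rapid_integrable f : continuous f -> rapid f ->
  lebn.-integrable setT (fun t => (f (rowT t))%:E).
Proof.
move=> cf /rapid_weight_bound[M hM]; apply: integrable_weight_bound hM.
exact: continuous_rowT_measurable.
Qed.

Lemma rapid_sqintegrable f : continuous f -> rapid f ->
  sqintegrable lebn (fun t => f (rowT t)).
Proof.
move=> cf rf; apply: integrable_sq; first exact: continuous_rowT_measurable.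
have -> : (fun t => (f (rowT t) ^+ 2)%:E) = (fun t => ((fun x => f x * f x) (rowT t))%:E).
  by apply/funext => t; rewrite expr2.
apply: (@rapid_integrable (fun x => f x * f x)); last exact: rapidM.
by move=> x; exact: continuousM (cf x) (cf x).
Qed.

Lemma schwartz_sqintegrable f : schwartz f -> sqintegrable lebn (fun t => f (rowT t)).
Proof.
by move=> sf; apply: rapid_sqintegrable; [exact: schwartz_continuous|exact: schwartz_rapid].
Qed.

Lemma schwartzM_integrable f g : schwartz f -> schwartz g ->
  lebn.-integrable setT (fun t => (f (rowT t) * g (rowT t))%:E).
Proof. by move=> sf sg; apply: mul_integrable; exact: schwartz_sqintegrable. Qed.

Lemma rowT_tupd (t : n.-tuple (measurableTypeR R)) j (s h : R) :
  rowT (tupd t j (h + s)) = h *: delta_mx 0 j + rowT (tupd t j s) :> V.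
Proof.
apply/rowP => i; rewrite !mxE !tnth_mktuple eqxx /=.
by case: eqVneq => _; rewrite ?mulr1 ?mulr0 ?add0r.
Qed.

Lemma integral_gradient_eq0 f df j : has_gradient f df -> continuous (df j) ->
  rapid f -> rapid (df j) -> intg (df j) = 0.
Proof.
move=> hf cdf /rapid_weight_bound[M1 h1] /rapid_weight_bound[M2 h2].
rewrite /intg /Rintegral.
have mm (t : n.-tuple (measurableTypeR R)) (y M M' : R) : y <= M * cauchy_weight t ->
    y <= Num.max M M' * cauchy_weight t.
  by move=> h; apply: le_trans h _; rewrite ler_wpM2r ?le_max ?lexx// ltW// cauchy_weight_gt0.
suff -> : (\int[lebn]_t (df j (rowT t))%:E = 0)%E by [].
apply: (@integral_partial_eq0 R n (fun t => f (rowT t)) (fun t => df j (rowT t)) j (Num.max M1 M2)).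
- exact: continuous_rowT_measurable.
- move=> t s; have [d1 /(_ j) d2] := hf (rowT (tupd t j s)).
  have := @diff_derivable _ _ _ f _ (delta_mx 0 j) d1; move: d2.
  rewrite /pderiv /derive /derivable => d2 d1'.
  (* The difference quotient in the j-th entry of the tuple is exactly the one defining the
     directional derivative on row vectors. *)
  have E : (fun h : R => h^-1 *: (((fun s : R => f (rowT (tupd t j s))) \o shift s) (h *: 1) -
        f (rowT (tupd t j s)))) =
      (fun h => h^-1 *: ((f \o shift (rowT (tupd t j s))) (h *: delta_mx 0 j) -
        f (rowT (tupd t j s)))).
    apply/funext => h /=; rewrite -rowT_tupd.
    by rewrite (_ : h *: (1 : R) = h)// /GRing.scale/= mulr1.
  by apply: DeriveDef; rewrite /derivable /derive E.
- move=> t s; have c := cdf (rowT (tupd t j s)).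
  apply: (@continuous_comp _ _ _ (fun s : R => rowT (tupd t j s)) (df j)) => //.
  rewrite (_ : (fun s : R => rowT (tupd t j s)) =
    (fun s : R => s *: delta_mx 0 j + rowT (tupd t j 0))); last first.
    by apply/funext => s'; rewrite -rowT_tupd addr0.
  have : continuous (fun s : R => s *: (delta_mx 0 j : V)).
    exact: (@scalel_continuous R V).
  by move=> /(_ s) h; apply: (@cvgD _ V); [exact: h|exact: cvg_cst].
- by move=> t; exact: mm.
- by move=> t; rewrite maxC; exact: mm.
Qed.

Lemma intgD f g : lebn.-integrable setT (fun t => (f (rowT t))%:E) ->
  lebn.-integrable setT (fun t => (g (rowT t))%:E) ->
  intg (fun x => f x + g x) = intg f + intg g.
Proof. by move=> h1 h2; rewrite /intg RintegralD. Qed.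

Lemma intgZ c f : lebn.-integrable setT (fun t => (f (rowT t))%:E) ->
  intg (fun x => c * f x) = c * intg f.
Proof. by move=> h1; rewrite /intg RintegralZl. Qed.

Lemma intg_by_parts f g j : schwartz f -> schwartz g ->
  intg (fun x => pderiv j f x * g x) = - intg (fun x => f x * pderiv j g x).
Proof.
move=> sf sg; apply/eqP; rewrite -addr_eq0 -intgD; last 2 first.
- by apply: schwartzM_integrable => //; exact: schwartz_pderiv.
- by apply: schwartzM_integrable => //; exact: schwartz_pderiv.
apply/eqP; have H := has_gradientM (has_gradient_pderiv (schwartz_differentiable sf))
  (has_gradient_pderiv (schwartz_differentiable sg)).
have cf := schwartz_continuous sf; have cg := schwartz_continuous sg.
have cdf := schwartz_continuous (schwartz_pderiv j sf).
have cdg := schwartz_continuous (schwartz_pderiv j sg).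
apply: (integral_gradient_eq0 (j := j) H).
- move=> x; exact: continuousD (continuousM (cdf x) (cg x)) (continuousM (cf x) (cdg x)).
- by apply: rapidM; exact: schwartz_rapid.
- by apply: rapidD; apply: rapidM; apply: schwartz_rapid => //; exact: schwartz_pderiv.
Qed.

End schwartz_integrals.

(** * Ladder operators and the Gaussian inner product *)

Section gaussian_pairing.
Context (R : realType) (n : nat).
Local Notation V := 'rV[R]_n.
Local Notation MP := (mpoly.mpoly n R[i]).
Local Notation C := R[i].
Local Notation X := (@mvar C n).
Local Notation gderiv := (@gderiv R n).
Local Notation lebn := (lebesgue_tuple R n).
Implicit Types (q r : MP) (phi : V -> R) (j : 'I_n).

Lemma ImE (z : C) : complex.Im z = complex.Re (- 'i%C * z).
Proof. by case: z => a b /=; ring. Qed.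

Lemma Im_gfun q x : complex.Im (gfun q x) = regfun (- 'i%C *: q) x.
Proof. by rewrite /regfun gfunZ ImE. Qed.

Lemma regfunD q r x : regfun (q + r) x = regfun q x + regfun r x.
Proof. by rewrite /regfun gfunD ReD. Qed.

Lemma regfun_mvarM j q x : regfun (X j * q) x = x 0 j * regfun q x.
Proof. by rewrite /regfun gfun_mvarM; case: (gfun q x) => a b /=; ring. Qed.

Lemma regfunZ c q x : regfun (c *: q) x =
  complex.Re c * regfun q x - complex.Im c * regfun (- 'i%C *: q) x.
Proof. by rewrite -Im_gfun /regfun gfunZ ReM. Qed.

Definition rpair q phi : R := intg (fun x => regfun q x * phi x).
(** The complex integral of [gfun q] times phi, assembled from two real integrals. It is the value
    at phi of the distribution given by [gfun q]. *)
Definition pair q phi : C := rpair q phi +i* rpair (- 'i%C *: q) phi.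

Lemma rpair_integrable q phi : schwartz phi ->
  lebn.-integrable setT (fun t => (regfun q (rowT t) * phi (rowT t))%:E).
Proof. by move=> sp; apply: schwartzM_integrable => //; exact: schwartz_regfun. Qed.

Lemma rpairD q r phi : schwartz phi -> rpair (q + r) phi = rpair q phi + rpair r phi.
Proof.
move=> sp; rewrite /rpair -intgD; [|exact: rpair_integrable|exact: rpair_integrable].
by congr intg; apply/funext => x; rewrite regfunD mulrDl.
Qed.

Lemma rpairZ c q phi : schwartz phi -> rpair (c *: q) phi =
  complex.Re c * rpair q phi - complex.Im c * rpair (- 'i%C *: q) phi.
Proof.
move=> sp; rewrite -mulNr /rpair.
have I1 := rpair_integrable q sp; have I2 := rpair_integrable (- 'i%C *: q) sp.
rewrite -intgZ// -intgZ// -intgD; last 2 first.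
- exact: (integrableZl _ (complex.Re c) I1).
- exact: (integrableZl _ (- complex.Im c) I2).
by congr intg; apply/funext => x; rewrite regfunZ; ring.
Qed.

Lemma pairD q r phi : schwartz phi -> pair (q + r) phi = pair q phi + pair r phi.
Proof. by move=> sp; rewrite /pair scalerDr !rpairD. Qed.

Lemma pairZ c q phi : schwartz phi -> pair (c *: q) phi = c * pair q phi.
Proof.
move=> sp; rewrite /pair scalerA (rpairZ c)// (rpairZ (- 'i%C * c))//.
move: (rpair q phi) (rpair (- 'i%C *: q) phi) => u v.
by case: c => a b; simpc => /=; congr Complex; ring.
Qed.

Lemma pair0 phi : schwartz phi -> pair 0 phi = 0.
Proof. by move=> sp; rewrite -(scale0r (0 : MP)) pairZ// mul0r. Qed.

Lemma pair_sum (I : Type) (s : seq I) (F : I -> MP) phi : schwartz phi ->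
  pair (\sum_(i <- s) F i) phi = \sum_(i <- s) pair (F i) phi.
Proof.
move=> sp; elim: s => [|i s IH]; first by rewrite !big_nil pair0.
by rewrite !big_cons pairD// IH.
Qed.

Lemma pairDr q phi psi : schwartz phi -> schwartz psi ->
  pair q (fun x => phi x + psi x) = pair q phi + pair q psi.
Proof.
move=> sp sq; rewrite /pair /rpair.
have H r : intg (fun x => regfun r x * (phi x + psi x)) =
    intg (fun x => regfun r x * phi x) + intg (fun x => regfun r x * psi x).
  rewrite -intgD; [|exact: rpair_integrable|exact: rpair_integrable].
  by congr intg; apply/funext => x; rewrite mulrDr.
by rewrite !H.
Qed.

Lemma pairZr q (a : R) phi : schwartz phi ->
  pair q (fun x => a * phi x) = a%:C * pair q phi.
Proof.
move=> sp; rewrite /pair /rpair.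
have H r : intg (fun x => regfun r x * (a * phi x)) =
    a * intg (fun x => regfun r x * phi x).
  rewrite -intgZ; last exact: rpair_integrable.
  by congr intg; apply/funext => x; rewrite mulrCA.
rewrite !H; move: (intg _) (intg _) => u v; by simpc.
Qed.

Lemma pair_mul_coord q phi j : pair q (fun x => x 0 j * phi x) = pair (X j * q) phi.
Proof.
have H r : rpair r (fun x => x 0 j * phi x) = rpair (X j * r) phi.
  by rewrite /rpair; congr intg; apply/funext => x; rewrite regfun_mvarM; ring.
by rewrite /pair !H -scalerAr.
Qed.

Lemma gderivZ c q j : gderiv j (c *: q) = c *: gderiv j q.
Proof. by rewrite /gderiv mpoly.mderivZ -scalerAr scalerBr. Qed.

Lemma pair_pderiv q phi j : schwartz phi ->
  pair q (pderiv j phi) = - pair (gderiv j q) phi.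
Proof.
move=> sp; have H r : rpair r (pderiv j phi) = - rpair (gderiv j r) phi.
  rewrite /rpair -(pderivE j (has_gradient_regfun r)) intg_by_parts ?opprK//.
  exact: schwartz_regfun.
by rewrite /pair !H -gderivZ.
Qed.

Definition isqrt2 : C := ((Num.sqrt 2)^-1)%:C.
(** Creation and annihilation transported to the polynomial factor: [gfun (cre j q)] is a_j^+
    applied to [gfun q], with [gderiv j] in the role of d_j, and likewise for [ann] and a_j. *)
Definition cre j q : MP := isqrt2 *: (X j * q - gderiv j q).
Definition ann j q : MP := isqrt2 *: (X j * q + gderiv j q).

Lemma isqrt2_sqr : isqrt2 * isqrt2 = 2^-1.
Proof.
rewrite /isqrt2 -rmorphM -invfM -expr2 sqr_sqrtr// fmorphV; congr (_^-1).
exact: rmorph_nat.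
Qed.

Lemma creE j q : cre j q = isqrt2 *: (2%:R * (X j * q) - mpoly.mderiv j q).
Proof. by rewrite /cre /gderiv; congr (_ *: _); ring. Qed.

Lemma annE j q : ann j q = isqrt2 *: mpoly.mderiv j q.
Proof. by rewrite /ann /gderiv; congr (_ *: _); ring. Qed.

Lemma number_opE q : \sum_j (cre j (ann j q) + 2^-1 *: q) =
  euler q - 2^-1 *: laplacian q + (n%:R / 2) *: q.
Proof.
rewrite big_split /= sumr_const card_ord scalerMnl -mulr_natl; congr (_ + _).
rewrite /euler /laplacian scaler_sumr -sumrB; apply: eq_bigr => j _.
rewrite creE annE mpoly.mderivZ -scalerAr [2%:R * _]mulrC -scalerAl -scalerBr.
rewrite scalerA isqrt2_sqr scalerBr; congr (_ - _).
by rewrite mulrC natZ scalerA mulVf ?scale1r// pnatr_eq0.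
Qed.

Lemma raise_opE q : \sum_j cre j (cre j q) =
  2^-1 *: (4%:R * @msqnorm C n * q - 4%:R * euler q - (2 * n)%:R * q + laplacian q).
Proof.
have -> : (2 * n)%:R * q = \sum_(j < n) 2%:R * q.
  by rewrite sumr_const card_ord mulnC natrM -mulrA mulr_natl.
rewrite /euler /laplacian /msqnorm -mulrA mulr_suml !mulr_sumr -!sumrB -big_split /=.
rewrite scaler_sumr; apply: eq_bigr => j _.
rewrite creE [cre j q]creE mpoly.mderivZ -scalerAr [2%:R * _]mulrC -scalerAl -scalerBr.
rewrite scalerA isqrt2_sqr; congr (_ *: _).
rewrite mpoly.mderivB.
have -> : mpoly.mderiv j (2%:R * (X j * q)) = 2%:R * (q + X j * mpoly.mderiv j q).
  by rewrite natZ mpoly.mderivZ mpoly.mderivM mderiv_var eqxx mul1r -natZ.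
by rewrite expr2; ring.
Qed.

Lemma lower_opE q : \sum_j ann j (ann j q) = 2^-1 *: laplacian q.
Proof.
rewrite /laplacian scaler_sumr; apply: eq_bigr => j _.
by rewrite !annE mpoly.mderivZ scalerA isqrt2_sqr.
Qed.

(* The integral of [gfun q] times the conjugate of [gfun r]. *)
Definition ip q r : C := pair q (regfun r) - 'i%C * pair q (regfun (- 'i%C *: r)).

Lemma ipDl q q' r : ip (q + q') r = ip q r + ip q' r.
Proof.
rewrite /ip !pairD; [|exact: schwartz_regfun..].
by rewrite mulrDr opprD addrACA.
Qed.

Lemma ipZl c q r : ip (c *: q) r = c * ip q r.
Proof.
rewrite /ip !pairZ; [|exact: schwartz_regfun..].
by rewrite mulrBr mulrCA.
Qed.

Lemma ipDr q r r' : ip q (r + r') = ip q r + ip q r'.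
Proof.
rewrite /ip scalerDr.
have E a b : regfun (a + b) = (fun x : V => regfun a x + regfun b x).
  by apply/funext => x; rewrite regfunD.
rewrite !E !pairDr; [|exact: schwartz_regfun..].
by rewrite mulrDr opprD addrACA.
Qed.

Lemma ipZr c q r : ip q (c *: r) = c^* * ip q r.
Proof.
rewrite /ip.
have E a b s : regfun ((a +i* b) *: s) =
    (fun x : V => a * regfun s x + - b * regfun (- 'i%C *: s) x).
  by apply/funext => x; rewrite regfunZ mulNr.
have Z (a : R) s : schwartz (fun x : V => a * regfun s x).
  rewrite (_ : (fun x => _) = regfun (a%:C *: s)); first exact: schwartz_regfun.
  by apply/funext => x; rewrite regfunZ /= mul0r subr0.
case: c => a b.
have -> : - 'i%C *: ((a +i* b) *: r) = (b +i* (- a)) *: r.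
  by rewrite scalerA; congr (_ *: _); simpc.
rewrite (E a b r) (E b (- a) r) !pairDr; [|exact: Z..].
rewrite !pairZr; [|exact: schwartz_regfun..].
move: (pair q _) (pair q _) => P P'.
by case: P P' => [x y] [x' y']; simpc => /=; congr Complex; ring.
Qed.

Lemma ip_mvar q r j : ip (X j * q) r = ip q (X j * r).
Proof.
have E s : regfun (X j * s) = (fun x : V => x 0 j * regfun s x).
  by apply/funext => x; rewrite regfun_mvarM.
by rewrite /ip scalerAr !E !pair_mul_coord.
Qed.

Lemma ip_gderiv q r j : ip (gderiv j q) r = - ip q (gderiv j r).
Proof.
have E s : regfun (gderiv j s) = pderiv j (regfun s).
  by rewrite (pderivE j (has_gradient_regfun s)).
rewrite /ip -gderivZ !E !pair_pderiv; [|exact: schwartz_regfun..].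
by rewrite mulrN -opprD opprK.
Qed.

Lemma conjc_isqrt2 : isqrt2^* = isqrt2.
Proof. by apply/eqP; rewrite /isqrt2 eq_complex /= oppr0 !eqxx. Qed.

Lemma ipNl q r : ip (- q) r = - ip q r.
Proof. by rewrite -[- q]scaleN1r ipZl mulN1r. Qed.

Lemma ipNr q r : ip q (- r) = - ip q r.
Proof. by rewrite -[- r]scaleN1r ipZr rmorphN1 mulN1r. Qed.

(** For [ip], multiplication by x_j is symmetric and [gderiv j] is skew, which exchanges x_j - d_j
    and x_j + d_j. *)
Lemma ip_cre q r j : ip (cre j q) r = ip q (ann j r).
Proof.
by rewrite /cre /ann ipZl ipZr conjc_isqrt2 ipDl ipDr ip_mvar ipNl ip_gderiv opprK.
Qed.

Lemma ip_ann q r j : ip (ann j q) r = ip q (cre j r).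
Proof.
by rewrite /cre /ann ipZl ipZr conjc_isqrt2 ipDl ipDr ip_mvar ip_gderiv ipNr.
Qed.

Lemma ip_suml (I : Type) (s : seq I) (F : I -> MP) r :
  ip (\sum_(i <- s) F i) r = \sum_(i <- s) ip (F i) r.
Proof.
elim: s => [|i s IH]; last by rewrite !big_cons ipDl IH.
by rewrite !big_nil -(scale0r (0 : MP)) ipZl mul0r.
Qed.

Lemma ip_sumr (I : Type) (s : seq I) (F : I -> MP) q :
  ip q (\sum_(i <- s) F i) = \sum_(i <- s) ip q (F i).
Proof.
elim: s => [|i s IH]; last by rewrite !big_cons ipDr IH.
by rewrite !big_nil -(scale0r (0 : MP)) ipZr rmorph0 mul0r.
Qed.

Definition gnorm2 q : R := intg (fun x => normc (gfun q x) ^+ 2).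

Lemma gnorm2E q : ip q q = (gnorm2 q)%:C.
Proof.
rewrite /ip /pair /gnorm2 /rpair.
set q' := - 'i%C *: q; have s1 := schwartz_regfun q; have s2 := schwartz_regfun q'.
have -> : intg (fun x => normc (gfun q x) ^+ 2) =
    intg (fun x => regfun q x * regfun q x) + intg (fun x => regfun q' x * regfun q' x).
  rewrite -intgD; [|exact: schwartzM_integrable..].
  by congr intg; apply/funext => x; rewrite sqr_normcE Im_gfun !expr2.
have -> : intg (fun x => regfun q' x * regfun q x) = intg (fun x => regfun q x * regfun q' x).
  by congr intg; apply/funext => x; rewrite mulrC.
move: (intg _) (intg _) (intg _) => u v w.
by simpc => /=; congr Complex; ring.
Qed.

End gaussian_pairing.

(** * Laguerre functions *)

Section laguerre_functions.
Context (R : realType) (n k : nat).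
Local Notation V := 'rV[R]_n.
Local Notation MP := (mpoly.mpoly n R[i]).
Local Notation C := R[i].
Local Notation lebn := (lebesgue_tuple R n).
Local Notation mu := (k%:R + n%:R / 2 : R).
Local Notation muC := (@mu_of C n k).

(** A nonzero polynomial is nonzero at some point, the Gaussian vanishes nowhere, and a continuous
    nonnegative function that is positive somewhere has positive integral. *)
Lemma gnorm2_gt0 (q : MP) : q != 0 -> 0 < gnorm2 q.
Proof.
move=> q0; have [x0 hx0] : exists x0 : V, poly_eval q x0 != 0.
  apply/not_existsP => h; move/eqP: q0; apply; apply: poly_eval_eq0 => x.
  by apply/eqP; apply: contra_notT (h x).
have s1 := schwartz_regfun q; have s2 := schwartz_regfun (- 'i%C *: q).
pose F (x : V) := regfun q x * regfun q x + regfun (- 'i%C *: q) x * regfun (- 'i%C *: q) x.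
have FE x : normc (gfun q x) ^+ 2 = F x by rewrite sqr_normcE Im_gfun !expr2.
have c1 := schwartz_continuous s1; have c2 := schwartz_continuous s2.
have cF : continuous F.
  by move=> x; exact: continuousD (continuousM (c1 x) (c1 x)) (continuousM (c2 x) (c2 x)).
have F0 x : 0 <= F x by rewrite -FE sqr_ge0.
have Fx0 : 0 < F x0.
  rewrite -FE exprn_gt0// lt_def normc_ge0 andbT.
  apply: contraNneq hx0 => /eq0_normc /eqP; rewrite /gfun mulf_eq0 => /orP[//|].
  rewrite eq_complex /= => /andP[/eqP g0 _].
  by have := expR_gt0 (- (sqnorm x0 / 2)); rewrite -/(gauss x0) g0 ltxx.
have iF : lebn.-integrable setT (fun t => (F (rowT t))%:E).
  have h1 := schwartzM_integrable s1 s1; have h2 := schwartzM_integrable s2 s2.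
  exact: (integrableD _ h1 h2).
have := integral_gt0_of_pos cF F0 Fx0.
have -> : gnorm2 q = fine (\int[lebn]_t (F (rowT t))%:E)%E.
  by rewrite /gnorm2 /intg; apply: eq_Rintegral => t _; rewrite FE.
have := integrable_fin_num measurableT iF.
by move=> /fineK <-; rewrite lte_fin.
Qed.

Variable h : MP.
Hypotheses (hn : (0 < n)%N) (hh : harmonic_homog k h).

Lemma mu_gt0 : 0 < mu.
Proof. by rewrite ltr_wpDl// divr_gt0// ltr0n. Qed.

Lemma muCE : muC = mu%:C.
Proof.
by rewrite /mu_of rmorphD /= rmorphM /= !rmorph_nat fmorphV /= rmorph_nat.
Qed.

Lemma muC_gt0 : 0 < muC.
Proof. by rewrite muCE ltcR mu_gt0. Qed.

Let hhom : h \is mpoly.ishomog1 k mpoly.mdeg := proj1 hh.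
Let hharm : laplacian h = 0 := proj2 hh.

(** The polynomial factor of F_m, so that [gfun (lagq m)] is F_m. *)
Definition lagq m : MP := 'i%C ^+ m *: lag_poly k h m.

Lemma lagq0 : lagq 0 = h.
Proof.
rewrite /lagq /lag_poly big_ord1 /lag_coef /pochK !big_ord0 /radial !expr0 mul1r.
by rewrite fact0 mulr1n !mul1r invr1 !scale1r.
Qed.

Lemma pochKE (a : R) m : pochK (a%:C) m = (poch a m)%:C.
Proof.
rewrite /pochK /poch rmorph_prod; apply: eq_bigr => j _.
by rewrite rmorphD /= rmorph_nat.
Qed.

Lemma lagE m (t : R) : lag mu m t = 'i%C ^+ m *
  (\sum_(j < m.+1) lag_coef C n k m j * ((2 * t)%:C ^+ j)) * (expR (- t))%:C.
Proof.
rewrite /lag -mulrA mulr_suml rmorph_sum; congr (_ * _); apply: eq_bigr => j _.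
have -> : lag_coef C n k m j = (poch (- m%:R) j / (poch mu j * j`!%:R))%:C.
  rewrite /lag_coef muCE pochKE rmorphM /= fmorphV /= rmorphM /= rmorph_nat.
  by rewrite -(pochKE (- m%:R)) rmorphN /= rmorph_nat.
by rewrite -rmorphXn /= -!rmorphM.
Qed.

Lemma poly_eval_msqnormX j x : poly_eval (@msqnorm C n ^+ j) x = (sqnorm x)%:C ^+ j.
Proof.
elim: j => [|j IH]; first by rewrite !expr0 /poly_eval mpoly.meval1.
by rewrite !exprS poly_evalM IH poly_eval_msqnorm.
Qed.

Lemma gfun_lagq m x : gfun (lagq m) x = lag mu m (sqnorm x / 2) * poly_eval h x.
Proof.
rewrite /lagq gfunZ lagE /gfun /gauss /lag_poly poly_eval_sum.
have -> : 2 * (sqnorm x / 2) = sqnorm x :> R by field.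
move: (expR _) => g; rewrite -!mulrA; congr (_ * _).
rewrite [_%:C * poly_eval h x]mulrC mulrA; congr (_ * _); rewrite mulr_suml.
apply: eq_bigr => j _; rewrite poly_evalZ /radial poly_evalM poly_eval_msqnormX.
by rewrite mulrA.
Qed.

Lemma lagq_number m : \sum_j (cre j (ann j (lagq m)) + 2^-1 *: lagq m) =
  (2 * m%:R + muC) *: lagq m.
Proof.
rewrite number_opE /lagq eulerZ laplacianZ.
have := number_lag_poly hhom hharm muC_gt0 m => /(congr1 (fun p => 'i%C ^+ m *: p)).
rewrite scalerDr scalerBr !scalerA [2^-1 * _]mulrC [n%:R / 2 * _]mulrC => ->.
by rewrite mulrC.
Qed.

Lemma lagq_raise m : \sum_j cre j (cre j (lagq m)) =
  (2 * 'i%C * (m%:R + muC)) *: lagq m.+1.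
Proof.
rewrite raise_opE /lagq eulerZ laplacianZ -!scalerAr -!scalerBr -scalerDr.
rewrite (raise_lag_poly hhom hharm muC_gt0) !scalerA; congr (_ *: _).
have ii : 'i%C * 'i%C = -1 :> C by rewrite -expr2 sqr_i.
rewrite exprS; transitivity (2 * ('i%C * 'i%C) * (m%:R + muC) * 'i%C ^+ m); last by ring.
by rewrite ii; field.
Qed.

Lemma lagq_lowerS m : \sum_j ann j (ann j (lagq m.+1)) =
  (- (2 * 'i%C * m.+1%:R)) *: lagq m.
Proof.
rewrite lower_opE /lagq laplacianZ (laplacian_lag_polyS hhom hharm muC_gt0) !scalerA.
by congr (_ *: _); rewrite exprS; field.
Qed.

Lemma lagq_lower0 : \sum_j ann j (ann j (lagq 0)) = 0.
Proof. by rewrite lower_opE lagq0 hharm scaler0. Qed.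

(** Eigenvectors of the symmetric operator N for the distinct real eigenvalues 2m + mu and 2l +
    mu. *)
Lemma lagq_orthogonal m l : m != l -> ip (lagq m) (lagq l) = 0.
Proof.
move=> ml.
have E : ip (\sum_j (cre j (ann j (lagq m)) + 2^-1 *: lagq m)) (lagq l) =
    ip (lagq m) (\sum_j (cre j (ann j (lagq l)) + 2^-1 *: lagq l)).
  rewrite ip_suml ip_sumr; apply: eq_bigr => j _.
  rewrite ipDl ipDr ip_cre ip_ann (ipZl 2^-1) (ipZr 2^-1).
  by rewrite fmorphV rmorph_nat.
move: E; rewrite !lagq_number (ipZl (_ + _)) (ipZr (_ + _)) muCE.
have -> : (2 * l%:R + mu%:C)^* = 2 * l%:R + mu%:C :> C.
  by rewrite rmorphD rmorphM /= !rmorph_nat /=; congr (_ + _); apply/eqP; rewrite eq_complex /= oppr0 !eqxx.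
move=> /eqP; rewrite -subr_eq0 -mulrBl mulf_eq0 => /orP[|/eqP//].
rewrite opprD addrACA subrr addr0 -mulrBr mulf_eq0 pnatr_eq0 /= subr_eq0 eqr_nat.
by rewrite (negPf ml).
Qed.

(** The product of the raised F_m with F_(m+1) is computed twice: directly it is 2i (m + mu)
    |F_(m+1)|^2, and through the adjoint it is the conjugate of - 2i (m+1) times |F_m|^2. *)
Lemma gnorm2_lagqS m : (m%:R + mu) * gnorm2 (lagq m.+1) = m.+1%:R * gnorm2 (lagq m).
Proof.
have E : ip (\sum_j cre j (cre j (lagq m))) (lagq m.+1) =
    ip (lagq m) (\sum_j ann j (ann j (lagq m.+1))).
  by rewrite ip_suml ip_sumr; apply: eq_bigr => j _; rewrite !ip_cre.
move: E; rewrite lagq_raise lagq_lowerS (ipZl (_ * _)) (ipZr (- _)) !gnorm2E muCE.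
have -> : (- (2 * 'i%C * m.+1%:R))^* = 2 * 'i%C * m.+1%:R :> C.
  rewrite rmorphN !rmorphM /= !rmorph_nat /= -mulNr -mulrN; congr (_ * _ * _).
  by apply/eqP; rewrite eq_complex /= oppr0 opprK !eqxx.
move: (gnorm2 _) (gnorm2 _) => a b; rewrite -!mulrA => E.
have i0 : 'i%C != 0 :> C by rewrite eq_complex /= oner_eq0 andbF.
have two0 : 2%:R != 0 :> C by rewrite pnatr_eq0.
have := mulfI i0 (mulfI two0 E).
rewrite -(rmorph_nat (real_complex R)) -(rmorph_nat (real_complex R) m.+1).
by rewrite -rmorphD -!rmorphM => /(congr1 (@complex.Re R)).
Qed.

Lemma gnorm2_lagq m : gnorm2 (lagq m) = m`!%:R / poch mu m * gnorm2 h.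
Proof.
have p0 j : 0 < poch mu j.
  by apply: prodr_gt0 => i _; rewrite ltr_pwDl// mu_gt0.
elim: m => [|m IH].
  by rewrite lagq0 /poch big_ord0 fact0 divr1 mul1r.
have m0 : m%:R + mu != 0 by rewrite gt_eqF// ltr_wpDl// mu_gt0.
apply: (mulfI m0); rewrite gnorm2_lagqS IH factS natrM.
rewrite (_ : poch mu m.+1 = poch mu m * (mu + m%:R)); last by rewrite /poch big_ord_recr.
have := lt0r_neq0 (p0 m); move: m0; rewrite [m%:R + _]addrC.
move: (poch mu m) (mu) (m.+1%:R : R) (m%:R : R) (gnorm2 h) => a b c e f h1 h2.
by field; rewrite h1 h2.
Qed.

End laguerre_functions.

Lemma ImB (R : realType) (a b : R[i]) :
  complex.Im (a - b) = complex.Im a - complex.Im b.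
Proof. by case: a b => [? ?] [? ?]. Qed.

(** * Vector-valued L^2 functions *)

Section vector_L2.
Context (R : realType) (n p : nat).
Local Notation V := 'rV[R]_n.
Local Notation MP := (mpoly.mpoly n R[i]).
Local Notation C := R[i].
Local Notation lebn := (lebesgue_tuple R n).
Implicit Types (psi chi : V -> 'cV[C]_p) (phi : V -> R) (l : 'I_p).

Definition Rec psi l : n.-tuple (measurableTypeR R) -> R :=
  fun t => complex.Re (psi (rowT t) l 0).
Definition Imc psi l : n.-tuple (measurableTypeR R) -> R :=
  fun t => complex.Im (psi (rowT t) l 0).

Lemma L2norm2E psi : measurable_Cp psi -> L2norm2 psi =
  (\sum_l (\int[lebn]_t (Rec psi l t ^+ 2)%:E + \int[lebn]_t (Imc psi l t ^+ 2)%:E))%E.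
Proof.
move=> mp; rewrite /L2norm2.
have mR l : measurable_fun setT (fun t => (Rec psi l t ^+ 2)%:E).
  by apply/measurable_EFinP/measurable_funX; have [] := mp l.
have mI l : measurable_fun setT (fun t => (Imc psi l t ^+ 2)%:E).
  by apply/measurable_EFinP/measurable_funX; have [] := mp l.
transitivity (\int[lebn]_t \sum_l ((Rec psi l t ^+ 2)%:E + (Imc psi l t ^+ 2)%:E))%E.
  apply: eq_integral => t _; rewrite -sumEFin; apply: eq_bigr => l _.
  by rewrite sqr_normcE.
rewrite ge0_integral_sum//.
- apply: eq_bigr => l _; rewrite ge0_integralD//.
  + by move=> t _; rewrite lee_fin sqr_ge0.
  + by move=> t _; rewrite lee_fin sqr_ge0.
- by move=> l; apply: emeasurable_funD.
- by move=> l t _; rewrite -EFinD lee_fin addr_ge0// sqr_ge0.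
Qed.

Lemma in_L2P psi : in_L2 psi <->
  forall l, sqintegrable lebn (Rec psi l) /\ sqintegrable lebn (Imc psi l).
Proof.
split=> [[mp]|h].
  rewrite L2norm2E// => fin l; have [m1 m2] := mp l.
  have f0 l' : (0 <= \int[lebn]_t (Rec psi l' t ^+ 2)%:E +
                 \int[lebn]_t (Imc psi l' t ^+ 2)%:E)%E.
    by apply: adde_ge0; apply: integral_ge0 => t _; rewrite lee_fin sqr_ge0.
  have := le_lt_trans _ fin; move=> /(_ (\int[lebn]_t (Rec psi l t ^+ 2)%:E +
                 \int[lebn]_t (Imc psi l t ^+ 2)%:E)%E) H.
  have {}H := H _; rewrite (bigD1 l)//= in H.
  have {}H := H (leeDl _ (sume_ge0 (fun l' _ => f0 l') _)).
  split; split=> //; apply: le_lt_trans H.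
    by rewrite leeDl// integral_ge0// => t _; rewrite lee_fin sqr_ge0.
  by rewrite leeDr// integral_ge0// => t _; rewrite lee_fin sqr_ge0.
have mp : measurable_Cp psi by move=> l; have [[? _] [? _]] := h l.
split=> //; rewrite L2norm2E//; apply: lte_sum_pinfty => l _.
by have [[_ ?] [_ ?]] := h l; exact: lte_add_pinfty.
Qed.

(** The square of the norm as a real number. It agrees with the extended [L2norm2] on L^2, and
    allows real arithmetic there. *)
Definition L2nrm psi : R := \sum_l (sqnorm2 lebn (Rec psi l) + sqnorm2 lebn (Imc psi l)).

Lemma L2nrmE psi : in_L2 psi -> L2norm2 psi = (L2nrm psi)%:E.
Proof.
move=> Lp; have [mp _] := Lp; have /in_L2P h := Lp.
rewrite L2norm2E// /L2nrm -sumEFin; apply: eq_bigr => l _.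
by have [h1 h2] := h l; rewrite EFinD -!sqnorm2E.
Qed.

Lemma sqnorm2_le_L2nrm psi l :
  sqnorm2 lebn (Rec psi l) + sqnorm2 lebn (Imc psi l) <= L2nrm psi.
Proof.
rewrite /L2nrm (bigD1 l)//= lerDl sumr_ge0// => l' _.
by rewrite addr_ge0// sqnorm2_ge0.
Qed.

Lemma distr_of_bound psi phi l : in_L2 psi -> schwartz phi ->
  normc (distr_of psi phi l 0) ^+ 2 <=
    L2nrm psi * sqnorm2 lebn (fun t => phi (rowT t)).
Proof.
move=> /in_L2P /(_ l)[h1 h2] /schwartz_sqintegrable sp.
rewrite mxE sqr_normcE /=.
have c1 := cauchy_schwarz_Rintegral h1 sp; have c2 := cauchy_schwarz_Rintegral h2 sp.
apply: le_trans (lerD c1 c2) _; rewrite -mulrDl ler_wpM2r ?sqnorm2_ge0//.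
exact: sqnorm2_le_L2nrm.
Qed.

Lemma in_L2B psi chi : in_L2 psi -> in_L2 chi -> in_L2 (fun x => psi x - chi x).
Proof.
move=> /in_L2P h1 /in_L2P h2; apply/in_L2P => l.
have [a1 b1] := h1 l; have [a2 b2] := h2 l.
have E1 : Rec (fun x => psi x - chi x) l = (fun t => Rec psi l t + -1 * Rec chi l t).
  by apply/funext => t; rewrite /Rec !mxE ReB mulN1r.
have E2 : Imc (fun x => psi x - chi x) l = (fun t => Imc psi l t + -1 * Imc chi l t).
  by apply/funext => t; rewrite /Imc !mxE ImB mulN1r.
by rewrite E1 E2; split; apply: sqintegrableD => //; exact: sqintegrableZ.
Qed.

Lemma L2nrm_le psi chi : in_L2 psi -> in_L2 chi ->
  L2nrm chi <= 2 * L2nrm psi + 2 * L2nrm (fun x => psi x - chi x).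
Proof.
move=> Lp Lc; have Ld := in_L2B Lp Lc.
rewrite /L2nrm !mulr_sumr -big_split; apply: ler_sum => l _ /=.
have H (f g k : n.-tuple (measurableTypeR R) -> R) : sqintegrable lebn f ->
    sqintegrable lebn g -> sqintegrable lebn k -> (forall t, k t = f t - g t) ->
    sqnorm2 lebn g <= 2 * sqnorm2 lebn f + 2 * sqnorm2 lebn k.
  move=> If Ig Ik e; have I1 := sqr_integrable If; have I2 := sqr_integrable Ik.
  rewrite /sqnorm2 -RintegralZl// -RintegralZl//.
  have J1 : lebn.-integrable setT (EFin \o (fun t => 2 * f t ^+ 2)).
    exact: (integrableZl _ 2 I1).
  have J2 : lebn.-integrable setT (EFin \o (fun t => 2 * k t ^+ 2)).
    exact: (integrableZl _ 2 I2).
  rewrite -RintegralD//; apply: le_Rintegral => //.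
  - exact: sqr_integrable.
  - exact: (integrableD _ J1 J2).
  (* 2 f^2 + 2 (f - g)^2 - g^2 = (2 f - g)^2. *)
  - move=> t _; rewrite e; have := sqr_ge0 (2 * f t - g t).
    by rewrite !expr2; lra.
have /in_L2P/(_ l)[a1 b1] := Lp; have /in_L2P/(_ l)[a2 b2] := Lc.
have /in_L2P/(_ l)[a3 b3] := Ld.
have h1 := H _ _ _ a1 a2 a3; have h2 := H _ _ _ b1 b2 b3.
have := h1 _; have := h2 _; rewrite !mulrDr => {}h2 {}h1.
have {}h1 := h1 (fun t => _); have {}h2 := h2 (fun t => _).
apply: le_trans (lerD (h1 _) (h2 _)) _.
- by move=> t; rewrite /Rec !mxE ReB.
- by move=> t; rewrite /Imc !mxE ImB.
by rewrite addrACA.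
Qed.

Lemma distr_ofB psi chi phi l : in_L2 psi -> in_L2 chi -> schwartz phi ->
  distr_of (fun x => psi x - chi x) phi l 0 =
  distr_of psi phi l 0 - distr_of chi phi l 0.
Proof.
move=> /in_L2P/(_ l)[a1 b1] /in_L2P/(_ l)[a2 b2] /schwartz_sqintegrable sp.
rewrite !mxE; have h1 := mul_integrable a1 sp; have h2 := mul_integrable a2 sp.
have h3 := mul_integrable b1 sp; have h4 := mul_integrable b2 sp.
have -> : (\int[lebn]_t (complex.Re ((psi (rowT t) - chi (rowT t)) l 0) * phi (rowT t))) =
    \int[lebn]_t (Rec psi l t * phi (rowT t)) - \int[lebn]_t (Rec chi l t * phi (rowT t)).
  rewrite -RintegralB//; apply: eq_Rintegral => t _.
  by rewrite !mxE ReB mulrBl.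
have -> : (\int[lebn]_t (complex.Im ((psi (rowT t) - chi (rowT t)) l 0) * phi (rowT t))) =
    \int[lebn]_t (Imc psi l t * phi (rowT t)) - \int[lebn]_t (Imc chi l t * phi (rowT t)).
  rewrite -RintegralB//; apply: eq_Rintegral => t _.
  by rewrite !mxE ImB mulrBl.
by [].
Qed.

Definition gvec (Q : 'I_p -> MP) : V -> 'cV[C]_p := fun x => \col_l gfun (Q l) x.

Lemma Rec_gvec Q l : Rec (gvec Q) l = fun t => regfun (Q l) (rowT t).
Proof. by apply/funext => t; rewrite /Rec mxE. Qed.

Lemma Imc_gvec Q l : Imc (gvec Q) l = fun t => regfun (- 'i%C *: Q l) (rowT t).
Proof. by apply/funext => t; rewrite /Imc mxE Im_gfun. Qed.

Lemma gvec_in_L2 Q : in_L2 (gvec Q).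
Proof.
apply/in_L2P => l; rewrite Rec_gvec Imc_gvec.
by split; apply: schwartz_sqintegrable; exact: schwartz_regfun.
Qed.

Lemma gnorm2_split (q : MP) : gnorm2 q =
  sqnorm2 lebn (fun t => regfun q (rowT t)) +
  sqnorm2 lebn (fun t => regfun (- 'i%C *: q) (rowT t)).
Proof.
rewrite /sqnorm2 -RintegralD//; last 2 first.
- by apply: sqr_integrable; apply: schwartz_sqintegrable; exact: schwartz_regfun.
- by apply: sqr_integrable; apply: schwartz_sqintegrable; exact: schwartz_regfun.
by rewrite /gnorm2 /intg; apply: eq_Rintegral => t _; rewrite sqr_normcE Im_gfun.
Qed.

Lemma L2nrm_gvec Q : L2nrm (gvec Q) = \sum_l gnorm2 (Q l).
Proof.
by rewrite /L2nrm; apply: eq_bigr => l _; rewrite Rec_gvec Imc_gvec gnorm2_split.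
Qed.

Lemma distr_of_gvec Q phi l : distr_of (gvec Q) phi l 0 = pair (Q l) phi.
Proof.
rewrite mxE /pair /rpair /intg; congr Complex; apply: eq_Rintegral => t _.
  by rewrite mxE.
by rewrite mxE Im_gfun.
Qed.

End vector_L2.

(** * Laguerre series in L^2 *)

Lemma bounded_series_tail (R : realType) (f : nat -> R) :
  (forall m, 0 <= f m) -> (exists K, forall N, \sum_(0 <= m < N) f m <= K) ->
  forall e : R, 0 < e -> exists N, forall i j, (N <= i)%N -> (i <= j)%N ->
    \sum_(i <= m < j) f m <= e.
Proof.
move=> f0 [K hK] e e0.
have nd : nondecreasing_seq (series f).
  by apply/nondecreasing_seqP => m; rewrite seriesSr lerDl.
have /cvg_ex[L hL] : cvgn (series f).
  apply: nondecreasing_is_cvgn => //; exists K => _ [N _ <-]; exact: hK.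
have /cvgrPdist_lt /(_ e e0)[N _ hN] := hL.
exists N => i j Ni ij.
have hj : series f j <= L.
  by rewrite -(cvg_lim _ hL)//; apply: nondecreasing_cvgn_le => //; apply/cvg_ex; exists L.
have := hN i Ni; rewrite /= => hi.
have E : series f j = series f i + \sum_(i <= m < j) f m by rewrite /series/= -big_cat_nat.
have := ler_norm (L - series f i); lra.
Qed.

Lemma cvg_sum0 (R : realType) (I : Type) (r : seq I) (f : I -> nat -> R) :
  (forall i, f i @ \oo --> (0 : R)) ->
  (fun N => \sum_(i <- r) f i N) @ \oo --> (0 : R).
Proof.
move=> hf; elim: r => [|i r IH].
  by under eq_fun do rewrite big_nil; exact: cvg_cst.
under eq_fun do rewrite big_cons.
suff : (fun N => f i N + \sum_(i <- r) f i N) @ \oo --> (0 + 0 : R) by rewrite addr0.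
by apply: cvgD; [exact: hf|exact: IH].
Qed.

Section laguerre_sums.
Context (R : realType) (n p k : nat).
Local Notation V := 'rV[R]_n.
Local Notation MP := (mpoly.mpoly n R[i]).
Local Notation C := R[i].
Local Notation lebn := (lebesgue_tuple R n).
Variables (h : MP) (u : nat -> 'cV[C]_p).
Hypotheses (hn : (0 < n)%N) (hh : harmonic_homog k h).
Local Notation lq := (lagq k h).

Definition lsum (M N : nat) (l : 'I_p) : MP := \sum_(M <= m < N) u m l 0 *: lq m.

Lemma psi_termE m x l : psi_term k h u m x l 0 = gfun (u m l 0 *: lq m) x.
Proof. by rewrite mxE gfunZ gfun_lagq mulrC. Qed.

Lemma psi_sumE M N : (fun x => \sum_(M <= m < N) psi_term k h u m x) = gvec (lsum M N).
Proof.
apply/funext => x; apply/matrixP => l j; rewrite (ord1 j) summxE mxE.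
rewrite /lsum /gfun poly_eval_sum mulr_suml; apply: eq_bigr => m _.
exact: psi_termE.
Qed.

Lemma gnorm2_lsum M N l : gnorm2 (lsum M N l) =
  \sum_(M <= m < N) normc (u m l 0) ^+ 2 * gnorm2 (lq m).
Proof.
have : ip (lsum M N l) (lsum M N l) =
    (\sum_(M <= m < N) normc (u m l 0) ^+ 2 * gnorm2 (lq m))%:C.
  rewrite {1}/lsum ip_suml rmorph_sum /=.
  apply: eq_big_seq => m hm; rewrite (ipZl (u m l 0)) /lsum ip_sumr.
  rewrite (bigD1_seq m) ?iota_uniq//= big1 => [|m' mm'].
    rewrite addr0 (ipZr (u m l 0)) gnorm2E mulrA -sqr_normc normCE rmorphM /=.
    by rewrite rmorphXn.
  by rewrite (ipZr (u m' l 0)) (lagq_orthogonal hn hh) ?mulr0// eq_sym.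
by rewrite gnorm2E => /(congr1 (@complex.Re R)).
Qed.

Lemma L2_sumP psi : in_L2 psi -> L2_sum (psi_term k h u) psi ->
  forall e : R, 0 < e -> exists N, forall N', (N <= N')%N ->
    L2nrm (fun x => psi x - gvec (lsum 0 N') x) < e.
Proof.
move=> Lp Sp e e0.
have e0E : (0%:E < e%:E :> \bar R)%E by rewrite lte_fin.
have [N _ hN] := Sp _ (open_ereal_lt' e0E); exists N => N' NN'.
have := hN N' NN'; rewrite /=.
have -> : (fun x => psi x - \sum_(m < N') psi_term k h u m x) =
    (fun x => psi x - gvec (lsum 0 N') x).
  by rewrite -psi_sumE; apply/funext => x; rewrite big_mkord.
by rewrite L2nrmE ?lte_fin//; apply: in_L2B => //; exact: gvec_in_L2.
Qed.

(** By Cauchy-Schwarz, pairing with a fixed Schwartz function is continuous for the L^2 norm, so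
    convergence in L^2 implies convergence as distributions. *)
Lemma L2_sum_distr psi phi l : in_L2 psi -> L2_sum (psi_term k h u) psi -> schwartz phi ->
  ((fun N => distr_of (gvec (lsum 0 N)) phi l 0) : nat -> R[i]^o) @ \oo -->
    (distr_of psi phi l 0 : R[i]^o).
Proof.
move=> Lp Sp sp; apply/cvgC_normc => e e0.
set s := sqnorm2 lebn (fun t => phi (rowT t)).
have s0 : 0 <= s by exact: sqnorm2_ge0.
have d0 : 0 < e ^+ 2 / (s + 1) by rewrite divr_gt0 ?exprn_gt0// ltr_wpDl.
have [N hN] := L2_sumP Lp Sp d0.
exists N => // N' /= NN'; have hl := hN N' NN'.
have Ld := in_L2B Lp (gvec_in_L2 (lsum 0 N')).
rewrite -distr_ofB//; last exact: gvec_in_L2.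
rewrite -(@ltr_pXn2r _ 2)// ?nnegrE ?normc_ge0 ?ltW//.
apply: le_lt_trans (distr_of_bound l Ld sp) _; rewrite -/s.
apply: (@le_lt_trans _ _ (e ^+ 2 / (s + 1) * s)); first by rewrite ler_wpM2r// ltW.
by rewrite mulrAC ltr_pdivrMr ?ltr_wpDl// ltr_pM2l ?exprn_gt0// ltrDl.
Qed.

(** Some N has all partial sums from N on at squared distance less than 1 from psi, so their squared
    norms are at most 2 |psi|^2 + 2. By orthogonality these norms are sums of nonnegative terms,
    which bounds the shorter partial sums too. *)
Lemma L2_sum_bounded psi l : in_L2 psi -> L2_sum (psi_term k h u) psi ->
  exists K, forall N, \sum_(0 <= m < N) normc (u m l 0) ^+ 2 * gnorm2 (lq m) <= K.
Proof.
move=> Lp Sp; have [N hN] := L2_sumP Lp Sp ltr01.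
have g0 m : 0 <= normc (u m l 0) ^+ 2 * gnorm2 (lq m).
  rewrite mulr_ge0 ?sqr_ge0// gnorm2_split addr_ge0// sqnorm2_ge0//.
exists (2 * L2nrm psi + 2) => N'.
apply: (@le_trans _ _ (L2nrm (gvec (lsum 0 (maxn N N'))))).
  rewrite L2nrm_gvec (bigD1 l)//= gnorm2_lsum.
  rewrite [X in _ <= X + _](@big_cat_nat _ _ _ N')//= ?leq_maxr// -addrA lerDl.
  rewrite addr_ge0//; first by apply: sumr_ge0.
  by apply: sumr_ge0 => l' _; rewrite gnorm2_split addr_ge0// sqnorm2_ge0.
apply: le_trans (L2nrm_le Lp (gvec_in_L2 _)) _.
by have := hN (maxn N N') (leq_maxl _ _); lra.
Qed.

(** By orthogonality the squared distance of two partial sums is a tail of a bounded series.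
    Completeness is applied to the real and imaginary part of each coordinate, and psi is assembled
    from the limits. *)
Lemma L2_sum_exists : (forall l, exists K, forall N,
    \sum_(0 <= m < N) normc (u m l 0) ^+ 2 * gnorm2 (lq m) <= K) ->
  exists psi, L2_sum (psi_term k h u) psi /\ in_L2 psi.
Proof.
move=> hK.
have g0 l m : 0 <= normc (u m l 0) ^+ 2 * gnorm2 (lq m).
  by rewrite mulr_ge0 ?sqr_ge0// gnorm2_split addr_ge0// sqnorm2_ge0.
have tail l (e : R) : 0 < e -> exists N, forall i j, (N <= i)%N -> (i <= j)%N ->
    gnorm2 (lsum i j l) <= e.
  move=> e0; have [N hN] := bounded_series_tail (g0 l) (hK l) e0.
  by exists N => i j Ni ij; rewrite gnorm2_lsum; exact: hN.
have lsumB i j l : (i <= j)%N -> lsum 0 j l = lsum 0 i l + lsum i j l.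
  by move=> ij; rewrite /lsum -big_cat_nat.
(* The scalar c is 1 for real parts and - i for imaginary parts, so one argument covers both. *)
have cau (c : C) l (e : R) : (forall q : MP, sqnorm2 lebn (fun t => regfun (c *: q) (rowT t)) <= gnorm2 q) ->
    0 < e -> exists N, forall i j, (N <= i)%N -> (N <= j)%N ->
    (\int[lebn]_t ((regfun (c *: lsum 0 i l) (rowT t) - regfun (c *: lsum 0 j l) (rowT t)) ^+ 2)%:E
      <= e%:E)%E.
  move=> hc e0; have [N hN] := tail l e e0; exists N => i j Ni Nj.
  wlog ij : i j Ni Nj / (i <= j)%N => [H|].
    have [ij|ji] := leqP i j; first exact: H.
    have := H j i Nj Ni (ltnW ji).
    by under eq_integral do rewrite -sqrrN opprB.
  have E : (fun t => ((regfun (c *: lsum 0 i l) (rowT t) -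
      regfun (c *: lsum 0 j l) (rowT t)) ^+ 2)%:E) =
      (fun t => (regfun (c *: lsum i j l) (rowT t) ^+ 2)%:E).
    apply/funext => t; rewrite (lsumB i j l ij) scalerDr regfunD opprD addrA subrr add0r.
    by rewrite sqrrN.
  rewrite E sqnorm2E; last by apply: schwartz_sqintegrable; exact: schwartz_regfun.
  by rewrite lee_fin; apply: le_trans (hc _) _; exact: hN.
have mS (c : C) l N : measurable_fun setT (fun t : n.-tuple (measurableTypeR R) =>
    regfun (c *: lsum 0 N l) (rowT t)).
  by apply: continuous_rowT_measurable; apply: schwartz_continuous; exact: schwartz_regfun.
have h1 (q : MP) : sqnorm2 lebn (fun t => regfun ((1 : C) *: q) (rowT t)) <= gnorm2 q.
  by rewrite scale1r gnorm2_split lerDl sqnorm2_ge0.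
have h2 (q : MP) : sqnorm2 lebn (fun t => regfun (- 'i%C *: q) (rowT t)) <= gnorm2 q.
  by rewrite gnorm2_split lerDr sqnorm2_ge0.
have /choice[a ha] := fun l => L2_complete (mS 1 l) (fun e => cau 1 l e h1).
have /choice[b hb] := fun l => L2_complete (mS (- 'i%C) l) (fun e => cau (- 'i%C) l e h2).
pose psi (x : V) : 'cV[C]_p := \col_l (a l (tuple_of_row x) +i* b l (tuple_of_row x)).
have RE l : Rec psi l = a l by apply/funext => t; rewrite /Rec mxE rowTK.
have IE l : Imc psi l = b l by apply/funext => t; rewrite /Imc mxE rowTK.
have sq (c : C) l (f : n.-tuple (measurableTypeR R) -> R) : measurable_fun setT f ->
    (forall e : R, 0 < e -> exists N, forall i, (N <= i)%N ->
      (\int[lebn]_t ((regfun (c *: lsum 0 i l) (rowT t) - f t) ^+ 2)%:E <= e%:E)%E) ->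
    sqintegrable lebn f.
  move=> mf hf; have [N /(_ N (leqnn N)) hN] := hf 1 ltr01.
  rewrite (_ : f = fun t => regfun (c *: lsum 0 N l) (rowT t) +
    -1 * (regfun (c *: lsum 0 N l) (rowT t) - f t)); last first.
    by apply/funext => t; ring.
  apply: sqintegrableD; first by apply: schwartz_sqintegrable; exact: schwartz_regfun.
  apply: sqintegrableZ; split; first by apply: measurable_funB => //; exact: mS.
  by apply: le_lt_trans hN _; rewrite ltry.
have Lp : in_L2 psi.
  by apply/in_L2P => l; rewrite RE IE; split; [apply: (sq 1 l); case: (ha l)|
    apply: (sq (- 'i%C) l); case: (hb l)].
exists psi; split=> //; rewrite /L2_sum.
have -> : (fun N => L2norm2 (fun x => psi x - \sum_(m < N) psi_term k h u m x)) =
    (fun N => (L2nrm (fun x => psi x - gvec (lsum 0 N) x))%:E).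
  apply/funext => N; rewrite -L2nrmE; last by apply: in_L2B => //; exact: gvec_in_L2.
  by congr L2norm2; rewrite -psi_sumE; apply/funext => x; rewrite big_mkord.
apply: cvg_EFin; first exact: nearW.
have conv (c : C) l (f : n.-tuple (measurableTypeR R) -> R)
    (F : nat -> n.-tuple (measurableTypeR R) -> R) : measurable_fun setT f ->
    (forall e : R, 0 < e -> exists N, forall i, (N <= i)%N ->
      (\int[lebn]_t ((regfun (c *: lsum 0 i l) (rowT t) - f t) ^+ 2)%:E <= e%:E)%E) ->
    (forall i t, F i t = f t - regfun (c *: lsum 0 i l) (rowT t)) ->
    (fun N => sqnorm2 lebn (F N)) @ \oo --> (0 : R).
  move=> mf hf hF; apply/cvgrPdist_le => e e0; have [N hN] := hf e e0.
  exists N => // i /= Ni; rewrite sub0r normrN ger0_norm ?sqnorm2_ge0//.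
  have := hN i Ni.
  have -> : (fun t => ((regfun (c *: lsum 0 i l) (rowT t) - f t) ^+ 2)%:E) =
      (fun t => (F i t ^+ 2)%:E).
    by apply/funext => t; rewrite hF -sqrrN opprB.
  rewrite sqnorm2E ?lee_fin// (_ : F i = fun t => f t + -1 * regfun (c *: lsum 0 i l) (rowT t)).
    apply: sqintegrableD; first exact: (sq c l).
    by apply: sqintegrableZ; apply: schwartz_sqintegrable; exact: schwartz_regfun.
  by apply/funext => t; rewrite hF mulN1r.
rewrite /comp /L2nrm /=; apply: cvg_sum0 => l.
pose f1 N := sqnorm2 lebn (Rec (fun x => psi x - gvec (lsum 0 N) x) l).
pose f2 N := sqnorm2 lebn (Imc (fun x => psi x - gvec (lsum 0 N) x) l).
suff : (fun N => f1 N + f2 N) @ \oo --> (0 + 0 : R) by rewrite addr0.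
apply: cvgD.
- have [ma hl] := ha l; apply: (conv 1 l (a l)) => // i t.
  by rewrite -RE /Rec !mxE ReB scale1r.
- have [mb hl] := hb l; apply: (conv (- 'i%C) l (b l)) => // i t.
  by rewrite -IE /Imc !mxE ImB Im_gfun.
Qed.

End laguerre_sums.

(** * The oscillator on distributions and the recurrence *)

Section distribution_operators.
Context (R : realType) (n p : nat).
Local Notation V := 'rV[R]_n.
Local Notation MP := (mpoly.mpoly n R[i]).
Local Notation C := R[i].
Implicit Types (T : vdistribution R n p) (Q : 'I_p -> MP) (phi : V -> R).

Lemma creationE j T phi l : creation j T phi l 0 =
  isqrt2 R * (T (fun x => (x 0 j * phi x)%R) l 0 + T (pderiv j phi) l 0).
Proof. by rewrite /creation /dmulx /dderiv !mxE opprK. Qed.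

Lemma annihilationE j T phi l : annihilation j T phi l 0 =
  isqrt2 R * (T (fun x => (x 0 j * phi x)%R) l 0 - T (pderiv j phi) l 0).
Proof. by rewrite /annihilation /dmulx /dderiv !mxE. Qed.

Lemma oscillatorE (A B : 'M[C]_p) T phi l : oscillator A B T phi l 0 =
  \sum_l' A l l' * (\sum_j (creation j (annihilation j T) phi l' 0 + 2^-1 * T phi l' 0))
  - 'i%C * (\sum_l' B l l' * (\sum_j creation j (creation j T) phi l' 0))
  + 'i%C * (\sum_l' B^t* l l' * (\sum_j annihilation j (annihilation j T) phi l' 0)).
Proof.
rewrite /oscillator !mxE; congr (_ - 'i%C * _ + 'i%C * _).
- apply: eq_bigr => l' _; rewrite summxE; congr (_ * _).
  by apply: eq_bigr => j _; rewrite !mxE.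
- by apply: eq_bigr => l' _; rewrite summxE.
- by apply: eq_bigr => l' _; rewrite summxE.
Qed.

Definition represents T Q := forall phi, schwartz phi ->
  forall l, T phi l 0 = pair (Q l) phi.

Lemma pairB (q r : MP) phi : schwartz phi -> pair (q - r) phi = pair q phi - pair r phi.
Proof. by move=> sp; rewrite pairD// -scaleN1r pairZ// mulN1r. Qed.

Lemma pair_cre (q : MP) phi j : schwartz phi -> pair (cre j q) phi =
  isqrt2 R * (pair q (fun x => (x 0 j * phi x)%R) + pair q (pderiv j phi)).
Proof. by move=> sp; rewrite /cre pairZ// pairB// pair_mul_coord pair_pderiv. Qed.

Lemma pair_ann (q : MP) phi j : schwartz phi -> pair (ann j q) phi =
  isqrt2 R * (pair q (fun x => (x 0 j * phi x)%R) - pair q (pderiv j phi)).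
Proof.
by move=> sp; rewrite /ann pairZ// pairD// pair_mul_coord pair_pderiv// opprK.
Qed.

Lemma represents_creation j T Q : represents T Q ->
  represents (creation j T) (fun l => cre j (Q l)).
Proof.
move=> TQ phi sp l; rewrite creationE pair_cre// !TQ//; first exact: schwartz_pderiv.
exact: schwartz_mul_coord.
Qed.

Lemma represents_annihilation j T Q : represents T Q ->
  represents (annihilation j T) (fun l => ann j (Q l)).
Proof.
move=> TQ phi sp l; rewrite annihilationE pair_ann// !TQ//; first exact: schwartz_pderiv.
exact: schwartz_mul_coord.
Qed.

Definition dconverges (Tn : nat -> vdistribution R n p) T := forall phi, schwartz phi ->
  forall l, ((fun N => Tn N phi l 0) : nat -> R[i]^o) @ \oo --> (T phi l 0 : R[i]^o).

Lemma dconverges_creation j Tn T : dconverges Tn T ->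
  dconverges (fun N => creation j (Tn N)) (creation j T).
Proof.
move=> h phi sp l; rewrite (creationE j T phi l) (funext (fun N => creationE j (Tn N) phi l)).
apply: cvgCZ; apply: cvgCD; apply: h; last exact: schwartz_pderiv.
exact: schwartz_mul_coord.
Qed.

Lemma dconverges_annihilation j Tn T : dconverges Tn T ->
  dconverges (fun N => annihilation j (Tn N)) (annihilation j T).
Proof.
move=> h phi sp l; rewrite (annihilationE j T phi l) (funext (fun N => annihilationE j (Tn N) phi l)).
apply: cvgCZ; apply: cvgCB; apply: h; last exact: schwartz_pderiv.
exact: schwartz_mul_coord.
Qed.

(** The operators act on the test function, which remains Schwartz; hence convergence against all
    test functions passes through them although they are unbounded on L^2. *)
Lemma dconverges_oscillator (A B : 'M[C]_p) Tn T : dconverges Tn T ->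
  dconverges (fun N => oscillator A B (Tn N)) (oscillator A B T).
Proof.
move=> h phi sp l; apply: (cvgC_congr (funext (fun N => oscillatorE A B (Tn N) phi l)) (oscillatorE A B T phi l)).
apply: cvgCD; [apply: cvgCB|].
- apply: cvgC_sum => l'; apply: cvgCZ; apply: cvgC_sum => j; apply: cvgCD.
    exact: (dconverges_creation (dconverges_annihilation h)).
  by apply: cvgCZ; exact: h.
- apply: cvgCZ; apply: cvgC_sum => l'; apply: cvgCZ; apply: cvgC_sum => j.
  exact: (dconverges_creation (dconverges_creation h)).
- apply: cvgCZ; apply: cvgC_sum => l'; apply: cvgCZ; apply: cvgC_sum => j.
  exact: (dconverges_annihilation (dconverges_annihilation h)).
Qed.

(** Boundedness of F for the L^2 norm of [gfun q], in squared form to avoid square roots. *)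
Definition gbounded (F : MP -> C) := exists K, forall q, normc (F q) ^+ 2 <= K * gnorm2 q.

Lemma gnorm2_ge0 (q : MP) : 0 <= gnorm2 q.
Proof. by rewrite gnorm2_split addr_ge0// sqnorm2_ge0. Qed.

Lemma gbounded_pair phi : schwartz phi -> gbounded (fun q => pair q phi).
Proof.
move=> sp; exists (sqnorm2 (lebesgue_tuple R n) (fun t => phi (rowT t))) => q.
have := distr_of_bound (ord0 : 'I_1) (gvec_in_L2 (fun _ : 'I_1 => q)) sp.
by rewrite distr_of_gvec L2nrm_gvec big_ord1 mulrC.
Qed.

Lemma gboundedD F G : gbounded F -> gbounded G -> gbounded (fun q => F q + G q).
Proof.
move=> [K hK] [L hL]; exists (2 * K + 2 * L) => q.
have h : normc (F q + G q) ^+ 2 <= (normc (F q) + normc (G q)) ^+ 2.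
  by apply: lerXn2r; rewrite ?nnegrE ?addr_ge0 ?normc_ge0// le_normcD.
apply: le_trans h _; have := hK q; have := hL q.
have := sqr_ge0 (normc (F q) - normc (G q)).
rewrite mulrDl -!mulrA !expr2; lra.
Qed.

Lemma gboundedZ c F : gbounded F -> gbounded (fun q => c * F q).
Proof.
move=> [K hK]; exists (normc c ^+ 2 * K) => q.
rewrite normcM exprMn -[leRHS]mulrA; apply: ler_wpM2l; last exact: hK.
exact: sqr_ge0.
Qed.

Lemma gbounded_ext F G : F =1 G -> gbounded F -> gbounded G.
Proof. by move=> /funext ->. Qed.

Lemma gbounded_ann phi j : schwartz phi -> gbounded (fun q => pair (ann j q) phi).
Proof.
move=> sp; apply: (gbounded_ext (fun q => esym (pair_ann q j sp))).
apply: gboundedZ; apply: gboundedD; first by apply: gbounded_pair; exact: schwartz_mul_coord.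
apply: (@gbounded_ext (fun q => -1 * pair q (pderiv j phi))) => [q|].
  by rewrite mulN1r.
by apply: gboundedZ; apply: gbounded_pair; exact: schwartz_pderiv.
Qed.

Lemma gbounded_cre_ann phi j : schwartz phi ->
  gbounded (fun q => pair (cre j (ann j q)) phi).
Proof.
move=> sp; apply: (gbounded_ext (fun q => esym (pair_cre (ann j q) j sp))).
apply: gboundedZ; apply: gboundedD; apply: gbounded_ann.
  exact: schwartz_mul_coord.
exact: schwartz_pderiv.
Qed.

(** All operators are transposed to phi, so the bound involves only the norm of q itself, with a
    constant depending on phi. *)
Lemma gbounded_number phi : schwartz phi ->
  gbounded (fun q => pair (\sum_(j < n) (cre j (ann j q) + 2^-1 *: q)) phi).
Proof.
move=> sp; apply: (@gbounded_ext
   (fun q => \sum_(j < n) (pair (cre j (ann j q)) phi + 2^-1 * pair q phi))) => [q|].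
  by rewrite pair_sum//; apply: eq_bigr => j _; rewrite pairD// (pairZ 2^-1).
elim: (index_enum _) => [|j r IH].
  exists 0 => q; rewrite big_nil normc0 expr0n/= mul0r//.
apply: (@gbounded_ext (fun q => (pair (cre j (ann j q)) phi + 2^-1 * pair q phi) +
   \sum_(j <- r) (pair (cre j (ann j q)) phi + 2^-1 * pair q phi))) => [q|].
  by rewrite big_cons.
apply: gboundedD => //; apply: gboundedD; first exact: gbounded_cre_ann.
by apply: gboundedZ; exact: gbounded_pair.
Qed.

Lemma cre_sum j (I : Type) (r : seq I) (c : I -> C) (q : I -> MP) :
  cre j (\sum_(i <- r) c i *: q i) = \sum_(i <- r) c i *: cre j (q i).
Proof.
rewrite /cre /gderiv raddf_sum /= !mulr_sumr -!sumrB scaler_sumr; apply: eq_bigr => i _.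
rewrite mpoly.mderivZ -!scalerAr -!scalerBr !scalerA; congr (_ *: _).
by rewrite mulrC.
Qed.

Lemma ann_sum j (I : Type) (r : seq I) (c : I -> C) (q : I -> MP) :
  ann j (\sum_(i <- r) c i *: q i) = \sum_(i <- r) c i *: ann j (q i).
Proof.
rewrite /ann /gderiv raddf_sum /= !mulr_sumr -!sumrB -big_split scaler_sumr.
apply: eq_bigr => i _ /=.
rewrite mpoly.mderivZ -!scalerAr -!scalerBr -scalerDr !scalerA; congr (_ *: _).
by rewrite mulrC.
Qed.

Lemma cre2_sum j (I : Type) (r : seq I) (c : I -> C) (q : I -> MP) :
  cre j (cre j (\sum_(i <- r) c i *: q i)) = \sum_(i <- r) c i *: cre j (cre j (q i)).
Proof.
exact: etrans (congr1 (cre j) (cre_sum j r c q)) (cre_sum j r c (fun i => cre j (q i))).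
Qed.

Lemma ann2_sum j (I : Type) (r : seq I) (c : I -> C) (q : I -> MP) :
  ann j (ann j (\sum_(i <- r) c i *: q i)) = \sum_(i <- r) c i *: ann j (ann j (q i)).
Proof.
exact: etrans (congr1 (ann j) (ann_sum j r c q)) (ann_sum j r c (fun i => ann j (q i))).
Qed.

End distribution_operators.

Section entries.
Context (K : comNzRingType) (p : nat).
Implicit Types X Y Z W : 'cV[K]_p.

Lemma lincomb4_entry (a b c d : K) X Y Z W l :
  (a *: X + b *: Y + c *: Z - d *: W) l 0 =
  a * X l 0 + b * Y l 0 + c * Z l 0 - d * W l 0.
Proof. by rewrite !mxE. Qed.

Lemma lincomb3_entry (a c d : K) X Z W l :
  (a *: X + 0 + c *: Z - d *: W) l 0 = a * X l 0 + 0 + c * Z l 0 - d * W l 0.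
Proof. by rewrite !mxE. Qed.

(** Collects the coefficient of each a_m. Truncation leaves two discrepancies: raising the last term
    reaches a_(N+1), outside the sum, and the term with z_N, which would come from index N + 1, is
    missing. *)
Lemma telescope_recurrence (mu : K) (a x y z w : nat -> K) N :
  \sum_(0 <= m < N.+1) (2 * m%:R + mu) * a m * x m
  - - (\sum_(0 <= m < N.+1) 2 * (m%:R + mu) * a m.+1 * y m)
  + \sum_(0 <= m < N) 2 * m.+1%:R * a m * z m
  - 2 * \sum_(0 <= m < N.+1) a m * w m =
  \sum_(0 <= m < N.+1) a m * ((2 * m%:R + mu) * x m +
      (if m is m'.+1 then 2 * (m'%:R + mu) * y m' else 0) +
      2 * m.+1%:R * z m - 2 * w m)
   + 2 * (N%:R + mu) * a N.+1 * y N - 2 * N.+1%:R * a N * z N.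
Proof.
have -> : \sum_(0 <= m < N.+1) a m * ((2 * m%:R + mu) * x m +
      (if m is m'.+1 then 2 * (m'%:R + mu) * y m' else 0) +
      2 * m.+1%:R * z m - 2 * w m) =
    \sum_(0 <= m < N.+1) (2 * m%:R + mu) * a m * x m
    + \sum_(0 <= m < N) 2 * (m%:R + mu) * a m.+1 * y m
    + \sum_(0 <= m < N.+1) 2 * m.+1%:R * a m * z m
    - 2 * \sum_(0 <= m < N.+1) a m * w m.
  have -> : \sum_(0 <= m < N) 2 * (m%:R + mu) * a m.+1 * y m =
      \sum_(0 <= m < N.+1) a m * (if m is m'.+1 then 2 * (m'%:R + mu) * y m' else 0).
    by rewrite [RHS]big_nat_recl// mulr0 add0r; apply: eq_bigr => m _; ring.
  by rewrite mulr_sumr -!big_split -sumrB; apply: eq_bigr => m _ /=; ring.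
rewrite [\sum_(0 <= m < N.+1) 2 * (m%:R + mu) * _ * _]big_nat_recr//=.
rewrite [\sum_(0 <= m < N.+1) 2 * m.+1%:R * _ * _]big_nat_recr//=.
by ring.
Qed.

End entries.

(** * The oscillator on partial sums *)

Section recurrence.
Context (R : realType) (n p k : nat).
Local Notation V := 'rV[R]_n.
Local Notation MP := (mpoly.mpoly n R[i]).
Local Notation C := R[i].
Variables (h : MP) (u : nat -> 'cV[C]_p) (A B Cm : 'M[C]_p).
Hypotheses (hn : (0 < n)%N) (hh : harmonic_homog k h).
Local Notation lq := (lagq k h).
Local Notation muC := (@mu_of C n k).
Local Notation mu := (k%:R + n%:R / 2 : R).
Local Notation ls := (lsum k h u).

Lemma number_lsum N l :
  \sum_j (cre j (ann j (ls 0 N l)) + 2^-1 *: ls 0 N l) =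
  \sum_(0 <= m < N) u m l 0 *: ((2 * m%:R + muC) *: lq m).
Proof.
rewrite /lsum.
under eq_bigr => j _ do rewrite ann_sum cre_sum scaler_sumr -big_split /=.
rewrite exchange_big /=; apply: eq_bigr => m _; rewrite -lagq_number// scaler_sumr.
apply: eq_bigr => j _; rewrite [RHS]scalerDr (scalerA 2^-1 (u m l 0)).
by rewrite (scalerA (u m l 0) 2^-1) (mulrC 2^-1).
Qed.

Lemma raise_lsum N l : \sum_j cre j (cre j (ls 0 N l)) =
  \sum_(0 <= m < N) u m l 0 *: ((2 * 'i%C * (m%:R + muC)) *: lq m.+1).
Proof.
rewrite /lsum; rewrite (eq_bigr _ (fun j _ => cre2_sum j (index_iota 0 N) (fun m => u m l 0) lq)).
rewrite exchange_big /=; apply: eq_bigr => m _.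
by rewrite -(lagq_raise hn hh) scaler_sumr.
Qed.

(** The sum loses one term: F_0 is annihilated, and every other F_m moves down by one. *)
Lemma lower_lsum N l : \sum_j ann j (ann j (ls 0 N.+1 l)) =
  \sum_(0 <= m < N) u m.+1 l 0 *: ((- (2 * 'i%C * m.+1%:R)) *: lq m).
Proof.
rewrite /lsum; rewrite (eq_bigr _ (fun j _ => ann2_sum j (index_iota 0 N.+1) (fun m => u m l 0) lq)).
rewrite exchange_big /= big_nat_recl//.
rewrite -[X in X + _]scaler_sumr (lagq_lower0 hh) scaler0 add0r; apply: eq_bigr => m _.
by rewrite -(lagq_lowerS hn hh) scaler_sumr.
Qed.

Lemma pair_lincomb (c d : nat -> C) (q : nat -> MP) N phi : schwartz phi ->
  pair (\sum_(0 <= m < N) c m *: (d m *: q m)) phi =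
  \sum_(0 <= m < N) c m * (d m * pair (q m) phi).
Proof.
move=> sp; rewrite pair_sum//; apply: eq_bigr => m _.
by rewrite (pairZ (c m))// (pairZ (d m)).
Qed.

Lemma mulmx_lincomb (D : 'M[C]_p) (v : nat -> 'cV[C]_p) (c : nat -> C) N l :
  \sum_l' D l l' * (\sum_(0 <= m < N) v m l' 0 * c m) =
  \sum_(0 <= m < N) c m * (D *m v m) l 0.
Proof.
under eq_bigr => l' _ do rewrite mulr_sumr.
rewrite exchange_big /=; apply: eq_bigr => m _; rewrite mxE mulr_sumr.
by apply: eq_bigr => l' _; ring.
Qed.

(** Left side minus right side of the three-term recurrence at m: the coefficient of F_m in the
    oscillator equation and of z^m in the disc equation. The term with B is absent at m = 0, where
    nothing is raised into F_0. *)
Definition recurrence_vec (m : nat) : 'cV[C]_p :=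
  (2 * m%:R + muC) *: (A *m u m)
  + (if m is m'.+1 then (2 * (m'%:R + muC)) *: (B *m u m') else 0)
  + (2 * m.+1%:R) *: (B^t* *m u m.+1)
  - 2 *: (Cm *m u m).
Local Notation recv := recurrence_vec.

(** For a partial sum, the defect of the oscillator equation is the corresponding sum of recurrence
    defects up to the two boundary terms of [telescope_recurrence]. The factors i in the operator
    cancel those in the action on the F_m, since i^2 = -1. *)
Lemma oscillator_partial N phi l : schwartz phi ->
  oscillator A B (distr_of (gvec (ls 0 N.+1))) phi l 0
   - 2 * (Cm *m distr_of (gvec (ls 0 N.+1)) phi) l 0 =
  \sum_(0 <= m < N.+1) pair (lq m) phi * recv m l 0
   + 2 * (N%:R + muC) * pair (lq N.+1) phi * (B *m u N) l 0
   - 2 * N.+1%:R * pair (lq N) phi * (B^t* *m u N.+1) l 0.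
Proof.
move=> sp; set a := fun m => pair (lq m) phi.
have rep : represents (distr_of (gvec (ls 0 N.+1))) (ls 0 N.+1).
  by move=> f sf l'; exact: distr_of_gvec.
have E1 l' : \sum_j (creation j (annihilation j (distr_of (gvec (ls 0 N.+1)))) phi l' 0 +
    2^-1 * distr_of (gvec (ls 0 N.+1)) phi l' 0) =
    \sum_(0 <= m < N.+1) u m l' 0 * ((2 * m%:R + muC) * a m).
  rewrite -(pair_lincomb (fun m => u m l' 0) (fun m => 2 * m%:R + muC) lq)//.
  rewrite -number_lsum pair_sum//; apply: eq_bigr => j _.
  rewrite pairD// (pairZ 2^-1)//; congr (_ + _ * _); last exact: rep.
  exact: (@represents_creation R n p j _ _ (@represents_annihilation R n p j _ _ rep) phi sp l').
have E2 l' : \sum_j creation j (creation j (distr_of (gvec (ls 0 N.+1)))) phi l' 0 =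
    \sum_(0 <= m < N.+1) u m l' 0 * ((2 * 'i%C * (m%:R + muC)) * a m.+1).
  rewrite -(pair_lincomb (fun m => u m l' 0) (fun m => 2 * 'i%C * (m%:R + muC)) (fun m => lq m.+1))//.
  rewrite -raise_lsum pair_sum//; apply: eq_bigr => j _.
  exact: (@represents_creation R n p j _ _ (@represents_creation R n p j _ _ rep) phi sp l').
have E3 l' : \sum_j annihilation j (annihilation j (distr_of (gvec (ls 0 N.+1)))) phi l' 0 =
    \sum_(0 <= m < N) u m.+1 l' 0 * ((- (2 * 'i%C * m.+1%:R)) * a m).
  rewrite -(pair_lincomb (fun m => u m.+1 l' 0) (fun m => - (2 * 'i%C * m.+1%:R)) lq)//.
  rewrite -lower_lsum pair_sum//; apply: eq_bigr => j _.
  exact: (@represents_annihilation R n p j _ _ (@represents_annihilation R n p j _ _ rep) phi sp l').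
have O : oscillator A B (distr_of (gvec (ls 0 N.+1))) phi l 0 =
    \sum_(0 <= m < N.+1) (2 * m%:R + muC) * a m * (A *m u m) l 0
    - 'i%C * (\sum_(0 <= m < N.+1) 2 * 'i%C * (m%:R + muC) * a m.+1 * (B *m u m) l 0)
    + 'i%C * (\sum_(0 <= m < N) - (2 * 'i%C * m.+1%:R) * a m * (B^t* *m u m.+1) l 0).
  rewrite -(mulmx_lincomb A u (fun m => (2 * m%:R + muC) * a m)).
  rewrite -(mulmx_lincomb B u (fun m => 2 * 'i%C * (m%:R + muC) * a m.+1)).
  rewrite -(mulmx_lincomb (B^t*) (fun m => u m.+1) (fun m => - (2 * 'i%C * m.+1%:R) * a m)).
  apply: etrans (oscillatorE A B _ phi l) _; congr (_ - _ * _ + _ * _).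
  - by apply: eq_bigr => l' _; congr (_ * _); exact: E1.
  - by apply: eq_bigr => l' _; congr (_ * _); exact: E2.
  - by apply: eq_bigr => l' _; congr (_ * _); exact: E3.
apply: etrans (congr1 (fun z => z - _) O) _.
move=> {O E1 E2 E3 rep}.
have -> : (Cm *m distr_of (gvec (ls 0 N.+1)) phi) l 0 =
    \sum_(0 <= m < N.+1) a m * (Cm *m u m) l 0.
  rewrite -mulmx_lincomb mxE; apply: eq_bigr => l' _; congr (_ * _).
  rewrite distr_of_gvec /lsum pair_sum//; apply: eq_bigr => m _.
  by rewrite (pairZ (u m l' 0)).
rewrite -/(a N.+1) -/(a N).
have ii : 'i%C * 'i%C = -1 :> C by rewrite -expr2 sqr_i.
have -> : 'i%C * (\sum_(0 <= m < N.+1) 2 * 'i%C * (m%:R + muC) * a m.+1 * (B *m u m) l 0)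
    = - (\sum_(0 <= m < N.+1) 2 * (m%:R + muC) * a m.+1 * (B *m u m) l 0).
  rewrite mulr_sumr -sumrN; apply: eq_bigr => m _.
  transitivity (('i%C * 'i%C) * (2 * (m%:R + muC) * a m.+1 * (B *m u m) l 0)); first ring.
  by rewrite ii mulN1r.
have -> : 'i%C * (\sum_(0 <= m < N) - (2 * 'i%C * m.+1%:R) * a m * (B^t* *m u m.+1) l 0)
    = \sum_(0 <= m < N) 2 * m.+1%:R * a m * (B^t* *m u m.+1) l 0.
  rewrite mulr_sumr; apply: eq_bigr => m _.
  transitivity (- ('i%C * 'i%C) * (2 * m.+1%:R * a m * (B^t* *m u m.+1) l 0)); first ring.
  by rewrite ii opprK mul1r.
have -> : \sum_(0 <= m < N.+1) pair (lq m) phi * recv m l 0 =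
    \sum_(0 <= m < N.+1) a m * ((2 * m%:R + muC) * (A *m u m) l 0 +
      (if m is m'.+1 then 2 * (m'%:R + muC) * (B *m u m') l 0 else 0) +
      2 * m.+1%:R * (B^t* *m u m.+1) l 0 - 2 * (Cm *m u m) l 0).
  apply: eq_bigr => m _; congr (_ * _); rewrite /recurrence_vec.
  by case: m => [|m]; [exact: lincomb3_entry|exact: lincomb4_entry].
exact: (telescope_recurrence muC a (fun m => (A *m u m) l 0) (fun m => (B *m u m) l 0)
  (fun m => (B^t* *m u m.+1) l 0) (fun m => (Cm *m u m) l 0) N).
Qed.

End recurrence.

(** * Vanishing of the boundary terms *)

Lemma cvgC_shift (R : realType) (f : nat -> R[i]) (l : R[i]) :
  (f : nat -> R[i]^o) @ \oo --> (l : R[i]^o) ->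
  ((fun N => f N.+1) : nat -> R[i]^o) @ \oo --> (l : R[i]^o).
Proof. by rewrite -cvg_shiftS. Qed.

Lemma sub_scale_entry (K : comNzRingType) (p : nat) (c : K) (X Y : 'cV[K]_p) l :
  (X - c *: Y) l 0 = X l 0 - c * Y l 0 - 0 + 0.
Proof. by rewrite !mxE subr0 addr0. Qed.

Lemma mulrD_invD (K : fieldType) (v x : K) : v != 0 ->
  (x + v) * (1 + v^-1) = x + v + x * v^-1 + 1.
Proof. by move=> v0; rewrite mulrDl !mulrDr !mulr1 mulfV//; ring. Qed.

Lemma subr_addr_shift (K : zmodType) (x s a b : K) : x = s + a - b -> s = x - a + b.
Proof. by move=> ->; rewrite addrAC subrK addrK. Qed.

Section oscillator_limit.
Context (R : realType) (n p k : nat).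
Local Notation V := 'rV[R]_n.
Local Notation MP := (mpoly.mpoly n R[i]).
Local Notation C := R[i].
Variables (h : MP) (u : nat -> 'cV[C]_p) (A B Cm : 'M[C]_p).
Hypotheses (hn : (0 < n)%N) (hh : harmonic_homog k h).
Local Notation lq := (lagq k h).
Local Notation muC := (@mu_of C n k).
Local Notation mu := (k%:R + n%:R / 2 : R).
Local Notation ls := (lsum k h u).
Local Notation recv := (recurrence_vec n k u A B Cm).
Local Notation g m := (gnorm2 (lq m)).

Lemma pair_lagq_decay phi : schwartz phi -> exists K, 0 <= K /\ forall m,
  (2 * m%:R + mu) ^+ 2 * normc (pair (lq m) phi) ^+ 2 <= K * g m.
Proof.
move=> sp; have [K hK] := gbounded_number sp; exists `|K|; split=> // m.
apply: (@le_trans _ _ (K * g m)); last by rewrite ler_wpM2r ?gnorm2_ge0// ler_norm.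
have := hK (lq m); rewrite (lagq_number hn hh) (pairZ (2 * m%:R + muC))// normcM exprMn.
rewrite (_ : 2 * m%:R + muC = (2 * m%:R + mu)%:C); last first.
  by rewrite muCE [RHS]rmorphD /= (rmorphM _ 2) !rmorph_nat.
by rewrite normc_real real_normK ?num_real.
Qed.

(** A boundary term couples F_(N+1) with u_N, or F_N with u_(N+1), so consecutive norms must be
    comparable. The ratio |F_(m+1)|^2 / |F_m|^2 = (m + 1) / (m + mu) lies between 1 / (1 + mu) and 1
    + 1/mu for every mu > 0. *)
Lemma weight_ratio_up m : g m.+1 <= (1 + mu^-1) * g m.
Proof.
have mu0 := mu_gt0 R k hn.
have m0 : 0 < m%:R + mu by rewrite ltr_wpDl.
rewrite -(ler_pM2l m0) (gnorm2_lagqS hn hh) mulrA ler_wpM2r ?gnorm2_ge0//.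
have -> : (m%:R + mu) * (1 + mu^-1) = m%:R + mu + m%:R * mu^-1 + 1.
  by rewrite mulrD_invD ?lt0r_neq0.
have : 0 <= m%:R * mu^-1 by rewrite mulr_ge0// invr_ge0 ltW.
rewrite -(natr1 m); move: (m%:R * mu^-1) => z; lra.
Qed.

Lemma weight_ratio_down m : g m <= (1 + mu) * g m.+1.
Proof.
have mu0 := mu_gt0 R k hn.
have m0 : 0 < m.+1%:R :> R by [].
rewrite -(ler_pM2l m0) -(gnorm2_lagqS hn hh) mulrA ler_wpM2r ?gnorm2_ge0//.
have m1 : 0 <= m%:R * mu by rewrite mulr_ge0// ltW.
have -> : m.+1%:R * (1 + mu) = m%:R + mu + m%:R * mu + 1 by rewrite -(natr1 m); ring.
lra.
Qed.

Lemma bounded_series_cvg0 (f : nat -> R) : (forall m, 0 <= f m) ->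
  (exists K, forall N, \sum_(0 <= m < N) f m <= K) ->
  forall e, 0 < e -> exists N, forall m, (N <= m)%N -> f m <= e.
Proof.
move=> f0 hK e e0; have [N hN] := bounded_series_tail f0 hK e0.
by exists N => m Nm; have := hN m m.+1 Nm (leqnSn m); rewrite big_nat1.
Qed.

Lemma cvgC0_sqr_bound (f : nat -> C) (w : nat -> R) (K : R) :
  (forall e, 0 < e -> exists N, forall m, (N <= m)%N -> w m <= e) ->
  0 <= K -> (forall m, normc (f m) ^+ 2 <= K * w m) ->
  (f : nat -> R[i]^o) @ \oo --> (0 : R[i]^o).
Proof.
move=> hw K0 hf; apply/cvgC_normc => e e0.
have d0 : 0 < e ^+ 2 / (K + 1) by rewrite divr_gt0 ?exprn_gt0// ltr_wpDl.
have [N hN] := hw _ d0; exists N => // m /= Nm; rewrite sub0r normcN.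
rewrite -(@ltr_pXn2r _ 2)// ?nnegrE ?normc_ge0 ?ltW//.
apply: le_lt_trans (hf m) _.
apply: (@le_lt_trans _ _ (K * (e ^+ 2 / (K + 1)))); first by rewrite ler_wpM2l// hN.
by rewrite mulrCA gtr_pMr ?exprn_gt0// ltr_pdivrMr ?ltr_wpDl// mul1r ltrDl.
Qed.

Hypothesis hK : forall l, exists K, forall N,
  \sum_(0 <= m < N) normc (u m l 0) ^+ 2 * g m <= K.

Lemma weight_cvg0 l (e : R) : 0 < e -> exists N, forall m, (N <= m)%N ->
  normc (u m l 0) ^+ 2 * g m <= e.
Proof.
apply: bounded_series_cvg0 => // m; by rewrite mulr_ge0 ?sqr_ge0 ?gnorm2_ge0.
Qed.

(** The factor N + mu is absorbed by the decay of <F_(N+1), phi>; the square of the term is then at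
    most a constant times |u_N|^2 |F_(N+1)|^2, hence a constant times |u_N|^2 |F_N|^2, the term of a
    convergent series. *)
Lemma boundary_raise_cvg0 phi l : schwartz phi ->
  ((fun N => 2 * (N%:R + muC) * pair (lq N.+1) phi * u N l 0) : nat -> R[i]^o)
    @ \oo --> (0 : R[i]^o).
Proof.
move=> sp; have [K [K0 hd]] := pair_lagq_decay sp; have mu0 := mu_gt0 R k hn.
have c0 : 0 <= 1 + mu^-1 by rewrite addr_ge0// invr_ge0 ltW.
apply: (@cvgC0_sqr_bound _ (fun m => normc (u m l 0) ^+ 2 * g m)
  (4 * K * (1 + mu^-1)) (@weight_cvg0 l)) => [|m]; first by rewrite !mulr_ge0.
have -> : 2 * (m%:R + muC) = (2 * (m%:R + mu))%:C.
  by rewrite muCE [RHS]rmorphM [in RHS](rmorphD _ m%:R) /= !rmorph_nat.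
rewrite !normcM normc_real !exprMn real_normK ?num_real//.
have m0 : 0 <= m%:R :> R by [].
have h1 : (2 * (m%:R + mu)) ^+ 2 <= 4 * (2 * m.+1%:R + mu) ^+ 2.
  rewrite exprMn (_ : 2 ^+ 2 = 4) ?ler_wpM2l//; last by rewrite expr2; ring.
  by rewrite -(natr1 m); apply: lerXn2r; rewrite ?nnegrE; lra.
have h2 := ler_wpM2r (sqr_ge0 (normc (pair (lq m.+1) phi))) h1.
have h3 := ler_wpM2l (ler0n R 4) (hd m.+1).
have h4 := ler_wpM2l (mulr_ge0 (ler0n R 4) K0) (weight_ratio_up m).
have h5 : (2 * (m%:R + mu)) ^+ 2 * normc (pair (lq m.+1) phi) ^+ 2 <=
    4 * K * (1 + mu^-1) * g m.
  apply: le_trans h2 _; rewrite -[leLHS]mulrA; apply: le_trans h3 _.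
  by rewrite mulrA; apply: le_trans h4 _; rewrite mulrA.
have h6 := ler_wpM2r (sqr_ge0 (normc (u m l 0))) h5.
apply: le_trans h6 _; rewrite -[leLHS]mulrA.
by move: (g m) (_ ^+ 2) => x y; rewrite (mulrC x y).
Qed.

Lemma boundary_lower_cvg0 phi l : schwartz phi ->
  ((fun N => 2 * N.+1%:R * pair (lq N) phi * u N.+1 l 0) : nat -> R[i]^o)
    @ \oo --> (0 : R[i]^o).
Proof.
move=> sp; have [K [K0 hd]] := pair_lagq_decay sp; have mu0 := mu_gt0 R k hn.
have [c c0 hc] : exists2 c : R, 0 <= c & forall m : nat, 2 * m.+1%:R <= c * (2 * m%:R + mu).
  (* At m = 0 the requirement is 2 <= c mu, so c has to grow as mu approaches 0. *)
  exists (2 * (1 + mu^-1)); first by rewrite mulr_ge0// addr_ge0// invr_ge0 ltW.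
  move=> m; rewrite -[leRHS]mulrA ler_wpM2l//.
  have -> : (1 + mu^-1) * (2 * m%:R + mu) = 2 * m%:R + mu + 2 * (m%:R * mu^-1) + 1.
    by rewrite mulrC mulrD_invD ?lt0r_neq0// mulrA.
  have : 0 <= m%:R * mu^-1 by rewrite mulr_ge0// invr_ge0 ltW.
  have : 0 <= m%:R :> R by [].
  rewrite -(natr1 m); move: (m%:R * mu^-1) => z; lra.
have w0 (e : R) : 0 < e -> exists N, forall m, (N <= m)%N ->
    normc (u m.+1 l 0) ^+ 2 * g m.+1 <= e.
  by move=> /(@weight_cvg0 l)[N hN]; exists N => m Nm; apply: hN; exact: leqW.
apply: (@cvgC0_sqr_bound _ (fun m => normc (u m.+1 l 0) ^+ 2 * g m.+1)
  (c ^+ 2 * K * (1 + mu)) w0) => [|m].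
  by rewrite !mulr_ge0 ?sqr_ge0// addr_ge0// ltW.
have -> : 2 * m.+1%:R = (2 * m.+1%:R)%:C :> C by rewrite rmorphM /= !rmorph_nat.
rewrite !normcM normc_real !exprMn real_normK ?num_real//.
have m0 : 0 <= m%:R :> R by [].
have h1 : (2 * m.+1%:R) ^+ 2 <= c ^+ 2 * (2 * m%:R + mu) ^+ 2.
  by rewrite -exprMn; apply: lerXn2r => //; rewrite nnegrE ?mulr_ge0//; apply: addr_ge0; rewrite ?mulr_ge0 ?ltW.
have h2 := ler_wpM2r (sqr_ge0 (normc (pair (lq m) phi))) h1.
have h3 := ler_wpM2l (sqr_ge0 c) (hd m).
have h4 := ler_wpM2l (mulr_ge0 (sqr_ge0 c) K0) (weight_ratio_down m).
have h5 : (2 * m.+1%:R) ^+ 2 * normc (pair (lq m) phi) ^+ 2 <=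
    c ^+ 2 * K * (1 + mu) * g m.+1.
  apply: le_trans h2 _; rewrite -[leLHS]mulrA; apply: le_trans h3 _.
  by rewrite mulrA; apply: le_trans h4 _; rewrite mulrA.
have h6 := ler_wpM2r (sqr_ge0 (normc (u m.+1 l 0))) h5.
apply: le_trans h6 _; rewrite -[leLHS]mulrA.
by move: (g m.+1) (normc (u m.+1 l 0) ^+ 2) => x y; rewrite (mulrC x y).
Qed.

(** The defect of the oscillator equation, tested on phi, is the sum of the <F_m, phi> times the
    recurrence defects. Both implications between the equation and the recurrence are read off from
    this. *)
Lemma oscillator_limit psi phi l : in_L2 psi -> L2_sum (psi_term k h u) psi ->
  schwartz phi ->
  ((fun N => \sum_(0 <= m < N.+1) pair (lq m) phi * recv m l 0) : nat -> R[i]^o)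
    @ \oo --> ((oscillator A B (distr_of psi) phi - 2 *: (Cm *m distr_of psi phi)) l 0 : R[i]^o).
Proof.
move=> Lp Sp sp.
have dT : dconverges (fun N => distr_of (gvec (ls 0 N))) (distr_of psi).
  by move=> f sf l'; exact: L2_sum_distr.
have cO := @dconverges_oscillator _ _ _ A B _ _ dT phi sp l.
have cC : ((fun N => (Cm *m distr_of (gvec (ls 0 N)) phi) l 0) : nat -> R[i]^o) @ \oo -->
    ((Cm *m distr_of psi phi) l 0 : R[i]^o).
  rewrite mxE (_ : (fun N => _) = fun N => \sum_l' Cm l l' * distr_of (gvec (ls 0 N)) phi l' 0).
    by apply: cvgC_sum => l'; apply: cvgCZ; exact: dT.
  by apply/funext => N; rewrite mxE.
have FF : Filter (\oo : set_system nat) by exact: _.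
have c1 := cvgCB FF cO (@cvgCZ R _ _ FF 2 _ _ cC).
have mulmx_cvg0 (D : 'M[C]_p) (c : nat -> C) (v : nat -> 'cV[C]_p) :
    (forall l', ((fun N => c N * v N l' 0) : nat -> R[i]^o) @ \oo --> (0 : R[i]^o)) ->
    ((fun N => c N * (D *m v N) l 0) : nat -> R[i]^o) @ \oo --> (0 : R[i]^o).
  move=> hc; pose f l' N : C := D l l' * (c N * v N l' 0).
  apply: (@cvgC_congr R _ _ _ (fun N => \sum_l' f l' N) _ (\sum_l' D l l' * 0)).
  - apply/funext => N; rewrite mxE mulr_sumr; apply: eq_bigr => l' _.
    exact: mulrCA.
  - by rewrite big1// => l' _; rewrite mulr0.
  - by apply: cvgC_sum => l'; apply: cvgCZ; exact: hc.
have bR := mulmx_cvg0 B _ u (fun l' => boundary_raise_cvg0 l' sp).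
have bL := mulmx_cvg0 (B^t*) _ (fun N => u N.+1) (fun l' => boundary_lower_cvg0 l' sp).
have c2 := cvgC_shift c1.
have c3 := cvgCD FF (cvgCB FF c2 bR) bL.
apply: (cvgC_congr _ _ c3).
  apply/funext => N; have := oscillator_partial u A B Cm hn hh N l sp.
  exact: subr_addr_shift.
exact: sub_scale_entry.
Qed.

End oscillator_limit.

(** * The oscillator equation is equivalent to the recurrence *)

Section oscillator_equation.
Context (R : realType) (n p k : nat).
Local Notation V := 'rV[R]_n.
Local Notation MP := (mpoly.mpoly n R[i]).
Local Notation C := R[i].
Variables (h : MP) (u : nat -> 'cV[C]_p) (A B Cm : 'M[C]_p).
Hypotheses (hn : (0 < n)%N) (hh : harmonic_homog k h).
Local Notation lq := (lagq k h).
Local Notation mu := (k%:R + n%:R / 2 : R).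
Local Notation recv := (recurrence_vec n k u A B Cm).
Variable psi : V -> 'cV[C]_p.
Hypotheses (Lp : in_L2 psi) (Sp : L2_sum (psi_term k h u) psi).

Let lim_recurrence phi l (sp : schwartz phi) :=
  @oscillator_limit R n p k h u A B Cm hn hh
    (fun l => L2_sum_bounded hn hh l Lp Sp) psi phi l Lp Sp sp.

Lemma oscillator_of_recurrence : (forall m, recv m = 0) ->
  forall phi, schwartz phi ->
    oscillator A B (distr_of psi) phi = 2 *: (Cm *m distr_of psi phi).
Proof.
move=> r0 phi sp; apply/eqP; rewrite -subr_eq0; apply/eqP/matrixP => l j.
rewrite (ord1 j) [RHS]mxE.
have H := @lim_recurrence phi l sp; apply: (cvgC_unique H).
have -> : (fun N => \sum_(0 <= m < N.+1) pair (lq m) phi * recv m l 0) = fun=> 0.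
  by apply/funext => N; rewrite big1// => m _; rewrite r0 mxE mulr0.
exact: cvg_cst.
Qed.

Lemma recurrence_of_oscillator : h != 0 ->
  (forall phi, schwartz phi ->
    oscillator A B (distr_of psi) phi = 2 *: (Cm *m distr_of psi phi)) ->
  forall m, recv m = 0.
Proof.
move=> h0 osc M; apply/matrixP => l j; rewrite (ord1 j) [RHS]mxE.
have lim0 phi : schwartz phi ->
    ((fun N => \sum_(0 <= m < N.+1) pair (lq m) phi * recv m l 0) : nat -> R[i]^o)
      @ \oo --> (0 : R[i]^o).
  move=> sp; have := @lim_recurrence phi l sp.
  by rewrite (osc _ sp) subrr mxE.
have FF : Filter (\oo : set_system nat) by exact: _.
(* The tests on the real part and on the imaginary part of F_M combine into the product with the
   conjugate of F_M. *)
have := cvgCB FF (lim0 _ (schwartz_regfun (lq M)))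
  (@cvgCZ R _ _ FF 'i%C _ _ (lim0 _ (schwartz_regfun (- 'i%C *: lq M)))).
move=> c; have {}c : ((fun N => \sum_(0 <= m < N.+1) ip (lq m) (lq M) * recv m l 0)
    : nat -> R[i]^o) @ \oo --> (0 : R[i]^o).
  apply: (cvgC_congr _ _ c); last by rewrite mulr0 subr0.
  apply/funext => N; rewrite mulr_sumr -sumrB; apply: eq_bigr => m _.
  by rewrite /ip mulrBl mulrA.
(* By orthogonality the partial sums are constant as soon as they contain index M. *)
have {}c : ((fun=> (gnorm2 (lq M))%:C * recv M l 0) : nat -> R[i]^o) @ \oo --> (0 : R[i]^o).
  apply: cvg_trans c; apply: near_eq_cvg; exists M => // N /= MN.
  rewrite (bigD1_seq M) ?iota_uniq ?mem_index_iota//= gnorm2E big1 ?addr0// => m mM.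
  by rewrite (lagq_orthogonal hn hh mM) mul0r.
have /eqP : (gnorm2 (lq M))%:C * recv M l 0 = 0.
  by apply: (cvgC_unique _ c); exact: cvg_cst.
rewrite mulf_eq0 => /orP[|/eqP //].
rewrite (gnorm2_lagq hn hh) => /eqP H; have {H} /eqP := congr1 (@complex.Re R) H.
rewrite /=.
have g0 := gnorm2_gt0 h0.
have p0 : 0 < poch mu M by apply: prodr_gt0 => i _; rewrite ltr_pwDl// mu_gt0.
by rewrite gt_eqF// mulr_gt0// divr_gt0// ltr0n fact_gt0.
Qed.

End oscillator_equation.

(** * The equation on the disc *)

Section disc_equation.
Context (R : realType) (n p k : nat).
Local Notation C := R[i].
Variables (u : nat -> 'cV[C]_p) (A B Cm : 'M[C]_p).
Local Notation mu := (k%:R + n%:R / 2 : R).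
Local Notation recv := (recurrence_vec n k u A B Cm).

Definition disc_defect (f : R[i]^o -> 'cV[C]_p) (z : R[i]^o) : 'cV[C]_p :=
  - (A *m componentwise (tauH mu) f z)
  + 2 *: (B *m componentwise (tauF mu) f z)
  - 2 *: (B^t* *m componentwise (@tauE R) f z)
  - 2 *: (Cm *m f z).

(** At z^m the operators tau(H), tau(F) and tau(E) give - (2m + mu) u_m, (m - 1 + mu) u_(m-1) and -
    (m + 1) u_(m+1). The signs in the disc equation turn these into the terms of the recurrence. *)
Lemma power_sum_disc_defect f l :
  (forall l', power_sum (fun m => u m l' 0) (coordf f l')) ->
  power_sum (fun m => recv m l 0) (fun z => disc_defect f z l 0).
Proof.
move=> uf.
have cw (tau : (R[i]^o -> R[i]^o) -> R[i]^o -> R[i]^o) (v : nat -> 'cV[C]_p) (D : 'M[C]_p) :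
    (forall l', power_sum (fun m => v m l' 0) (tau (coordf f l'))) ->
    power_sum (fun m => (D *m v m) l 0) (fun z => (D *m componentwise tau f z) l 0).
  move=> h; apply: power_sum_mulmx => l'.
  by apply: (eq_power_sum _ _ (h l')) => [//|z]; rewrite mxE.
have hH : power_sum (fun m => (A *m ((- (2 * m%:R + mu%:C)) *: u m)) l 0)
    (fun z => (A *m componentwise (tauH mu) f z) l 0).
  apply: cw => l'; apply: (eq_power_sum _ _ (power_sum_tauH mu (uf l'))) => // m.
  by rewrite mxE mulNr.
have hF : power_sum (fun m => (B *m (if m is m'.+1 then (m'%:R + mu%:C) *: u m' else 0)) l 0)
    (fun z => (B *m componentwise (tauF mu) f z) l 0).
  apply: cw => l'; apply: (eq_power_sum _ _ (power_sum_tauF mu (uf l'))) => // m.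
  by case: m => [|m]; rewrite mxE.
have hE : power_sum (fun m => (B^t* *m ((- m.+1%:R) *: u m.+1)) l 0)
    (fun z => (B^t* *m componentwise (@tauE R) f z) l 0).
  apply: cw => l'; apply: (eq_power_sum _ _ (power_sum_tauE (uf l'))) => // m.
  by rewrite mxE mulNr.
have hC : power_sum (fun m => (Cm *m u m) l 0) (fun z => (Cm *m f z) l 0).
  exact: power_sum_mulmx.
have H := power_sumB (power_sumB (power_sumB (power_sumZ 2 hF) hH) (power_sumZ 2 hE))
  (power_sumZ 2 hC).
apply: (eq_power_sum _ _ H) => [m|z].
  rewrite /recurrence_vec muCE; case: m => [|m]; rewrite ?mulmx0 -!scalemxAr.
    move: (A *m _) (B^t* *m _) (Cm *m _) (mu%:C) => X Z W c.
    by rewrite !mxE; ring.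
  move: (A *m _) (B *m _) (B^t* *m _) (Cm *m _) (mu%:C) => X Y Z W c.
  by rewrite !mxE; ring.
rewrite /disc_defect.
move: (A *m _) (B *m _) (B^t* *m _) (Cm *m _) => X Y Z W; rewrite !mxE.
by congr (_ - _ - _); rewrite addrC.
Qed.

End disc_equation.

Arguments power_sum_disc_defect {R} n {p} k {u} A B Cm {f} l.

(** * The equivalence of the two problems *)

Theorem theorem4p1 (R : realType) (n p k : nat) (hn : (1 <= n)%N) (hp : (1 <= p)%N)
  (A B C : 'M[R[i]]_p) (hA : A = A^t*) (hC : C = C^t*)
  (h : mpoly.mpoly n R[i]) (hh : harmonic_homog k h) (h0 : h != 0)
  (u : nat -> 'cV[R[i]]_p) :
  let mu : R := k%:R + n%:R / 2 in
  (exists psi : 'rV[R]_n -> 'cV[R[i]]_p,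
     [/\ L2_sum (psi_term k h u) psi,
         in_L2 psi
       & forall phi : 'rV[R]_n -> R, schwartz phi ->
           oscillator A B (distr_of psi) phi
             = 2 *: (C *m distr_of psi phi)])
  <->
  (exists f : R[i]^o -> 'cV[R[i]]_p,
     [/\ forall l : 'I_p, power_sum (fun m => u m l 0) (coordf f l),
         forall l : 'I_p, in_Hmu mu (coordf f l)
       & forall z : R[i]^o, in_D z ->
           - (A *m componentwise (tauH mu) f z)
           + 2 *: (B *m componentwise (tauF mu) f z)
           - 2 *: (B^t* *m componentwise (@tauE R) f z)
             = 2 *: (C *m f z)]).
Proof.
move=> mu; have mu0 : 0 < mu := mu_gt0 R k hn; have g0 := gnorm2_gt0 h0.
have weightE (l : 'I_p) N : \sum_(0 <= m < N) normc (u m l 0) ^+ 2 * gnorm2 (lagq k h m) =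
    gnorm2 h * \sum_(0 <= m < N) m`!%:R / poch mu m * normc (u m l 0) ^+ 2.
  rewrite mulr_sumr; apply: eq_bigr => m _; rewrite (gnorm2_lagq hn hh).
  by rewrite mulrA mulrC [_ ^+ 2 * _]mulrC.
split=> [[psi [Sp Lp osc]]|[f [uf fH ode]]].
- have rec0 := recurrence_of_oscillator hn hh Lp Sp h0 osc.
  have hK l : exists K, forall N,
      \sum_(0 <= m < N) m`!%:R / poch mu m * normc (u m l 0) ^+ 2 <= K.
    have [K hK] := L2_sum_bounded hn hh l Lp Sp.
    exists (K / gnorm2 h) => N; rewrite ler_pdivlMr// mulrC -weightE; exact: hK.
  (* The bound on the weighted coefficients makes the series of u converge on the whole disc, which
     produces f coordinate by coordinate. *)
  have /choice[F hF] l := subexponential_power_sum (weighted_subexponential mu0 (hK l)).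
  pose f (z : R[i]^o) : 'cV[R[i]]_p := \col_l F l z.
  have fE l : coordf f l = F l by apply/funext => z; rewrite /coordf mxE.
  have uf l : power_sum (fun m => u m l 0) (coordf f l) by rewrite fE; exact: hF.
  exists f; split=> // [l|z zD].
    have [dF _] := power_sum_derive (uf l).
    split=> //; exists (fun m => u m l 0); split=> //.
    by apply/(Hmu_norm2_bounded mu0).
  apply/eqP; rewrite -subr_eq0; apply/eqP/matrixP => l j; rewrite (ord1 j) [RHS]mxE.
  apply: (power_sum_of0 (power_sum_disc_defect n k A B C l uf)) => // m.
  by rewrite rec0 mxE.
have hK l : exists K, forall N,
    \sum_(0 <= m < N) m`!%:R / poch mu m * normc (u m l 0) ^+ 2 <= K.
  have [_ [a [af fin]]] := fH l; apply/(Hmu_norm2_bounded mu0).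
  (* Membership in H_mu comes with its own coefficient sequence; uniqueness of power series
     coefficients identifies it with u. *)
  by rewrite (_ : (fun m => _) = a)//; apply/funext => m; exact: power_sum_inj (uf l) af m.
have rec0 m : recurrence_vec n k u A B C m = 0.
  apply/matrixP => l j; rewrite (ord1 j) [RHS]mxE.
  (* The recurrence defects are the Taylor coefficients of the disc defect, which vanishes on the
     disc, so each of them is 0. *)
  apply: (@power_sum0_eq0 _ (fun m => recurrence_vec n k u A B C m l 0)) => z zD.
  have := power_sum_disc_defect n k A B C l uf z zD.
  have -> : disc_defect n k A B C f z = 0; last by rewrite mxE.
  by apply/eqP; rewrite subr_eq0; apply/eqP; exact: ode.
have [psi [Sp Lp]] : exists psi, L2_sum (psi_term k h u) psi /\ in_L2 psi.
  apply: L2_sum_exists => // l; have [K hK'] := hK l.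
  by exists (gnorm2 h * K) => N; rewrite weightE ler_pM2l.
exists psi; split=> //; exact: (oscillator_of_recurrence hn hh Lp Sp rec0).
Qed.
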